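(* Let $\Omega\subseteq\mathbb H$ be a basic domain and let $g\in\mathcal{SR}(\Omega)$ be a slice-regular function that does not vanish in $\Omega$. Then for every $z\in\Omega$ there exist an open axially symmetric neighbourhood $U\subset\Omega$ of $z$ and a function $f\in\mathcal{SR}(U)$ such that $\exp_*(f)=g$ on $U$.
   Context: $\mathbb H$ is the skew field of quaternions, $\mathbb S=\{q\in\mathbb H: q^2=-1\}$, $\mathbb C_I=\mathbb R+I\mathbb R$ for $I\in\mathbb S$, and $\Omega_I=\Omega\cap\mathbb C_I$. A domain is a connected open set. An open set $\Omega$ is axially symmetric if $x+Iy\in\Omega$ ($x,y\in\mathbb R$, $I\in\mathbb S$) implies $x+\mathbb Sy\subset\Omega$. A domain is basic if it is axially symmetric and every connected component (there are one or two) of $\Omega_I$ is simply connected for one (hence all) $I$. Let $\Omega$ be axially symmetric open. Let $\mathbb H_{\mathbb C}=\mathbb H+\iota\mathbb H$ be the complexification ($\iota^2=-1$, $\iota$ central, with involution $\overline{x+\iota y}=x-\iota y$), and $\Omega_\iota=\{x+\iota y: x,y\in\mathbb R,\ x+Iy\in\Omega\}$. A stem function is $F=F_1+\iota F_2:\Omega_\iota\to\mathbb H_{\mathbb C}$ with $F(\bar z)=\overline{F(z)}$; it induces the slice function $f(x+Jy)=F_1(x+\iota y)+JF_2(x+\iota y)$, $J\in\mathbb S$. $f$ is slice-regular if $F$ is holomorphic; $\mathcal{SR}(\Omega)$ is the set of slice-regular functions on $\Omega$. The $*$-product $f*g$ is the slice function induced by the pointwise product $FG$ of stem functions, and $\exp_*(f)=\sum_{n\ge0}f^{*n}/n!$,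 where $f^{*n}$ is the $n$-th $*$-power. *)

(* Defs.v *)
(* MathComp / MathComp-Analysis; the reals are an arbitrary R : realType. *)
From HB Require Import structures.
From mathcomp Require Import all_boot all_order all_algebra.
From mathcomp Require Import ring lra complex.
From mathcomp Require Import all_classical all_reals all_analysis.
Set Implicit Arguments.
Unset Strict Implicit.
Unset Printing Implicit Defensive.
Import Order.TTheory GRing.Theory Num.Theory.
Import numFieldNormedType.Exports.
Local Open Scope classical_set_scope.
Local Open Scope ring_scope.

(* The quaternion algebra over K, carried by the normed space of row vectors
   (a, b, c, d) = a + b i + c j + d k.  At K = R this is the skew field H; at
   K = R[i] it is the complexification H_C = H + iota H, the central element
   iota acting as the scalar 'i (see complexification_decomp below).  The norm
   is the sup norm, which induces the usual topology. *)
Definition quat (K : numFieldType) : Type := 'rV[K]_4.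

#[warnings="-redundant-canonical-projection"]
HB.instance Definition _ (K : numFieldType) :=
  NormedModule.copy (quat K) 'rV[K]_4.

Section QuatRing.
Variable K : numFieldType.
Implicit Types (p q : quat K) (a b c d : K).

Definition qmk a b c d : quat K := \row_(k < 4) [:: a; b; c; d]`_k.

Definition q_re q : K := (q : 'rV[K]_4) 0 0.
Definition q_i q : K := (q : 'rV[K]_4) 0 1.
Definition q_j q : K := (q : 'rV[K]_4) 0 2.
Definition q_k q : K := (q : 'rV[K]_4) 0 3.

Definition mulq p q : quat K := qmk
  (q_re p * q_re q - q_i p * q_i q - q_j p * q_j q - q_k p * q_k q)
  (q_re p * q_i q + q_i p * q_re q + q_j p * q_k q - q_k p * q_j q)
  (q_re p * q_j q - q_i p * q_k q + q_j p * q_re q + q_k p * q_i q)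
  (q_re p * q_k q + q_i p * q_j q - q_j p * q_i q + q_k p * q_re q).

Definition oneq : quat K := qmk 1 0 0 0.

Lemma quat_ext p q : q_re p = q_re q -> q_i p = q_i q -> q_j p = q_j q ->
  q_k p = q_k q -> p = q.
Proof.
move=> e0 e1 e2 e3; apply/rowP => -[[|[|[|[|//]]]] h].
- by move: e0; rewrite /q_re; congr (_ = _); congr fun_of_matrix; exact/val_inj.
- by move: e1; rewrite /q_i; congr (_ = _); congr fun_of_matrix; exact/val_inj.
- by move: e2; rewrite /q_j; congr (_ = _); congr fun_of_matrix; exact/val_inj.
- by move: e3; rewrite /q_k; congr (_ = _); congr fun_of_matrix; exact/val_inj.
Qed.

Lemma q_mkE a b c d :
  (q_re (qmk a b c d) = a) * (q_i (qmk a b c d) = b) *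
  (q_j (qmk a b c d) = c) * (q_k (qmk a b c d) = d).
Proof. by rewrite /q_re /q_i /q_j /q_k !mxE. Qed.

Lemma q_DE p q :
  (q_re (p + q) = q_re p + q_re q) * (q_i (p + q) = q_i p + q_i q) *
  (q_j (p + q) = q_j p + q_j q) * (q_k (p + q) = q_k p + q_k q).
Proof. by split; [split; [split|]|]; exact: mxE. Qed.

Lemma q_ZE a q :
  (q_re (a *: q) = a * q_re q) * (q_i (a *: q) = a * q_i q) *
  (q_j (a *: q) = a * q_j q) * (q_k (a *: q) = a * q_k q).
Proof. by split; [split; [split|]|]; exact: mxE. Qed.

Lemma mulqA : associative mulq.
Proof. by move=> p q r; apply: quat_ext; rewrite /mulq !q_mkE; ring. Qed.

Lemma mul1q : left_id oneq mulq.
Proof. by move=> p; apply: quat_ext; rewrite /mulq /oneq !q_mkE; ring. Qed.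

Lemma mulq1 : right_id oneq mulq.
Proof. by move=> p; apply: quat_ext; rewrite /mulq /oneq !q_mkE; ring. Qed.

Lemma mulqDl : left_distributive mulq +%R.
Proof.
by move=> p q r; apply: quat_ext; rewrite /mulq !(q_mkE, q_DE); ring.
Qed.

Lemma mulqDr : right_distributive mulq +%R.
Proof.
by move=> p q r; apply: quat_ext; rewrite /mulq !(q_mkE, q_DE); ring.
Qed.

Lemma oneq_neq0 : oneq != 0.
Proof.
apply/eqP => /(congr1 q_re); rewrite q_mkE.
by rewrite /q_re mxE => /eqP; rewrite oner_eq0.
Qed.

End QuatRing.

HB.instance Definition _ (K : numFieldType) :=
  GRing.Zmodule_isNzRing.Build (quat K)
    (@mulqA K) (@mul1q K) (@mulq1 K) (@mulqDl K) (@mulqDr K) (oneq_neq0 K).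

Section QuatAlgebra.
Variable K : numFieldType.
Implicit Types (p q : quat K) (a : K).

Lemma scaleqAl a p q : a *: (p * q) = (a *: p) * q.
Proof.
rewrite -[p * q]/(mulq p q) -[_ * q]/(mulq (a *: p) q).
by apply: quat_ext; rewrite /mulq !(q_mkE, q_ZE); ring.
Qed.

Lemma scaleqAr a p q : a *: (p * q) = p * (a *: q).
Proof.
rewrite -[p * q]/(mulq p q) -[p * _]/(mulq p (a *: q)).
by apply: quat_ext; rewrite /mulq !(q_mkE, q_ZE); ring.
Qed.

End QuatAlgebra.

HB.instance Definition _ (K : numFieldType) :=
  GRing.Lmodule_isLalgebra.Build K (quat K) (@scaleqAl K).
HB.instance Definition _ (K : numFieldType) :=
  GRing.Lalgebra_isAlgebra.Build K (quat K) (@scaleqAr K).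

Section Quaternions.
Variable R : realType.
Local Notation H := (quat R).
Local Notation C := R[i].
Local Notation HC := (quat R[i]).
Implicit Types (Omega : set H) (I J q : H) (x y : R) (z : C).

Definition imag_units : set H := [set J | J ^+ 2 = -1].

Definition slice_plane I : set H := [set q | exists x y, q = x%:A + y *: I].

Definition slice_of Omega I : set H := Omega `&` slice_plane I.

Definition axially_symmetric Omega := forall x y I J,
  imag_units I -> imag_units J ->
  Omega (x%:A + y *: I) -> Omega (x%:A + y *: J).

Definition domain Omega := open Omega /\ connected Omega.

Definition path_connected (T : topologicalType) (A : set T) :=
  forall a b, A a -> A b -> exists gamma : R -> T,
    [/\ {within `[0, 1], continuous gamma}, gamma @` `[0, 1] `<=` A,
        gamma 0 = a & gamma 1 = b].

(* Every loop gamma in A is null-homotopic in A relative to its base point. *)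
Definition simply_connected (T : topologicalType) (A : set T) :=
  path_connected A /\
  forall gamma : R -> T, {within `[0, 1], continuous gamma} ->
    gamma @` `[0, 1] `<=` A -> gamma 0 = gamma 1 ->
    exists h : R * R -> T,
      [/\ {within `[0, 1] `*` `[0, 1], continuous h},
          h @` (`[0, 1] `*` `[0, 1]) `<=` A,
          {in `[0, 1], forall t, h (0, t) = gamma t},
          {in `[0, 1], forall t, h (1, t) = gamma 0} &
          {in `[0, 1], forall s, h (s, 0) = gamma 0 /\ h (s, 1) = gamma 0}].

Definition basic_domain Omega :=
  [/\ domain Omega, axially_symmetric Omega &
      exists2 I, imag_units I &
        forall q, slice_of Omega I q ->
          simply_connected (connected_component (slice_of Omega I) q)].

Definition Omega_iota Omega : set C :=
  [set z | exists2 I, imag_units I &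
             Omega ((complex.Re z)%:A + (complex.Im z) *: I)].

(* The components F_1, F_2 of w = F_1 + iota F_2, and the involution
   F_1 + iota F_2 |-> F_1 - iota F_2. *)
Definition hc1 (w : HC) : H := map_mx (@complex.Re R) w.
Definition hc2 (w : HC) : H := map_mx (@complex.Im R) w.
Definition hc_conj (w : HC) : HC := map_mx (@conjc R) w.

Definition stem_function Omega (F : C -> HC) :=
  forall z, Omega_iota Omega z -> F (z^*)%C = hc_conj (F z).

Definition induces Omega (F : C -> HC) (f : H -> H) :=
  forall x y J, imag_units J -> Omega (x%:A + y *: J) ->
    f (x%:A + y *: J) = hc1 (F (x +i* y)%C) + J * hc2 (F (x +i* y)%C).

Definition holomorphic_on (D : set C) (F : C -> HC) :=
  forall z, D z -> derivable (F : C^o -> HC) z 1.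

Definition slice_regular Omega (f : H -> H) :=
  exists F, [/\ stem_function Omega F, holomorphic_on (Omega_iota Omega) F &
                induces Omega F f].

(* The stem function of the slice function f; it is determined on
   Omega_iota (see stem_uniq below). *)
Definition stem_of Omega (f : H -> H) : C -> HC :=
  xget (fun=> 0) [set F | stem_function Omega F /\ induces Omega F f].

(* The slice function induced by a stem function F: writing q = x + y J with
   y = |Im q|, the value is F_1(x + iota y) + J F_2(x + iota y).  If y = 0 the
   second term is 0, consistently with the vanishing of F_2 on the real axis. *)
Definition slice_fun (F : C -> HC) : H -> H := fun q =>
  let x := q_re q in
  let y := Num.sqrt (q_i q ^+ 2 + q_j q ^+ 2 + q_k q ^+ 2) in
  let J := y^-1 *: (q - x%:A) in
  hc1 (F (x +i* y)%C) + J * hc2 (F (x +i* y)%C).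

(* The values of star, star_pow and exp_star outside Omega are meaningless;
   induces_star and induces_star_pow below give them on Omega. *)
Definition star Omega (f g : H -> H) : H -> H :=
  slice_fun (fun z => stem_of Omega f z * stem_of Omega g z).

Definition star_pow Omega (f : H -> H) (n : nat) : H -> H :=
  iter n (star Omega f) (fun=> 1).

Definition exp_star Omega (f : H -> H) : H -> H := fun q =>
  lim (series (fun n => (n`!%:R : R)^-1 *: star_pow Omega f n q) @ \oo).

Definition hc_emb (q : H) : HC := map_mx (real_complex R) q.

Lemma complexification_decomp (w : HC) :
  w = hc_emb (hc1 w) + 'i%C *: hc_emb (hc2 w).
Proof. by apply/rowP => k; rewrite !mxE; exact: complexE. Qed.

Lemma hc_embM (p q : H) : hc_emb (p * q) = hc_emb p * hc_emb q.
Proof.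
rewrite -[p * q]/(mulq p q) -[RHS]/(mulq _ _).
have E u : (q_re (hc_emb u) = (q_re u)%:C%C) * (q_i (hc_emb u) = (q_i u)%:C%C)
    * (q_j (hc_emb u) = (q_j u)%:C%C) * (q_k (hc_emb u) = (q_k u)%:C%C).
  by split; [split; [split|]|]; exact: mxE.
apply: quat_ext; rewrite /mulq !(q_mkE, E); apply/eqP;
  by rewrite eq_complex /=; apply/andP; split; apply/eqP; ring.
Qed.

Lemma imag_unitsE J : imag_units J ->
  q_re J = 0 /\ q_i J ^+ 2 + q_j J ^+ 2 + q_k J ^+ 2 = 1.
Proof.
rewrite /imag_units /= expr2 -[J * J]/(mulq J J) => JJ.
have E0 : q_re (mulq J J) = -1.
  by rewrite JJ -[1]/(oneq R) -scaleN1r q_ZE q_mkE mulr1.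
have [E1 E2 E3] :
    [/\ q_i (mulq J J) = 0, q_j (mulq J J) = 0 & q_k (mulq J J) = 0].
  by rewrite JJ -[1]/(oneq R) -scaleN1r !q_ZE !q_mkE !mulr0.
move: E0 E1 E2 E3; rewrite /mulq !q_mkE.
move: (q_re J) (q_i J) (q_j J) (q_k J) => a b c d h0 h1 h2 h3.
have {}h1 : a * b = 0 by nra.
have {}h2 : a * c = 0 by nra.
have {}h3 : a * d = 0 by nra.
have [a0|a0] := eqVneq a 0; first by split => //; rewrite a0 in h0; nra.
have b0 : b = 0 by apply: (mulfI a0); rewrite h1 mulr0.
have c0 : c = 0 by apply: (mulfI a0); rewrite h2 mulr0.
have d0 : d = 0 by apply: (mulfI a0); rewrite h3 mulr0.
by rewrite b0 c0 d0 in h0; nra.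
Qed.

Lemma imag_units_neq0 : imag_units !=set0.
Proof.
exists (qmk 0 1 0 0); rewrite /imag_units /= expr2.
rewrite -[LHS]/(mulq _ _) -[1 in RHS]/(oneq R) -scaleN1r.
by apply: quat_ext; rewrite /mulq /oneq !(q_mkE, q_ZE); ring.
Qed.

Lemma imag_unitsN J : imag_units J -> imag_units (- J).
Proof. by rewrite /imag_units /= sqrrN. Qed.

Lemma slice_funP Omega (F : C -> HC) :
  stem_function Omega F -> induces Omega F (slice_fun F).
Proof.
move=> sF x y J uJ OJ; rewrite /slice_fun.
have [J0 J1] := imag_unitsE uJ.
have E : q_re (x%:A + y *: J) = x.
  by rewrite q_DE !q_ZE J0 mulr0 addr0 -[1]/(oneq R) q_mkE mulr1.
have E' : q_i (x%:A + y *: J) ^+ 2 + q_j (x%:A + y *: J) ^+ 2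
    + q_k (x%:A + y *: J) ^+ 2 = y ^+ 2.
  rewrite !q_DE !q_ZE -[1]/(oneq R) !q_mkE -[RHS]mulr1 -J1; ring.
rewrite E E' sqrtr_sqr [_ + _ - _]addrC addKr.
have sz : Omega_iota Omega (x +i* y)%C by exists J.
have [y0|y0|y0] := ltrgtP y 0.
- have -> : (x +i* `|y|)%C = ((x +i* y)^*)%C by rewrite ltr0_norm.
  rewrite (sF _ sz) ltr0_norm // scalerA invrN mulNr mulVf ?lt_eqF // scaleN1r.
  have -> : hc1 (hc_conj (F (x +i* y)%C)) = hc1 (F (x +i* y)%C).
    by apply/rowP => k; rewrite !mxE; case: (F _ _ _).
  have -> : hc2 (hc_conj (F (x +i* y)%C)) = - hc2 (F (x +i* y)%C).
    by apply/rowP => k; rewrite !mxE; case: (F _ _ _).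
  by rewrite mulrNN.
- by rewrite gtr0_norm // scalerA mulVf ?gt_eqF // scale1r.
rewrite y0 normr0 scale0r scaler0 mul0r.
have -> : hc2 (F (x +i* 0)%C) = 0.
  rewrite y0 in sz; have := sF _ sz; rewrite /= oppr0 => e.
  apply/rowP => k; have /(congr1 (fun w : HC => complex.Im (w 0 k))) := e.
  rewrite !mxE; case: (F _ _ _) => a b /= /eqP.
  by rewrite -addr_eq0 -mulr2n mulrn_eq0 /= => /eqP.
by rewrite mulr0.
Qed.

Lemma half_sum (a b c d : H) : a - b = c - d -> a + b = c + d -> a = c.
Proof.
move=> e1 e2; have aE (u v : H) : u = 2^-1 *: ((u - v) + (u + v)).
  by rewrite addrACA addNr addr0 -mulr2n -(scaler_nat 2 u) scalerA
    mulVf ?scale1r// pnatr_eq0.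
by rewrite (aE a b) e1 e2 -aE.
Qed.

Lemma stem_uniq Omega (F G : C -> HC) (f : H -> H) :
  axially_symmetric Omega -> induces Omega F f -> induces Omega G f ->
  {in Omega_iota Omega, F =1 G}.
Proof.
move=> aO iF iG [x y]; rewrite inE => -[J uJ /= OJ].
have uJ' := imag_unitsN uJ; have OJ' := aO _ _ _ _ uJ uJ' OJ.
have := iF _ _ _ uJ OJ; rewrite (iG _ _ _ uJ OJ).
have := iF _ _ _ uJ' OJ'; rewrite (iG _ _ _ uJ' OJ') !mulNr.
set G1 := hc1 _; set G2 := hc2 _; set F1 := hc1 _; set F2 := hc2 _ => e1 e2.
have e : G1 = F1 by exact: half_sum e1 e2.
have {e1 e2} /(congr1 (fun q => J * q)) : J * G2 = J * F2.
  by move: e2; rewrite e => /addrI.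
rewrite !mulrA -expr2 uJ !mulN1r => /oppr_inj e'.
rewrite (complexification_decomp (F _)) (complexification_decomp (G _)).
by rewrite -/F1 -/F2 -/G1 -/G2 e e'.
Qed.

Lemma hc_conjM (v w : HC) : hc_conj (v * w) = hc_conj v * hc_conj w.
Proof.
rewrite -[v * w]/(mulq v w) -[RHS]/(mulq _ _).
have E u : (q_re (hc_conj u) = ((q_re u)^*)%C)
    * (q_i (hc_conj u) = ((q_i u)^*)%C) * (q_j (hc_conj u) = ((q_j u)^*)%C)
    * (q_k (hc_conj u) = ((q_k u)^*)%C).
  by rewrite /q_re /q_i /q_j /q_k !mxE.
by apply: quat_ext; rewrite /mulq !(q_mkE, E);
  move: (q_re v) (q_i v) (q_j v) (q_k v) (q_re w) (q_i w) (q_j w) (q_k w)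
    => [? ?] [? ?] [? ?] [? ?] [? ?] [? ?] [? ?] [? ?];
  apply/eqP; rewrite eq_complex /=; apply/andP; split; apply/eqP; ring.
Qed.

Lemma stem_ofP Omega (F : C -> HC) (f : H -> H) :
  axially_symmetric Omega -> stem_function Omega F -> induces Omega F f ->
  {in Omega_iota Omega, stem_of Omega f =1 F}.
Proof.
move=> aO sF iF; rewrite /stem_of; case: xgetP => [G _ [_ iG]|/(_ F)[]//].
exact: stem_uniq aO iG iF.
Qed.

Lemma induces_star Omega (F G : C -> HC) (f g : H -> H) :
  axially_symmetric Omega -> stem_function Omega F -> induces Omega F f ->
  stem_function Omega G -> induces Omega G g ->
  stem_function Omega (fun z => F z * G z) /\
  induces Omega (fun z => F z * G z) (star Omega f g).
Proof.
move=> aO sF iF sG iG.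
have Oconj z : Omega_iota Omega z -> Omega_iota Omega (z^*)%C.
  case: z => x y [J uJ OJ]; exists (- J); first exact: imag_unitsN.
  by rewrite /= scalerN scaleNr opprK.
have sFG : stem_function Omega (fun z => F z * G z).
  by move=> z Oz; rewrite sF // sG // hc_conjM.
have E z : Omega_iota Omega z ->
    stem_of Omega f z * stem_of Omega g z = F z * G z.
  by move=> Oz; rewrite (stem_ofP aO sF iF) ?inE // (stem_ofP aO sG iG) ?inE.
split=> // x y J uJ OJ; rewrite /star (slice_funP (Omega := Omega)) //.
- by rewrite E //; exists J.
- by move=> z Oz; rewrite !E //; [exact: sFG|exact: Oconj].
Qed.

Lemma induces_star_pow Omega (F : C -> HC) (f : H -> H) n :
  axially_symmetric Omega -> stem_function Omega F -> induces Omega F f ->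
  stem_function Omega (fun z => F z ^+ n) /\
  induces Omega (fun z => F z ^+ n) (star_pow Omega f n).
Proof.
move=> aO sF iF; elim: n => [|n [sn In]].
  have E1 : hc1 1 = 1.
    by apply: quat_ext; rewrite -[1 in RHS]/(oneq R) ?q_mkE;
      rewrite /q_re /q_i /q_j /q_k !mxE.
  have E2 : hc2 1 = 0.
    by apply: quat_ext; rewrite /q_re /q_i /q_j /q_k !mxE.
  have E3 : hc_conj 1 = 1.
    by apply: quat_ext; rewrite -[1 in RHS]/(oneq _) ?q_mkE;
      rewrite /q_re /q_i /q_j /q_k !mxE /= oppr0.
  split=> [z _|x y J _ _]; rewrite !expr0 ?E3 // E1 E2 mulr0 addr0 //.
have [sS iS] := induces_star aO sF iF sn In.
split=> [z Oz|x y J uJ OJ]; first by rewrite !exprS; exact: sS.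
by rewrite exprS; exact: iS.
Qed.

End Quaternions.

(* Main.v *)
From HB Require Import structures.
Require Import Defs.
From mathcomp Require Import all_boot all_order all_algebra.
From mathcomp Require Import ring lra complex.
From mathcomp Require Import all_classical all_reals all_analysis.
Set Implicit Arguments.
Unset Strict Implicit.
Unset Printing Implicit Defensive.
Import Order.TTheory GRing.Theory Num.Theory.
Import numFieldNormedType.Exports.
Local Open Scope classical_set_scope.
Local Open Scope ring_scope.

(** Let G be the stem function of g.  Since g has no zeros, the complex norm
form of G does not vanish, and only a local logarithm of G in
H_C = C (x) H = M_2(C) is needed, compatible with conjugation when the base
point is real.  If G = G_0 + n W with W^2 = -1, it is
(A + B)/2 + (A - B)/(2 iota) W with exp A = G_0 + iota n and
exp B = G_0 - iota n.  Such n and W exist where the vector part of G is not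
isotropic.  They also exist near every real point o: there the vector part is
(z - o)^m V with V(o) real and nonzero (or it vanishes identically), so that
its norm form has a holomorphic square root.  Choosing B(z) as the conjugate of
A(conj z) then makes the logarithm a stem function.  At a non-real point where
the vector part is isotropic, G = G_0 (1 + X) with X^2 = - u scalar and small,
and log (1 + X) = S(u) + T(u) X, where S(s^2) and s T(s^2) are the even and odd
parts of log (1 + iota s) (up to iota).

The order m and the extension of T through 0 require that complex
differentiable functions be analytic.  This is obtained from Goursat's lemma
for triangles, with integrals over segments defined as limits of dyadic
trapezoid sums, and Cauchy's formula on a square; the value 2 pi iota of the
integral of 1 / (w - z) is never needed, only that it does not vanish. *)

(** * Modulus and limits in the complex numbers *)

(** A logarithm of G cannot be obtained by integrating G' G^-1: H_C is not commutative, and the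
    derivative of exp L is L' exp L only if L and L' commute. The problem is therefore reduced to
    scalar logarithms of the two eigenvalues G_0 + iota n and G_0 - iota n of G as a 2 by 2 matrix;
    their product is the norm form of G, which is nonzero. The obstacle is n, a square root of a
    function that may vanish. Off the real axis it is met by expressions even in n, and the stem
    condition costs nothing there: a logarithm on a disc of the upper half-plane is copied to the
    mirror disc by conjugation. At a real point the stem condition is a real constraint, and even
    expressions are not enough: if G(o) is a negative real number, no scalar logarithm of G_0 is
    real at o, and a stem logarithm takes there a value such as ln |G_0| + pi W with W a real unit
    vector. Hence W must be continued holomorphically through the zeros of the vector part, and this
    is what requires orders of vanishing, and so analyticity. *)

Section Modulus.
Context {R : realType}.
Implicit Types z w : R[i].

(** The norm of [R[i]] takes its values in [R[i]]; with a modulus in [R] the estimates are within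
    reach of [lra]. *)
Definition nm z : R := Num.sqrt (complex.Re z ^+ 2 + complex.Im z ^+ 2).

Lemma nmE z : `|z| = (nm z)%:C%C.
Proof. by rewrite normc_def. Qed.

Lemma nm_ge0 z : 0 <= nm z.
Proof. exact: sqrtr_ge0. Qed.

Lemma nmM z w : nm (z * w) = nm z * nm w.
Proof. by apply: complexI; rewrite rmorphM /= -!nmE normrM. Qed.

Lemma nmV z : nm z^-1 = (nm z)^-1.
Proof. by apply: complexI; rewrite fmorphV /= -!nmE normfV. Qed.

Lemma nmN z : nm (- z) = nm z.
Proof. by apply: complexI; rewrite -!nmE normrN. Qed.

Lemma nm_distC z w : nm (z - w) = nm (w - z).
Proof. by rewrite -nmN opprB. Qed.

Lemma nmD z w : nm (z + w) <= nm z + nm w.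
Proof. by rewrite -lecR rmorphD /= -!nmE ler_normD. Qed.

Lemma nm_dist (u z w : R[i]) : nm (z - w) <= nm (z - u) + nm (u - w).
Proof. by apply: le_trans (nmD _ _); rewrite addrA subrK. Qed.

Lemma nm_sub z w : nm (z - w) <= nm z + nm w.
Proof. by rewrite -(nmN w) nmD. Qed.

Lemma nm0 : nm 0 = 0.
Proof. by apply: complexI; rewrite -nmE normr0. Qed.

Lemma nm1 : nm 1 = 1.
Proof. by apply: complexI; rewrite -nmE normr1. Qed.

Lemma nmX z n : nm (z ^+ n) = nm z ^+ n.
Proof. by apply: complexI; rewrite rmorphXn /= -!nmE normrX. Qed.

Lemma nm_eq0 z : nm z = 0 -> z = 0.
Proof. by move=> z0; apply/eqP; rewrite -normr_eq0 nmE z0. Qed.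

Lemma nm_gt0 z : z != 0 -> 0 < nm z.
Proof.
move=> z0; rewrite lt_neqAle nm_ge0 andbT eq_sym.
by apply: contra_neq z0 => /nm_eq0.
Qed.

Lemma nm_natr (n : nat) : nm n%:R = n%:R.
Proof. by apply: complexI; rewrite -nmE normr_nat rmorph_nat. Qed.

Lemma nm_real (x : R) : nm x%:C%C = `|x|.
Proof. by rewrite /nm /= expr0n addr0 sqrtr_sqr. Qed.

Lemma nm_Re z : `|complex.Re z| <= nm z.
Proof. by rewrite -sqrtr_sqr ler_wsqrtr// lerDl sqr_ge0. Qed.

Lemma nm_Im z : `|complex.Im z| <= nm z.
Proof. by rewrite -sqrtr_sqr ler_wsqrtr// lerDr sqr_ge0. Qed.

Lemma nm_conj z : nm (z^*)%C = nm z.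
Proof. by case: z => a b; rewrite /nm /= sqrrN. Qed.

Lemma nm_i z : nm ('i%C * z) = nm z.
Proof. by rewrite nmM {1}/nm /= expr0n add0r expr1n sqrtr1 mul1r. Qed.

Lemma nm_le_ReIm z : nm z <= `|complex.Re z| + `|complex.Im z|.
Proof.
rewrite {1}(complexE z); apply: (le_trans (nmD _ _)).
by rewrite nm_i !nm_real.
Qed.

Lemma nm_half z : nm (z / 2) = nm z / 2.
Proof. by rewrite nmM nmV (nm_natr 2). Qed.

Lemma eq_of_nm_lt z w : (forall e, 0 < e -> nm (z - w) <= e) -> z = w.
Proof.
move=> H; apply/eqP; rewrite -subr_eq0; apply/eqP; apply: nm_eq0.
apply/eqP; rewrite eq_le nm_ge0 andbT; apply/ler_addgt0Pr => e e0.
by rewrite add0r H.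
Qed.

(* [2 K] rather than [K] because the limit is taken on the two coordinates
   separately. *)
Lemma geometric_limit (u : nat -> R[i]) (K : R) :
    (forall n, nm (u n.+1 - u n) <= K / 2 ^+ n.+1) ->
  exists z, forall n, nm (u n - z) <= 2 * (K / 2 ^+ n).
Proof.
have real (v : nat -> R) : (forall n, `|v n.+1 - v n| <= K / 2 ^+ n.+1) ->
    exists x, forall n, `|v n - x| <= K / 2 ^+ n.
  move=> hv; pose e n := K / 2 ^+ n.
  have eS n : e n.+1 = e n / 2 by rewrite /e exprSr invfM mulrA.
  have hl n : v n - e n <= v n.+1 - e n.+1.
    by have := hv n; rewrite -/(e _) eS ler_norml => /andP[]; lra.
  have hr n : v n.+1 + e n.+1 <= v n + e n.
    by have := hv n; rewrite -/(e _) eS ler_norml => /andP[]; lra.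
  have hl' n k : v n - e n <= v (n + k)%N - e (n + k)%N.
    by elim: k => [|k IH]; rewrite ?addn0// addnS (le_trans IH).
  have hr' n k : v (n + k)%N + e (n + k)%N <= v n + e n.
    by elim: k => [|k IH]; rewrite ?addn0// addnS (le_trans _ IH).
  have e0 n : 0 <= e n.
    by have := le_trans (normr_ge0 _) (hv n); rewrite -/(e _) eS; lra.
  have hlr m n : v m - e m <= v n + e n.
    have [/subnK <-|/ltnW/subnK <-] := leqP m n; rewrite addnC.
      by apply: (le_trans (hl' m (n - m)%N)); have := e0 (m + (n - m))%N; lra.
    by apply: le_trans (hr' n (m - n)%N); have := e0 (n + (m - n))%N; lra.
  (* The intervals [[v n - e n, v n + e n]] are nested, and the supremum of their left ends lies in
     all of them. *)
  pose S := [set v n - e n | n in [set: nat]].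
  have ubS n : ubound S (v n + e n) by move=> _ [m _ <-]; exact: hlr.
  have S0 : S !=set0 by exists (v 0 - e 0); exists 0.
  exists (sup S) => n; rewrite ler_distlC.
  apply/andP; split.
    by apply: ub_le_sup; [exists (v 0 + e 0); exact: ubS|exists n].
  by apply: ge_sup => //; exact: ubS.
move=> hu.
have [x hx] : exists x, forall n, `|complex.Re (u n) - x| <= K / 2 ^+ n.
  apply: real => n; apply: le_trans (hu n); apply: le_trans (nm_Re _).
  by case: (u n.+1) (u n) => ? ? [? ?].
have [y hy] : exists y, forall n, `|complex.Im (u n) - y| <= K / 2 ^+ n.
  apply: real => n; apply: le_trans (hu n); apply: le_trans (nm_Im _).
  by case: (u n.+1) (u n) => ? ? [? ?].
exists (x +i* y)%C => n; apply: (le_trans (nm_le_ReIm _)).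
rewrite mulr2n mulrDl mul1r lerD//.
  by have := hx n; case: (u n).
by have := hy n; case: (u n).
Qed.

Lemma half_pow_small (K e : R) : 0 < e -> exists n, K / 2 ^+ n < e.
Proof.
move=> e0; have [n hn] : exists n : nat, K / e < n%:R.
  by exists (Num.truncn `|K / e|).+1; rewrite (le_lt_trans (ler_norm _))// truncnS_gt.
exists n; rewrite ltr_pdivrMr ?exprn_gt0// mulrC -ltr_pdivrMr//.
by rewrite (lt_le_trans hn)// -natrX ler_nat ltnW// ltn_expl.
Qed.

End Modulus.

(** * Continuity and complex derivatives *)

Section ComplexDerivative.
Context {R : realType}.
Local Notation C := R[i].
Implicit Types (f g h : C -> C) (z w d : C) (P Q : C -> Prop).

(** Neighbourhoods with real radii; [nbhs_nearc] identifies them with the filter of [R[i]^o]. *)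
Definition nearc z P := exists2 r : R, 0 < r & forall w, nm (w - z) < r -> P w.

Definition ccont f z := forall e : R, 0 < e -> nearc z (fun w => nm (f w - f z) < e).

(* Caratheodory's form of the derivative: the rules of calculus reduce to the
   continuity of the slope function. *)
Definition cderiv f z d := exists phi,
  [/\ ccont phi z, phi z = d & nearc z (fun w => f w - f z = phi w * (w - z))].

Definition hol f z := exists d, cderiv f z d.

Lemma nearcW z P Q : (forall w, P w -> Q w) -> nearc z P -> nearc z Q.
Proof. by move=> PQ [r r0 H]; exists r => // w /H /PQ. Qed.

Lemma nearc_and z P Q : nearc z P -> nearc z Q -> nearc z (fun w => P w /\ Q w).
Proof.
move=> [r r0 Hr] [s s0 Hs]; exists (Num.min r s); first by rewrite lt_min r0.
by move=> w; rewrite lt_min => /andP[/Hr ? /Hs].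
Qed.

Lemma nearc_all z P : (forall w, P w) -> nearc z P.
Proof. by move=> H; exists 1. Qed.

Lemma nearc_self z P : nearc z P -> P z.
Proof. by move=> [r r0]; apply; rewrite subrr nm0. Qed.

Lemma nearc_ball z (r : R) : 0 < r -> nearc z (fun w => nm (w - z) < r).
Proof. by exists r. Qed.

Lemma nearc_open o (r : R) z : nm (z - o) < r -> nearc z (fun w => nm (w - o) < r).
Proof.
move=> zr; exists (r - nm (z - o)); first by rewrite subr_gt0.
by move=> w wz; have := nm_dist z w o; lra.
Qed.

Lemma nearc_near z P : nearc z P -> nearc z (fun w => nearc w P).
Proof.
move=> [r r0 H]; exists r => // w wr.
by apply: nearcW (nearc_open wr).
Qed.

Lemma nearc_neq z a : z != a -> nearc z (fun w => w != a).
Proof.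
move=> za; exists (nm (z - a)); first by apply: nm_gt0; rewrite subr_eq0.
by move=> w; apply: contraTN => /eqP->; rewrite nm_distC ltxx.
Qed.

Lemma cc_near f g z : nearc z (fun w => f w = g w) -> ccont f z -> ccont g z.
Proof.
move=> fg cf e e0; have fgz := nearc_self fg.
by apply: nearcW (nearc_and fg (cf _ e0)) => w [-> H]; rewrite -fgz.
Qed.

Lemma cc_cst c z : ccont (fun=> c) z.
Proof. by move=> e e0; apply: nearc_all => w; rewrite subrr nm0. Qed.

Lemma cc_id z : ccont id z.
Proof. by move=> e e0; exact: nearc_ball. Qed.

Lemma ccD f g z : ccont f z -> ccont g z -> ccont (fun w => f w + g w) z.
Proof.
move=> cf cg e e0; have e20 : 0 < e / 2 by lra.
apply: nearcW (nearc_and (cf _ e20) (cg _ e20)) => w [h1 h2].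
rewrite opprD addrACA; apply: le_lt_trans (nmD _ _) _; lra.
Qed.

Lemma ccN f z : ccont f z -> ccont (fun w => - f w) z.
Proof.
move=> cf e e0; apply: nearcW (cf _ e0) => w.
by rewrite -opprD nmN.
Qed.

Lemma ccB f g z : ccont f z -> ccont g z -> ccont (fun w => f w - g w) z.
Proof. by move=> cf cg; apply: ccD => //; exact: ccN. Qed.

Lemma cc_bounded f z : ccont f z -> nearc z (fun w => nm (f w) < nm (f z) + 1).
Proof.
move=> cf; apply: nearcW (cf _ ltr01) => w h.
by have := nm_dist (f z) (f w) 0; rewrite !subr0; lra.
Qed.

Lemma ccM f g z : ccont f z -> ccont g z -> ccont (fun w => f w * g w) z.
Proof.
move=> cf cg e e0.
pose M := nm (f z) + 1 + nm (g z); have M0 : 0 < M.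
  by rewrite /M; have := nm_ge0 (f z); have := nm_ge0 (g z); lra.
have eM : 0 < e / M by rewrite divr_gt0.
apply: nearcW (nearc_and (cc_bounded cf) (nearc_and (cf _ eM) (cg _ eM))) => w [h1 [h2 h3]].
have -> : f w * g w - f z * g z = f w * (g w - g z) + (f w - f z) * g z by ring.
apply: le_lt_trans (nmD _ _) _; rewrite !nmM.
have -> : e = (nm (f z) + 1) * (e / M) + e / M * nm (g z).
  by rewrite [X in X + _]mulrC -mulrDr divfK// gt_eqF.
apply: ltr_leD; last by apply: ler_wpM2r; [exact: nm_ge0|exact: ltW].
apply: le_lt_trans (_ : (nm (f w)) * (e / M) < _).
  by apply: ler_wpM2l; [exact: nm_ge0|exact: ltW].
by rewrite ltr_pM2r.
Qed.

Lemma cc_neq0 f z : ccont f z -> f z != 0 -> nearc z (fun w => nm (f z) / 2 < nm (f w)).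
Proof.
move=> cf fz; have h : 0 < nm (f z) / 2 by have := nm_gt0 fz; lra.
apply: nearcW (cf _ h) => w hw.
by have := nm_dist (f w) (f z) 0; rewrite !subr0 nm_distC; lra.
Qed.

Lemma cc_nonzero f z : ccont f z -> f z != 0 -> nearc z (fun w => f w != 0).
Proof.
move=> cf fz; apply: nearcW (cc_neq0 cf fz) => w; apply: contraTneq => ->.
by rewrite nm0 -leNgt; have := nm_gt0 fz; lra.
Qed.

Lemma ccV f z : ccont f z -> f z != 0 -> ccont (fun w => (f w)^-1) z.
Proof.
move=> cf fz e e0; have n0 := nm_gt0 fz.
have k0 : 0 < e * (nm (f z) * (nm (f z) / 2)) by rewrite !mulr_gt0// invr_gt0.
apply: nearcW (nearc_and (cc_nonzero cf fz) (nearc_and (cc_neq0 cf fz) (cf _ k0))) => w [fw [h1 h2]].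
have -> : (f w)^-1 - (f z)^-1 = - (f w - f z) * ((f z)^-1 * (f w)^-1).
  by field; rewrite fw fz.
rewrite nmM nmN nmM !nmV -invfM ltr_pdivrMr ?mulr_gt0 ?nm_gt0//.
by apply: (lt_le_trans h2); rewrite ler_pM2l// ler_pM2l// ltW.
Qed.

Lemma cc_comp f g z : ccont f z -> ccont g (f z) -> ccont (fun w => g (f w)) z.
Proof.
move=> cf cg e e0; have [r r0 H] := cg _ e0.
by apply: nearcW (cf _ r0) => w /H.
Qed.

Lemma nearc_comp f z P : ccont f z -> nearc (f z) P -> nearc z (fun w => P (f w)).
Proof. by move=> cf [r r0 H]; apply: nearcW (cf _ r0) => w /H. Qed.

Lemma cc_punctured_eq0 f z : nearc z (fun w => w != z -> f w = 0) -> ccont f z -> f z = 0.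
Proof.
move=> [r r0 H] cf; apply: eq_of_nm_lt => e e0; rewrite subr0.
have [s s0 Hs] := cf _ e0.
pose t := Num.min r s / 2; have t0 : 0 < t by rewrite divr_gt0// lt_min r0.
have tm : t < Num.min r s by rewrite /t; move: t0; rewrite /t; lra.
have nt : nm (z + t%:C%C - z) = t by rewrite addrC addKr nm_real gtr0_norm.
have := Hs (z + t%:C%C); rewrite nt => /(_ _)/ltW.
rewrite H ?sub0r ?nmN; first by apply; rewrite (lt_le_trans tm)// ge_min lexx orbT.
- by rewrite nt (lt_le_trans tm)// ge_min lexx.
- by rewrite -subr_eq0; apply/eqP => h; move: nt; rewrite h nm0 => /eqP; rewrite lt_eqF.
Qed.

Lemma cc_uniq f g z : nearc z (fun w => w != z -> f w = g w) ->
  ccont f z -> ccont g z -> f z = g z.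
Proof.
move=> fg cf cg; apply/eqP; rewrite -subr_eq0; apply/eqP.
apply: (cc_punctured_eq0 (f := fun w => f w - g w)); last exact: ccB.
by apply: nearcW fg => w H /H ->; rewrite subrr.
Qed.

Lemma cd_cont f z d : cderiv f z d -> ccont f z.
Proof.
move=> [phi [cp _ H]].
apply: (@cc_near (fun w => f z + phi w * (w - z))).
  by apply: nearcW H => w <-; rewrite addrC subrK.
apply: ccD; first exact: cc_cst.
by apply: ccM => //; apply: ccB; [exact: cc_id|exact: cc_cst].
Qed.

Lemma hol_cont f z : hol f z -> ccont f z.
Proof. by case=> d /cd_cont. Qed.

Lemma cd_uniq f z d d' : cderiv f z d -> cderiv f z d' -> d = d'.
Proof.
move=> [phi [cp <- H]] [psi [cq <- H']]; apply: cc_uniq cp cq.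
apply: nearcW (nearc_and H H') => w [-> e] wz.
by apply: (mulIf (x := w - z)) => //; rewrite subr_eq0.
Qed.

Lemma cd_near f g z d : nearc z (fun w => f w = g w) -> cderiv f z d -> cderiv g z d.
Proof.
move=> fg [phi [cp pd H]]; exists phi; split => //.
have fgz := nearc_self fg.
by apply: nearcW (nearc_and fg H) => w [<- <-]; rewrite fgz.
Qed.

Lemma hol_near f g z : nearc z (fun w => f w = g w) -> hol f z -> hol g z.
Proof. by move=> fg [d H]; exists d; exact: cd_near H. Qed.

Lemma cd_cst c z : cderiv (fun=> c) z 0.
Proof.
exists (fun=> 0); split => //; first exact: cc_cst.
by apply: nearc_all => w; rewrite subrr mul0r.
Qed.

Lemma cd_id z : cderiv id z 1.
Proof.
exists (fun=> 1); split => //; first exact: cc_cst.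
by apply: nearc_all => w; rewrite mul1r.
Qed.

Lemma cdD f g z d d' : cderiv f z d -> cderiv g z d' ->
  cderiv (fun w => f w + g w) z (d + d').
Proof.
move=> [phi [cp <- H]] [psi [cq <- H']]; exists (fun w => phi w + psi w); split => //.
  exact: ccD.
by apply: nearcW (nearc_and H H') => w [e1 e2]; rewrite mulrDl -e1 -e2; ring.
Qed.

Lemma cdM f g z d d' : cderiv f z d -> cderiv g z d' ->
  cderiv (fun w => f w * g w) z (d * g z + f z * d').
Proof.
move=> Hf Hg; have cg := cd_cont Hg; move: Hf Hg.
move=> [phi [cp <- H]] [psi [cq <- H']].
exists (fun w => phi w * g w + f z * psi w); split => //.
  by apply: ccD; apply: ccM => //; exact: cc_cst.
apply: nearcW (nearc_and H H') => w [e1 e2].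
have -> : f w = f z + phi w * (w - z) by rewrite -e1; ring.
have -> : g w = g z + psi w * (w - z) by rewrite -e2; ring.
ring.
Qed.

Lemma cdN f z d : cderiv f z d -> cderiv (fun w => - f w) z (- d).
Proof.
move=> [phi [cp <- H]]; exists (fun w => - phi w); split => //.
  exact: ccN.
by apply: nearcW H => w e1; rewrite mulNr -e1; ring.
Qed.

Lemma cdB f g z d d' : cderiv f z d -> cderiv g z d' ->
  cderiv (fun w => f w - g w) z (d - d').
Proof. by move=> Hf Hg; apply: cdD => //; exact: cdN. Qed.

Lemma cdV f z d : cderiv f z d -> f z != 0 ->
  cderiv (fun w => (f w)^-1) z (- d / f z ^+ 2).
Proof.
move=> Hf fz; have cf := cd_cont Hf; move: Hf => [phi [cp <- H]].
exists (fun w => - phi w * ((f w)^-1 * (f z)^-1)); split.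
- apply: ccM; first exact: ccN.
  by apply: ccM; [exact: ccV|exact: cc_cst].
- by rewrite expr2 invfM.
- apply: nearcW (nearc_and (cc_nonzero cf fz) H) => w [fw e].
  transitivity (- (phi w * (w - z)) * ((f w)^-1 * (f z)^-1)); last by ring.
  by rewrite -e; field; rewrite fw fz.
Qed.

Lemma cd_comp f g z d d' : cderiv f z d -> cderiv g (f z) d' ->
  cderiv (fun w => g (f w)) z (d' * d).
Proof.
move=> Hf Hg; have cf := cd_cont Hf; move: Hf Hg.
move=> [phi [cp <- H]] [psi [cq <- H']].
exists (fun w => psi (f w) * phi w); split => //.
  by apply: ccM => //; exact: cc_comp.
by apply: nearcW (nearc_and (nearc_comp cf H') H) => w [-> ->]; rewrite mulrA.
Qed.

Lemma hol_cst c z : hol (fun=> c) z.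
Proof. by exists 0; exact: cd_cst. Qed.

Lemma hol_id z : hol id z.
Proof. by exists 1; exact: cd_id. Qed.

Lemma holD f g z : hol f z -> hol g z -> hol (fun w => f w + g w) z.
Proof. by move=> [d ?] [d' ?]; exists (d + d'); exact: cdD. Qed.

Lemma holN f z : hol f z -> hol (fun w => - f w) z.
Proof. by move=> [d ?]; exists (- d); exact: cdN. Qed.

Lemma holB f g z : hol f z -> hol g z -> hol (fun w => f w - g w) z.
Proof. by move=> [d ?] [d' ?]; exists (d - d'); exact: cdB. Qed.

Lemma holM f g z : hol f z -> hol g z -> hol (fun w => f w * g w) z.
Proof. by move=> [d ?] [d' ?]; exists (d * g z + f z * d'); exact: cdM. Qed.

Lemma holV f z : hol f z -> f z != 0 -> hol (fun w => (f w)^-1) z.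
Proof. by move=> [d ?] fz; exists (- d / f z ^+ 2); exact: cdV. Qed.

Lemma hol_comp f g z : hol f z -> hol g (f z) -> hol (fun w => g (f w)) z.
Proof. by move=> [d ?] [d' ?]; exists (d' * d); exact: cd_comp. Qed.

Lemma holX f n z : hol f z -> hol (fun w => f w ^+ n) z.
Proof.
move=> hf; elim: n => [|n IH]; first exact: hol_cst.
by apply: hol_near (holM hf IH); apply: nearc_all => w; rewrite exprS.
Qed.

(** With its converse [cd_of_bound], this passes between the slope function, suited to algebra, and
    the little-o form, suited to integrals and series. *)
Lemma cd_bound f z d : cderiv f z d -> forall e : R, 0 < e ->
  nearc z (fun w => nm (f w - f z - d * (w - z)) <= e * nm (w - z)).
Proof.
move=> [phi [cp <- H]] e e0; apply: nearcW (nearc_and H (cp _ e0)) => w [-> h].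
by rewrite -mulrBl nmM ler_wpM2r ?nm_ge0// ltW.
Qed.

Lemma cd_of_bound f z d : (forall e : R, 0 < e ->
  nearc z (fun w => nm (f w - f z - d * (w - z)) <= e * nm (w - z))) -> cderiv f z d.
Proof.
move=> H; exists (fun w => if w == z then d else (f w - f z) / (w - z)).
split; rewrite ?eqxx//; last first.
  apply: nearc_all => w; case: eqP => [->|/eqP wz]; first by rewrite !subrr mulr0.
  by rewrite divfK// subr_eq0.
move=> e e0; have e20 : 0 < e / 2 by lra.
apply: nearcW (H _ e20) => w; rewrite eqxx; case: eqP => [->|/eqP wz] h.
  by rewrite subrr nm0.
have wz0 : w - z != 0 by rewrite subr_eq0.
have -> : (f w - f z) / (w - z) - d = (f w - f z - d * (w - z)) / (w - z).
  by field.
rewrite nmM nmV ltr_pdivrMr ?nm_gt0//; apply: (le_lt_trans h).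
by rewrite ltr_pM2r ?nm_gt0//; lra.
Qed.

Lemma conjcB z w : ((z - w)^*)%C = (z^*)%C - (w^*)%C.
Proof. exact: rmorphB. Qed.

Lemma conjcM z w : ((z * w)^*)%C = (z^*)%C * (w^*)%C.
Proof. exact: rmorphM. Qed.

(** Schwarz reflection: conjugating both the argument and the value of the slope function gives a
    slope function again. *)
Lemma hol_reflect f z : hol f (z^*)%C -> hol (fun w => ((f (w^*)%C)^*)%C) z.
Proof.
move=> [d [phi [cp _ [r r0 H]]]].
exists ((phi (z^*)%C)^*)%C; exists (fun w => ((phi (w^*)%C)^*)%C); split => //.
  move=> e e0; have [s s0 Hs] := cp _ e0; exists s => // w ws.
  by rewrite -conjcB nm_conj; apply: Hs; rewrite -conjcB nm_conj.
exists r => // w wr; have := H (w^*)%C; rewrite -conjcB nm_conj => /(_ wr).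
by move=> /(congr1 (@conjc R)); rewrite conjcM !conjcB !conjcK.
Qed.

End ComplexDerivative.

(** * Subdivision of triangles *)

Section Subdivision.
Context {R : realType}.
Local Notation C := R[i].
Implicit Types (K : set C) (a b c o z w : C) (r : R).

Definition closedc K := forall z,
  (forall e : R, 0 < e -> exists2 w, K w & nm (w - z) < e) -> K z.

(** All subdivisions are dyadic, so midpoints are the only convex combinations that occur. *)
Definition midconvex K := forall a b, K a -> K b -> K ((a + b) / 2).

Definition perimeter a b c : R := nm (b - a) + nm (c - b) + nm (a - c).

Lemma two_neq0 : (2 : C) != 0.
Proof. by rewrite pnatr_eq0. Qed.

Lemma nm_midB a b z : nm ((a + b) / 2 - z) <= (nm (a - z) + nm (b - z)) / 2.
Proof.
have -> : (a + b) / 2 - z = ((a - z) + (b - z)) / 2 by field.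
by rewrite nm_half ler_pM2r ?nmD// invr_gt0.
Qed.

Lemma nm_midl a b : nm ((a + b) / 2 - a) = nm (b - a) / 2.
Proof. by rewrite -nm_half; congr nm; field. Qed.

Lemma nm_midr a b : nm (b - (a + b) / 2) = nm (b - a) / 2.
Proof. by rewrite -nm_half; congr nm; field. Qed.

Lemma midconvex_ball o r : midconvex [set w | nm (w - o) <= r].
Proof. by move=> a b /= ha hb; have := nm_midB a b o; lra. Qed.

Lemma midconvex_openball o r : midconvex [set w | nm (w - o) < r].
Proof. by move=> a b /= ha hb; have := nm_midB a b o; lra. Qed.

Lemma closedc_ball o r : closedc [set w | nm (w - o) <= r].
Proof.
move=> z H /=; apply/ler_addgt0Pr => e /H[w /= wo wz].
by have := nm_dist w z o; rewrite (nm_distC z w); lra.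
Qed.

Lemma midconvexI K L : midconvex K -> midconvex L -> midconvex (K `&` L).
Proof. by move=> hK hL a b [? ?] [? ?]; split; [exact: hK|exact: hL]. Qed.

Lemma closedcI K L : closedc K -> closedc L -> closedc (K `&` L).
Proof. by move=> hK hL z H; split; [apply: hK|apply: hL] => e /H[w [? ?]]; exists w. Qed.

Lemma perimeter_ge0 a b c : 0 <= perimeter a b c.
Proof. by rewrite !addr_ge0// nm_ge0. Qed.

Lemma perimeter_half1 a b c :
  perimeter a ((a + b) / 2) ((c + a) / 2) = perimeter a b c / 2.
Proof. by rewrite /perimeter !mulrDl -!nm_half; congr (nm _ + nm _ + nm _); field. Qed.

Lemma perimeter_half2 a b c :
  perimeter ((a + b) / 2) b ((b + c) / 2) = perimeter a b c / 2.
Proof. by rewrite /perimeter !mulrDl -!nm_half; congr (nm _ + nm _ + nm _); field. Qed.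

Lemma perimeter_half3 a b c :
  perimeter ((c + a) / 2) ((b + c) / 2) c = perimeter a b c / 2.
Proof. by rewrite /perimeter !mulrDl -!nm_half; congr (nm _ + nm _ + nm _); field. Qed.

Lemma perimeter_half4 a b c :
  perimeter ((b + c) / 2) ((c + a) / 2) ((a + b) / 2) = perimeter a b c / 2.
Proof.
rewrite /perimeter !mulrDl -!nm_half -(nmN ((b - a) / 2)) -(nmN ((c - b) / 2)).
by rewrite -(nmN ((a - c) / 2)); congr (nm _ + nm _ + nm _); field.
Qed.

(* Cousin's principle for triangles; segments are the triangles with [b = c]. *)
Lemma subdivision_ind K (P : C -> C -> C -> Prop) : closedc K -> midconvex K ->
    (forall a b c, K a -> K b -> K c ->
      P a ((a + b) / 2) ((c + a) / 2) -> P ((a + b) / 2) b ((b + c) / 2) ->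
      P ((c + a) / 2) ((b + c) / 2) c ->
      P ((b + c) / 2) ((c + a) / 2) ((a + b) / 2) -> P a b c) ->
    (forall z, K z -> exists2 r, 0 < r & forall a b c, K a -> K b -> K c ->
      perimeter a b c < r -> nm (a - z) <= 2 * perimeter a b c -> P a b c) ->
  forall a b c, K a -> K b -> K c -> P a b c.
Proof.
move=> Kc Km hsub hloc a b c Ka Kb Kc'; apply: contrapT => nP.
pose Q (t : C * C * C) := [/\ K t.1.1, K t.1.2, K t.2 & ~ P t.1.1 t.1.2 t.2].
pose p (t : C * C * C) := perimeter t.1.1 t.1.2 t.2.
have [F HF] : exists F, forall t, Q t ->
    [/\ Q (F t), p (F t) = p t / 2 & nm ((F t).1.1 - t.1.1) <= p t / 2].
  suff /choice[F HF] : forall t, exists t', Q t ->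
      [/\ Q t', p t' = p t / 2 & nm (t'.1.1 - t.1.1) <= p t / 2] by exists F.
  move=> [[x y] w]; have [[/= Kx Ky Kw nPt]|nQ] := pselect (Q (x, y, w)); last first.
    by exists (x, y, w) => /nQ.
  have [Kxy Kyw Kwx] : [/\ K ((x + y) / 2), K ((y + w) / 2) & K ((w + x) / 2)].
    by split; exact: Km.
  have n1 := nm_ge0 (y - x); have n2 := nm_ge0 (w - y); have n3 := nm_ge0 (x - w).
  have [P1|nP1] := pselect (P x ((x + y) / 2) ((w + x) / 2)); last first.
    exists (x, (x + y) / 2, (w + x) / 2) => _; split => //; rewrite /p /=.
      exact: perimeter_half1.
    by rewrite subrr nm0 divr_ge0 ?perimeter_ge0.
  have [P2|nP2] := pselect (P ((x + y) / 2) y ((y + w) / 2)); last first.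
    exists ((x + y) / 2, y, (y + w) / 2) => _; split => //; rewrite /p /=.
      exact: perimeter_half2.
    by rewrite nm_midl /perimeter; lra.
  have [P3|nP3] := pselect (P ((w + x) / 2) ((y + w) / 2) w); last first.
    exists ((w + x) / 2, (y + w) / 2, w) => _; split => //; rewrite /p /=.
      exact: perimeter_half3.
    by rewrite (addrC w) nm_midl nm_distC /perimeter; lra.
  exists ((y + w) / 2, (w + x) / 2, (x + y) / 2) => _; split => //=.
  - split => //= P4; exact/nPt/hsub.
  - exact: perimeter_half4.
  - apply: (le_trans (nm_midB _ _ _)).
    by rewrite (nm_distC w x) /p /= /perimeter; lra.
pose t n := iter n F (a, b, c).
have Qt n : Q (t n) by elim: n => [//|n /HF[]].
have pt n : p (t n) = p (t 0) / 2 ^+ n.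
  elim: n => [|n IH]; first by rewrite expr0 divr1.
  by have [_ /= -> _] := HF _ (Qt n); rewrite -/(t n) IH exprSr invfM mulrA.
(* Each choice moves the first vertex by at most half the current perimeter, and perimeters halve.
   [geometric_limit] then places the limit within twice the current perimeter, whence the 2 in the
   local hypothesis. *)
have [z hz] : exists z, forall n, nm ((t n).1.1 - z) <= 2 * (p (t 0) / 2 ^+ n).
  apply: geometric_limit => n; have [_ _ h] := HF _ (Qt n).
  by apply: (le_trans h); rewrite pt exprS invfM mulrCA mulrC.
have Kz : K z.
  apply: Kc => e e0; have [n hn] := half_pow_small (2 * p (t 0)) e0.
  exists (t n).1.1; first by case: (Qt n).
  by apply: (le_lt_trans (hz n)); rewrite mulrA.
have [r r0 H] := hloc z Kz; have [n hn] := half_pow_small (p (t 0)) r0.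
have [K1 K2 K3] := Qt n; apply; apply: H => //; rewrite -/(p (t n)) pt //.
Qed.

Lemma cauchy_limit (u : nat -> C) :
    (forall e : R, 0 < e -> exists N, forall n m, (N <= n)%N -> (N <= m)%N ->
      nm (u n - u m) <= e) ->
  exists z, forall e : R, 0 < e -> exists N, forall n, (N <= n)%N -> nm (u n - z) < e.
Proof.
move=> hu.
have /choice[N hN] : forall k : nat, exists N, forall n m, (N <= n)%N -> (N <= m)%N ->
    nm (u n - u m) <= (2 ^+ k.+1)^-1 by move=> k; apply: hu; rewrite invr_gt0 exprn_gt0.
have [z hz] : exists z, forall k, nm (u (N k) - z) <= 2 * (2 / 2 ^+ k).
  apply: geometric_limit => k; set M := maxn (N k) (N k.+1).
  have h1 := hN k _ _ (leqnn _) (leq_maxl (N k) (N k.+1)).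
  have h2 := hN k.+1 _ _ (leqnn _) (leq_maxr (N k) (N k.+1)).
  have := nm_dist (u M) (u (N k.+1)) (u (N k)); rewrite (nm_distC (u M)).
  rewrite exprS invfM in h2.
  have : 0 <= (2 ^+ k.+1)^-1 :> R by rewrite invr_ge0 exprn_ge0.
  rewrite -/M in h1 h2 *; lra.
(* In units of [2 ^- k], 5 exceeds the 4 coming from [hz] plus the 1/2 coming from [hN]. *)
exists z => e e0; have [k hk] := half_pow_small 5 e0.
exists (N k) => n hn; have h1 := hN k _ _ hn (leqnn _).
have := nm_dist (u (N k)) (u n) z; have := hz k.
rewrite exprS invfM in h1.
have : 0 < (2 ^+ k)^-1 :> R by rewrite invr_gt0 exprn_gt0.
lra.
Qed.

End Subdivision.

(** * Segment integrals and Goursat's lemma *)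

Section SegmentIntegral.
Context {R : realType}.
Local Notation C := R[i].
Implicit Types (f g : C -> C) (K : set C) (a b c o z w L : C) (r M : R).

(** The trapezoid sum over [2 ^ n] equal pieces. In this form splitting at the midpoint holds by
    definition, reversal changes the sign exactly, and affine functions are integrated without error
    at every [n]. *)
Fixpoint trap f n a b : C := match n with
  | 0 => (b - a) * ((f a + f b) / 2)
  | n'.+1 => trap f n' a ((a + b) / 2) + trap f n' ((a + b) / 2) b
  end.

Lemma trapD f g n a b : trap (fun w => f w + g w) n a b = trap f n a b + trap g n a b.
Proof.
elim: n a b => [|n IH] a b /=; last by rewrite !IH addrACA.
by ring.
Qed.

Lemma trapZ k f n a b : trap (fun w => k * f w) n a b = k * trap f n a b.
Proof. by elim: n a b => [|n IH] a b /=; [ring|rewrite !IH mulrDr]. Qed.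

Lemma trap_rev f n a b : trap f n b a = - trap f n a b.
Proof. by elim: n a b => [|n IH] a b /=; [ring|rewrite (addrC b) (IH _ b) (IH a) -opprD [X in - X]addrC]. Qed.

Lemma trap_affine p q n a b :
  trap (fun w => p + q * w) n a b = (p * b + q * (b ^+ 2 / 2)) - (p * a + q * (a ^+ 2 / 2)).
Proof. by elim: n a b => [|n IH] a b /=; [field|rewrite !IH; ring]. Qed.

Lemma trap_bound K f M n a b : midconvex K -> (forall w, K w -> nm (f w) <= M) ->
  K a -> K b -> nm (trap f n a b) <= M * nm (b - a).
Proof.
move=> Km fM; elim: n a b => [|n IH] a b Ka Kb /=.
  rewrite nmM mulrC ler_wpM2r ?nm_ge0// nm_half.
  by have := nmD (f a) (f b); have := fM _ Ka; have := fM _ Kb; lra.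
have Kab := Km _ _ Ka Kb; apply: (le_trans (nmD _ _)).
have := IH _ _ Ka Kab; have := IH _ _ Kab Kb.
by rewrite nm_midl nm_midr; lra.
Qed.

Lemma trap_ext K f g n a b : midconvex K -> (forall w, K w -> f w = g w) ->
  K a -> K b -> trap f n a b = trap g n a b.
Proof.
move=> Km fg; elim: n a b => [|n IH] a b Ka Kb /=; first by rewrite !fg.
by have Kab := Km _ _ Ka Kb; rewrite !IH.
Qed.

Definition is_segint f a b L := forall e : R, 0 < e ->
  exists N, forall n, (N <= n)%N -> nm (trap f n a b - L) < e.

Lemma is_segint_uniq f a b L L' : is_segint f a b L -> is_segint f a b L' -> L = L'.
Proof.
move=> H H'; apply: eq_of_nm_lt => e e0; have e20 : 0 < e / 2 by lra.
have [N HN] := H _ e20; have [N' HN'] := H' _ e20.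
have h1 := HN _ (leq_maxl N N'); have h2 := HN' _ (leq_maxr N N').
have := nm_dist (trap f (maxn N N') a b) L L'; rewrite (nm_distC L (trap _ _ _ _)); lra.
Qed.

Lemma is_segint_lim_bound f a b L M : is_segint f a b L ->
  (forall n, nm (trap f n a b) <= M) -> nm L <= M.
Proof.
move=> H HM; apply/ler_addgt0Pr => e /H[N /(_ _ (leqnn _))].
by have := nm_dist (trap f N a b) L 0; rewrite !subr0 (nm_distC L); have := HM N; lra.
Qed.

Lemma is_segint_bound K f M a b L : midconvex K -> (forall w, K w -> nm (f w) <= M) ->
  K a -> K b -> is_segint f a b L -> nm L <= M * nm (b - a).
Proof. by move=> *; apply: is_segint_lim_bound; [eassumption|move=> n; apply: trap_bound; eauto]. Qed.

Lemma is_segint_D f g a b L L' : is_segint f a b L -> is_segint g a b L' ->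
  is_segint (fun w => f w + g w) a b (L + L').
Proof.
move=> H H' e e0; have e20 : 0 < e / 2 by lra.
have [N HN] := H _ e20; have [N' HN'] := H' _ e20.
exists (maxn N N') => n; rewrite geq_max => /andP[/HN h1 /HN' h2].
by rewrite trapD opprD addrACA; apply: (le_lt_trans (nmD _ _)); lra.
Qed.

Lemma is_segint_Z k f a b L : is_segint f a b L -> is_segint (fun w => k * f w) a b (k * L).
Proof.
move=> H e e0; have k0 : 0 < nm k + 1 by have := nm_ge0 k; lra.
have [N HN] := H _ (divr_gt0 e0 k0); exists N => n /HN h.
rewrite trapZ -mulrBr nmM; move: h; rewrite ltr_pdivlMr// mulrC.
by apply: le_lt_trans; apply: ler_wpM2r; rewrite ?nm_ge0//; lra.
Qed.

Lemma is_segint_rev f a b L : is_segint f a b L -> is_segint f b a (- L).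
Proof. by move=> H e /H[N HN]; exists N => n /HN; rewrite (trap_rev _ _ a b) -opprD nmN. Qed.

Lemma is_segint_affine p q a b :
  is_segint (fun w => p + q * w) a b ((p * b + q * (b ^+ 2 / 2)) - (p * a + q * (a ^+ 2 / 2))).
Proof. by move=> e e0; exists 0 => n _; rewrite trap_affine subrr nm0. Qed.

Lemma is_segint_ext K f g a b L : midconvex K -> (forall w, K w -> f w = g w) ->
  K a -> K b -> is_segint f a b L -> is_segint g a b L.
Proof.
move=> Km fg Ka Kb H e /H[N HN]; exists N => n /HN.
by rewrite (trap_ext _ Km fg).
Qed.

Lemma is_segint_mid f a b L L' : is_segint f a ((a + b) / 2) L -> is_segint f ((a + b) / 2) b L' ->
  is_segint f a b (L + L').
Proof.
move=> H H' e e0; have e20 : 0 < e / 2 by lra.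
have [N HN] := H _ e20; have [N' HN'] := H' _ e20.
exists (maxn N N').+1 => -[//|n]; rewrite ltnS geq_max => /andP[/HN h1 /HN' h2] /=.
by rewrite opprD addrACA; apply: (le_lt_trans (nmD _ _)); lra.
Qed.

Definition admissible K f := [/\ closedc K, midconvex K & forall z, K z -> ccont f z].

(** The oscillation bound [e' * nm (b - a)] is additive under bisection and holds on short segments
    by continuity at a nearby point. Cousin's principle, on degenerate triangles, gives it
    everywhere without uniform continuity. *)
Lemma is_segint_ex K f a b : admissible K f -> K a -> K b -> exists L, is_segint f a b L.
Proof.
move=> [Kc Km cf] Ka Kb; apply: cauchy_limit => e e0.
pose e' := e / (nm (b - a) + 1).
have n0 := nm_ge0 (b - a); have e'0 : 0 < e' by rewrite divr_gt0//; lra.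
suff [N HN] : exists N, forall n m, (N <= n)%N -> (N <= m)%N ->
    nm (trap f n a b - trap f m a b) <= e' * nm (b - a).
  exists N => n m Nn Nm; apply: (le_trans (HN _ _ Nn Nm)).
  by rewrite /e' -mulrA ler_piMr ?(ltW e0)// mulrC ler_pdivrMr; lra.
pose P x y w := y = w -> exists N, forall n m, (N <= n)%N -> (N <= m)%N ->
    nm (trap f n x y - trap f m x y) <= e' * nm (y - x).
suff : P a b b by exact.
apply: (subdivision_ind (K := K)) => //.
all: rewrite {}/P; clearbody e'; clear n0 Ka Kb; clear a b.
  move=> a b c Ka Kb _ P1 P2 _ _ bc; rewrite {}bc in P1 P2 *.
  have [|N1 H1] := P1; first by rewrite addrC.
  have [|N2 H2] := P2; first by field.
  exists (maxn N1 N2).+1 => -[//|n] -[//|m] /=; rewrite !ltnS !geq_max.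
  move=> /andP[n1 n2] /andP[m1 m2].
  rewrite opprD addrACA; apply: (le_trans (nmD _ _)).
  have := H1 _ _ n1 m1; have := H2 _ _ n2 m2.
  by rewrite nm_midl nm_midr; lra.
move=> z Kz; have e0' : 0 < e' / 2 by lra.
have [r r0 Hr] := cf _ Kz _ e0'; exists (r / 4); first by lra.
move=> a' b' c Ka' Kb' _ pr az bc; exists 0 => n m _ _.
have n1 := nm_ge0 (b' - a'); have n2 := nm_ge0 (c - b'); have n3 := nm_ge0 (a' - c).
have az' : nm (a' - z) < r by lra.
have bz' : nm (b' - z) < r.
  by apply: (le_lt_trans (nm_dist a' _ _)); move: pr az; rewrite /perimeter; lra.
(* The sums of the constant [f z] do not depend on [k], so they cancel in the difference; each of
   the two remaining sums is at most half the allowed bound. *)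
have E k : trap f k a' b' = (b' - a') * f z + trap (fun w => f w - f z) k a' b'.
  transitivity (trap (fun w => (f z + 0 * w) + (f w - f z)) k a' b').
    by apply: (@trap_ext [set: C]) => // w _; ring.
  by rewrite trapD trap_affine; congr (_ + _); ring.
have B k : nm (trap (fun w => f w - f z) k a' b') <= e' / 2 * nm (b' - a').
  apply: (trap_bound (K := [set w | nm (w - z) < r])) => //.
    exact: midconvex_openball.
  by move=> w /= /Hr/ltW.
have -> : trap f n a' b' - trap f m a' b' =
   trap (fun w => f w - f z) n a' b' - trap (fun w => f w - f z) m a' b'.
  by rewrite !E; ring.
by apply: (le_trans (nm_sub _ _)); have := B n; have := B m; lra.
Qed.

Definition segint f a b : C := xget 0 [set L | is_segint f a b L].

Lemma is_segint_I f a b L : is_segint f a b L -> segint f a b = L.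
Proof. by move=> H; rewrite /segint; case: xgetP => [L' _ /= H'|/(_ L)//]; exact: is_segint_uniq H' H. Qed.

Lemma segint_P K f a b : admissible K f -> K a -> K b -> is_segint f a b (segint f a b).
Proof. by move=> aK Ka Kb; have [L HL] := is_segint_ex aK Ka Kb; rewrite (is_segint_I HL). Qed.

Lemma segint_rev K f a b : admissible K f -> K a -> K b -> segint f b a = - segint f a b.
Proof. by move=> aK Ka Kb; apply: is_segint_I; apply: is_segint_rev; exact: segint_P aK Ka Kb. Qed.

Lemma segint_mid K f a b : admissible K f -> K a -> K b ->
  segint f a b = segint f a ((a + b) / 2) + segint f ((a + b) / 2) b.
Proof.
move=> aK Ka Kb; have [_ Km _] := aK; have Kab := Km _ _ Ka Kb.
by apply: is_segint_I; apply: is_segint_mid; [exact: segint_P aK Ka Kab|exact: segint_P aK Kab Kb].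
Qed.

Lemma segint_bound K f M a b : admissible K f -> (forall w, K w -> nm (f w) <= M) ->
  K a -> K b -> nm (segint f a b) <= M * nm (b - a).
Proof.
move=> aK fM Ka Kb; have [_ Km _] := aK.
exact: is_segint_bound Km fM Ka Kb (segint_P aK Ka Kb).
Qed.

Lemma segint_same f a : segint f a a = 0.
Proof.
apply: is_segint_I => e e0; exists 0 => n _; rewrite subr0.
apply: le_lt_trans e0; have -> : 0 = nm (f a) * nm (a - a) by rewrite subrr nm0 mulr0.
by apply: (trap_bound (K := [set a])) => // [x y -> ->|w ->//]; field.
Qed.

Lemma admissibleI K K' f : admissible K f -> closedc K' -> midconvex K' ->
  admissible (K `&` K') f.
Proof.
move=> [Kc Km cf] Kc' Km'; split; [exact: closedcI|exact: midconvexI|].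
by move=> z [Kz _]; exact: cf.
Qed.

Definition bd f a b c : C := segint f a b + segint f b c + segint f c a.

Lemma bd_split K f a b c : admissible K f -> K a -> K b -> K c ->
  bd f a b c = bd f a ((a + b) / 2) ((c + a) / 2) + bd f ((a + b) / 2) b ((b + c) / 2)
    + bd f ((c + a) / 2) ((b + c) / 2) c
    + bd f ((b + c) / 2) ((c + a) / 2) ((a + b) / 2).
Proof.
move=> aK Ka Kb Kc; have [_ Km _] := aK.
have K1 := Km _ _ Ka Kb; have K2 := Km _ _ Kb Kc; have K3 := Km _ _ Kc Ka.
rewrite /bd (segint_mid aK Ka Kb) (segint_mid aK Kb Kc) (segint_mid aK Kc Ka).
rewrite (segint_rev aK K1 K2) (segint_rev aK K2 K3) (segint_rev aK K3 K1); ring.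
Qed.

Lemma bd_bound K f M a b c : admissible K f -> (forall w, K w -> nm (f w) <= M) ->
  K a -> K b -> K c -> nm (bd f a b c) <= M * perimeter a b c.
Proof.
move=> aK fM Ka Kb Kc; rewrite /bd /perimeter !mulrDr.
do 2 (apply: (le_trans (nmD _ _)); apply: lerD; last exact: (segint_bound aK)).
exact: (segint_bound aK).
Qed.

(** An affine function has an explicit primitive, whose increments telescope around the triangle. *)
Lemma bd_affine_rem K f p q a b c : admissible K f -> K a -> K b -> K c ->
  bd f a b c = bd (fun w => f w - (p + q * w)) a b c.
Proof.
move=> aK Ka Kb Kc; rewrite /bd.
have E x y : K x -> K y -> segint (fun w => f w - (p + q * w)) x y =
    segint f x y - ((p * y + q * (y ^+ 2 / 2)) - (p * x + q * (x ^+ 2 / 2))).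
  move=> Kx Ky; apply: is_segint_I.
  rewrite -[X in _ - X]mul1r -mulNr.
  apply: (@is_segint_ext [set: C] (fun w => f w + (-1) * (p + q * w))) => //.
    by move=> w _; rewrite mulN1r.
  by apply: is_segint_D; [exact: segint_P aK Kx Ky|exact/is_segint_Z/is_segint_affine].
rewrite !E//; ring.
Qed.

(** The bound [e' * perimeter ^+ 2] passes from the four half-size triangles to the whole one,
    because 4 (p/2)^2 = p^2. It holds on small triangles because there [f] is affine up to a small
    multiple of the distance. *)
Lemma goursat K f a b c : closedc K -> midconvex K -> (forall z, K z -> hol f z) ->
  K a -> K b -> K c -> bd f a b c = 0.
Proof.
move=> Kc Km hf Ka Kb Kc'.
have aK : admissible K f by split => // z /hf/hol_cont.
apply: eq_of_nm_lt => e e0; rewrite subr0.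
have p0 := perimeter_ge0 a b c; set e' := e / (perimeter a b c ^+ 2 + 1).
have p20 := sqr_ge0 (perimeter a b c).
have e'0 : 0 < e' by rewrite divr_gt0//; lra.
suff h : nm (bd f a b c) <= e' * perimeter a b c ^+ 2.
  apply: (le_trans h); rewrite /e' -mulrA ler_piMr ?(ltW e0)//.
  by rewrite mulrC ler_pdivrMr; lra.
move: a b c Ka Kb Kc' p0 @e' p20 e'0 => a0 b0 c0 Ka0 Kb0 Kc0 _ e' _ e'0.
apply: (subdivision_ind (K := K) (P := fun a b c =>
  nm (bd f a b c) <= e' * perimeter a b c ^+ 2)) => //.
  move=> a b c Ka Kb Kc'.
  rewrite perimeter_half1 perimeter_half2 perimeter_half3 perimeter_half4.
  move=> h1 h2 h3 h4; rewrite (bd_split aK Ka Kb Kc').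
  set p := perimeter a b c in h1 h2 h3 h4 *.
  have -> : e' * p ^+ 2 = e' * (p / 2) ^+ 2 + e' * (p / 2) ^+ 2 + e' * (p / 2) ^+ 2
    + e' * (p / 2) ^+ 2 by field.
  by do 3 (apply: (le_trans (nmD _ _)); apply: lerD => //).
move=> z Kz; have [d hd] := hf _ Kz.
(* The vertices lie within 3p of [z]: the first within 2p by the local hypothesis, the others at
   most p further. The remainder is then at most [e' / 3 * (3 * p)], on a contour of length p. *)
have e4 : 0 < e' / 3 by lra.
have [r r0 Hr] := cd_bound hd e4; exists (r / 4); first by lra.
move=> a b c Ka Kb Kc' pr az; set p := perimeter a b c in pr az *.
have p0 : 0 <= p := perimeter_ge0 a b c.
have n1 := nm_ge0 (b - a); have n2 := nm_ge0 (c - b); have n3 := nm_ge0 (a - c).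
have bz : nm (b - z) <= 3 * p.
  by apply: (le_trans (nm_dist a _ _)); move: az; rewrite /p /perimeter; lra.
have cz : nm (c - z) <= 3 * p.
  apply: (le_trans (nm_dist a _ _)); move: az; rewrite (nm_distC c).
  by rewrite /p /perimeter; lra.
rewrite (bd_affine_rem (f z - d * z) d aK)//.
have -> : e' * p ^+ 2 = (e' / 3 * (3 * p)) * p by field.
have [Kcb Kmb] : closedc [set w | nm (w - z) <= 3 * p] /\ midconvex [set w | nm (w - z) <= 3 * p].
  by split; [exact: closedc_ball|exact: midconvex_ball].
apply: (bd_bound (K := K `&` [set w | nm (w - z) <= 3 * p])).
- apply: admissibleI => //; split => // w Kw; apply: ccB; first by have [_ _] := aK; apply.
  apply: ccD; first exact: cc_cst.
  by apply: ccM; [exact: cc_cst|exact: cc_id].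
- move=> w [_ /= wz]; have -> : f w - (f z - d * z + d * w) = f w - f z - d * (w - z) by ring.
  apply: (@le_trans _ _ (e' / 3 * nm (w - z))); last by rewrite ler_pM2l.
  by apply: Hr; lra.
- by split => //=; lra.
- by split.
- by split.
Qed.

(** A line through [o] leaves [b] and [c] strictly on one side, with margin [k]; a triangle with
    vertex [o] can then be trimmed at [o] inside a half-plane. *)
Definition separated o b c := exists nu : C, exists2 k : R, 0 < k &
  k <= complex.Re (nu * (b - o)) /\ k <= complex.Re (nu * (c - o)).

Lemma Re_add z w : complex.Re (z + w) = complex.Re z + complex.Re w.
Proof. by case: z w => ? ? [? ?]. Qed.

Lemma Re_half z : complex.Re (z / 2) = complex.Re z / 2.
Proof.
have {2}-> : z = z / 2 + z / 2 by field.
by rewrite Re_add; lra.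
Qed.

Lemma midconvex_halfplane nu o (k : R) : midconvex [set w | k <= complex.Re (nu * (w - o))].
Proof.
move=> a b /= ha hb.
have -> : nu * ((a + b) / 2 - o) = (nu * (a - o) + nu * (b - o)) / 2 by field.
by rewrite Re_half Re_add; lra.
Qed.

Lemma closedc_halfplane nu o (k : R) : closedc [set w | k <= complex.Re (nu * (w - o))].
Proof.
move=> z H /=; apply/ler_addgt0Pr => e e0.
have n0 : 0 < nm nu + 1 by have := nm_ge0 nu; lra.
have [w /= kw wz] := H _ (divr_gt0 e0 n0).
have -> : nu * (z - o) = nu * (w - o) + nu * (z - w) by ring.
apply: (le_trans kw); rewrite Re_add -addrA lerDl.
have h : nm (nu * (z - w)) <= e.
  rewrite nmM nm_distC; move: wz; rewrite ltr_pdivlMr// => /ltW; apply: le_trans.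
  by rewrite mulrC ler_wpM2l ?nm_ge0//; lra.
by have := nm_Re (nu * (z - w)); rewrite ler_norml => /andP[]; lra.
Qed.

(** The three subtriangles away from the corner [o] lie in the half-plane at margin [k / 2], which
    misses [o], so [goursat] kills them. *)
Lemma goursat_vertex_step K f o b c : admissible K f ->
    (forall z, K z -> z != o -> hol f z) -> K o -> K b -> K c -> separated o b c ->
  bd f o b c = bd f o ((o + b) / 2) ((c + o) / 2).
Proof.
move=> aK hf Ko Kb Kc [nu [k k0 [hb hc]]]; have [Kcl Km _] := aK.
have K1 := Km _ _ Ko Kb; have K2 := Km _ _ Kb Kc; have K3 := Km _ _ Kc Ko.
rewrite (bd_split aK Ko Kb Kc).
have Hmid x y : nu * ((x + y) / 2 - o) = (nu * (x - o)) / 2 + (nu * (y - o)) / 2 by field.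
pose H := K `&` [set w | k / 2 <= complex.Re (nu * (w - o))].
have ZZ x y w : H x -> H y -> H w -> bd f x y w = 0.
  apply: goursat.
  - by apply: closedcI => //; exact: closedc_halfplane.
  - by apply: midconvexI => //; exact: midconvex_halfplane.
  - move=> z [Kz /= hz]; apply: hf => //; apply/eqP => zo; move: hz.
    by rewrite zo subrr mulr0 /=; lra.
have Hb : H b by split => //=; lra.
have Hc : H c by split => //=; lra.
have H1 : H ((o + b) / 2).
  by split => //=; rewrite Hmid Re_add !Re_half subrr mulr0 /=; lra.
have H2 : H ((b + c) / 2) by split => //=; rewrite Hmid Re_add !Re_half; lra.
have H3 : H ((c + o) / 2).
  by split => //=; rewrite Hmid Re_add !Re_half subrr mulr0 /=; lra.
by rewrite (ZZ _ b)// (ZZ _ _ c)// (ZZ ((b + c) / 2))// !addr0.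
Qed.

(** At [o] only continuity is assumed. Halving towards [o] preserves the contour integral, while [f]
    is bounded near [o] and the perimeter tends to 0. *)
Lemma goursat_vertex K f o b c : admissible K f ->
    (forall z, K z -> z != o -> hol f z) -> K o -> K b -> K c -> separated o b c ->
  bd f o b c = 0.
Proof.
move=> aK hf Ko Kb Kc sep; have [Kcl Km cf] := aK.
have step n : exists b' c', [/\ K b', K c', separated o b' c',
    perimeter o b' c' = perimeter o b c / 2 ^+ n & bd f o b c = bd f o b' c'].
  elim: n => [|n [b' [c' [Kb' Kc' sep' hp hbd]]]].
    by exists b, c; split => //; rewrite expr0 divr1.
  exists ((o + b') / 2), ((c' + o) / 2); split.
  - exact: Km.
  - exact: Km.
  - have [nu [k k0 [h1 h2]]] := sep'; exists nu; exists (k / 2); first by lra.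
    have Hm x : nu * ((o + x) / 2 - o) = (nu * (x - o)) / 2 by field.
    by rewrite (addrC c') !Hm !Re_half; lra.
  - by rewrite perimeter_half1 hp exprSr invfM mulrA.
  - by rewrite hbd; exact: goursat_vertex_step aK hf Ko Kb' Kc' sep'.
have [r r0 Hr] := cc_bounded (cf _ Ko); set M := nm (f o) + 1 in Hr.
have M0 : 0 < M by rewrite /M; have := nm_ge0 (f o); lra.
apply: eq_of_nm_lt => e e0; rewrite subr0.
have m0 : 0 < Num.min r (e / M) by rewrite lt_min r0 divr_gt0.
have [n] := half_pow_small (perimeter o b c) m0; rewrite lt_min => /andP[h1 h2].
have [b' [c' [Kb' Kc' _ hp ->]]] := step n; rewrite -hp in h1 h2.
have n1 := nm_ge0 (b' - o); have n2 := nm_ge0 (c' - b'); have n3 := nm_ge0 (o - c').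
pose r' := perimeter o b' c'.
apply: (@le_trans _ _ (M * perimeter o b' c')); last first.
  by move: h2; rewrite ltr_pdivlMr// mulrC => /ltW.
apply: (bd_bound (K := K `&` [set w | nm (w - o) <= r'])).
- by apply: admissibleI => //; [exact: closedc_ball|exact: midconvex_ball].
- by move=> w [_ /= wr]; apply: ltW; apply: Hr; exact: le_lt_trans h1.
- by split => //=; rewrite subrr nm0 perimeter_ge0.
- by split => //=; rewrite /r' /perimeter; lra.
- by split => //=; rewrite nm_distC /r' /perimeter; lra.
Qed.

End SegmentIntegral.

(** * Primitives and the Cauchy kernel *)

Section Primitive.
Context {R : realType}.
Local Notation C := R[i].
Implicit Types (f g : C -> C) (K : set C) (a b c o z w L : C) (r M : R).

Lemma segint_D K f g a b : admissible K f -> admissible K g -> K a -> K b ->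
  segint (fun w => f w + g w) a b = segint f a b + segint g a b.
Proof. by move=> af ag Ka Kb; apply: is_segint_I; apply: is_segint_D; apply: segint_P; eassumption. Qed.

Lemma segint_Z K f k a b : admissible K f -> K a -> K b ->
  segint (fun w => k * f w) a b = k * segint f a b.
Proof. by move=> af Ka Kb; apply: is_segint_I; apply: is_segint_Z; exact: segint_P af Ka Kb. Qed.

Lemma segint_ext K f g a b : admissible K f -> (forall w, K w -> f w = g w) ->
  K a -> K b -> segint f a b = segint g a b.
Proof.
move=> af fg Ka Kb; symmetry; apply: is_segint_I; have [_ Km _] := af.
exact: is_segint_ext Km fg Ka Kb (segint_P af Ka Kb).
Qed.

Lemma segint_cst k a b : segint (fun=> k) a b = k * (b - a).
Proof.
apply: is_segint_I; rewrite mulrBr.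
have H := is_segint_affine k 0 a b; rewrite !mul0r !addr0 in H.
by apply: (is_segint_ext (K := [set: C])) H => // w _; rewrite mul0r addr0.
Qed.

Lemma admissible_cst K k : closedc K -> midconvex K -> admissible K (fun=> k).
Proof. by move=> Kc Km; split => // z _; exact: cc_cst. Qed.

Lemma admissibleD K f g : admissible K f -> admissible K g ->
  admissible K (fun w => f w + g w).
Proof. by move=> [? ? cf] [_ _ cg]; split => // z Kz; apply: ccD; [exact: cf|exact: cg]. Qed.

Lemma admissibleM K f g : admissible K f -> admissible K g ->
  admissible K (fun w => f w * g w).
Proof. by move=> [? ? cf] [_ _ cg]; split => // z Kz; apply: ccM; [exact: cf|exact: cg]. Qed.

Lemma segint_near_cst K f k M a b : admissible K f -> K a -> K b ->
  (forall w, K w -> nm (f w - k) <= M) -> nm (segint f a b - k * (b - a)) <= M * nm (b - a).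
Proof.
move=> af Ka Kb fM; have [Kc Km _] := af.
have ac : admissible K (fun=> - k) by exact: admissible_cst.
have -> : segint f a b - k * (b - a) = segint (fun w => f w + - k) a b.
  by rewrite (segint_D af ac)// segint_cst mulNr.
by apply: (segint_bound (admissibleD af ac)).
Qed.

Definition cball o r := [set w : C | nm (w - o) <= r].

Lemma cball_admissible o r f : (forall z, cball o r z -> ccont f z) -> admissible (cball o r) f.
Proof. by move=> cf; split => //; [exact: closedc_ball|exact: midconvex_ball]. Qed.

Lemma cball_center o r : 0 <= r -> cball o r o.
Proof. by move=> r0; rewrite /cball /= subrr nm0. Qed.

Lemma nm_sqr z : nm z ^+ 2 = complex.Re ((z^*)%C * z).
Proof. by case: z => x y; rewrite /nm sqr_sqrtr ?addr_ge0 ?sqr_ge0//=; ring. Qed.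

(** The direction is that of [z - o]: pairing [w - o] with it gives [nm (z - o) ^+ 2] up to an error
    of at most [nm (z - o) * nm (w - z)]. *)
Lemma separated_near o z w : z != o -> nm (w - z) < nm (z - o) -> separated o z w.
Proof.
move=> zo wz; have n0 : 0 < nm (z - o) by apply: nm_gt0; rewrite subr_eq0.
exists ((z - o)^*)%C; exists (nm (z - o) * (nm (z - o) - nm (w - z))).
  by rewrite mulr_gt0// subr_gt0.
have nn := nm_ge0 (w - z).
have -> : ((z - o)^*)%C * (w - o) = ((z - o)^*)%C * (z - o) + ((z - o)^*)%C * (w - z) by ring.
rewrite Re_add -nm_sqr; have := nm_Re (((z - o)^*)%C * (w - z)).
rewrite nmM nm_conj ler_norml => /andP[h _].
have := mulr_ge0 (ltW n0) nn.
by split; rewrite mulrBr expr2; lra.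
Qed.

(** Continuity alone at the centre is allowed so that the result applies to removable
    singularities. *)
Lemma primitive_punctured f o r : 0 < r -> (forall z, cball o r z -> ccont f z) ->
    (forall z, cball o r z -> z != o -> hol f z) ->
  forall z, nm (z - o) < r -> cderiv (segint f o) z (f z).
Proof.
move=> r0 cf hf z zr; have aK := cball_admissible cf.
have Ko := cball_center o (ltW r0); have Kz : cball o r z by exact: ltW.
apply: cd_of_bound => e e0; have [s s0 Hs] := cf _ Kz _ e0.
have : nearc z (fun w => z != o -> nm (w - z) < nm (z - o)).
  have [->|zo] := eqVneq z o; first by apply: nearc_all.
  by exists (nm (z - o)) => //; apply: nm_gt0; rewrite subr_eq0.
move=> H; apply: nearcW (nearc_and H (nearc_and (nearc_ball z s0) (nearc_open zr))).
move=> w [Hw [ws wr]]; have Kw : cball o r w by exact: ltW.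
(* Goursat on the triangle [o], [z], [w], whose possible singularity is the vertex [o]; the
   condition on [w] separates [z] and [w] from it. If [z] is [o] the triangle degenerates. *)
have -> : segint f o w - segint f o z = segint f z w.
  have [zo|zo] := eqVneq z o; first by rewrite zo segint_same subr0.
  have := goursat_vertex aK hf Ko Kz Kw (separated_near zo (Hw zo)).
  rewrite /bd (segint_rev aK Ko Kw) => h.
  have -> : segint f z w = (segint f o z + segint f z w - segint f o w) - segint f o z + segint f o w by ring.
  by rewrite h; ring.
apply: (segint_near_cst (K := cball o r `&` cball z (nm (w - z)))).
- by apply: admissibleI => //; [exact: closedc_ball|exact: midconvex_ball].
- by split => //; rewrite /cball /= subrr nm0 nm_ge0.
- by split => //; rewrite /cball /=.
- by move=> u [_ uz]; apply: ltW; apply: Hs; exact: le_lt_trans ws.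
Qed.

Lemma hol_primitive f o r : 0 < r -> (forall z, cball o r z -> hol f z) ->
  forall z, nm (z - o) < r -> cderiv (segint f o) z (f z).
Proof.
move=> r0 hf; apply: primitive_punctured => // z Kz; last by move=> _; exact: hf.
by apply/hol_cont/hf.
Qed.

Definition slope f z d w : C := if w == z then d else (f w - f z) / (w - z).

Lemma slope_cont f z d : cderiv f z d -> ccont (slope f z d) z.
Proof.
move=> [phi [cp pd H]]; apply: cc_near cp; apply: nearcW H => w e.
rewrite /slope; case: eqP => [->//|/eqP wz].
by rewrite e mulfK// subr_eq0.
Qed.

Lemma slope_hol f z d w : w != z -> hol f w -> hol (slope f z d) w.
Proof.
move=> wz hf; apply: (@hol_near _ (fun u => (f u - f z) / (u - z))).
  by apply: nearcW (nearc_neq wz) => u uz; rewrite /slope (negbTE uz).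
apply: holM; first by apply: holB => //; exact: hol_cst.
apply: holV; last by rewrite subr_eq0.
by apply: holB; [exact: hol_id|exact: hol_cst].
Qed.

(** Differentiation under the integral sign: the remainder is quadratic in [w - z], uniformly on
    [K], so no convergence theorem is involved. *)
Lemma param_deriv K a b (k : C -> C -> C) (k' : C -> C) z M : K a -> K b ->
    nearc z (fun w => admissible K (k w)) -> admissible K k' ->
    nearc z (fun w => forall u, K u ->
      nm (k w u - k z u - k' u * (w - z)) <= M * nm (w - z) ^+ 2) ->
  cderiv (fun w => segint (k w) a b) z (segint k' a b).
Proof.
move=> Ka Kb adk adk' H; apply: cd_of_bound => e e0.
have M'0 : 0 < `|M| * nm (b - a) + 1.
  by have := mulr_ge0 (normr_ge0 M) (nm_ge0 (b - a)); lra.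
have e'0 := divr_gt0 e0 M'0; have akz := nearc_self adk; have [Kc Km _] := akz.
apply: nearcW (nearc_and (nearc_ball z e'0) (nearc_and adk H)) => w [we [akw B]].
have akN : admissible K (fun u => -1 * k z u) by apply: admissibleM => //; exact: admissible_cst.
have akN' : admissible K (fun u => - (w - z) * k' u).
  by apply: admissibleM => //; exact: admissible_cst.
have -> : segint (k w) a b - segint (k z) a b - segint k' a b * (w - z) =
    segint (fun u => k w u + -1 * k z u + - (w - z) * k' u) a b.
  rewrite (segint_D (admissibleD akw akN) akN')// (segint_D akw akN)// (segint_Z _ akz)// (segint_Z _ adk')//.
  by ring.
apply: (@le_trans _ _ ((`|M| * nm (w - z) ^+ 2) * nm (b - a))).
  apply: (segint_bound (K := K)) => //; first by apply: admissibleD => //; exact: admissibleD.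
  move=> u Ku; apply: (@le_trans _ _ (M * nm (w - z) ^+ 2)).
    by apply: le_trans (B _ Ku); rewrite (_ : _ + _ = k w u - k z u - k' u * (w - z))//; ring.
  by rewrite ler_wpM2r ?sqr_ge0// ler_norm.
have n0 := nm_ge0 (w - z); rewrite expr2.
have -> : `|M| * (nm (w - z) * nm (w - z)) * nm (b - a) =
  (`|M| * nm (b - a) * nm (w - z)) * nm (w - z) by ring.
apply: ler_wpM2r => //.
move: we; rewrite ltr_pdivlMr// => /ltW; apply: le_trans.
by rewrite mulrC mulrDr mulr1 lerDl.
Qed.

(** The second conclusion says that the derivative found in the first is itself holomorphic;
    [derivative_hol] rests on it. *)
Lemma cauchy_kernel_deriv K a b (phi : C -> C) z (k : R) M : K a -> K b ->
    admissible K phi -> (forall u, K u -> nm (phi u) <= M) ->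
    0 < k -> (forall u, K u -> k <= nm (u - z)) ->
  cderiv (fun w => segint (fun u => phi u * (u - w)^-1) a b) z
         (segint (fun u => phi u * (u - z)^-1 ^+ 2) a b) /\
  hol (fun w => segint (fun u => phi u * (u - w)^-1 ^+ 2) a b) z.
Proof.
move=> Ka Kb aphi phiM k0 hk; have [Kc Km cphi] := aphi.
have k20 : 0 < k / 2 by lra.
have far w : nm (w - z) < k / 2 -> forall u, K u -> k / 2 <= nm (u - w).
  by move=> wz u /hk h; have := nm_dist w u z; lra.
have far0 w : nm (w - z) < k / 2 -> forall u, K u -> u - w != 0.
  by move=> wz u Ku; apply/eqP => h; have := far _ wz _ Ku; rewrite h nm0; lra.
have zz : nm (z - z) < k / 2 by rewrite subrr nm0.
have cinv w : nm (w - z) < k / 2 -> admissible K (fun u => (u - w)^-1).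
  move=> wz; split => // u Ku; apply: ccV; last exact: far0 wz _ Ku.
  by apply: ccB; [exact: cc_id|exact: cc_cst].
have cinvn w n : nm (w - z) < k / 2 -> admissible K (fun u => phi u * (u - w)^-1 ^+ n).
  move=> wz; apply: admissibleM => //; elim: n => [|n IH]; first exact: admissible_cst.
  have [_ _ cn] := admissibleM (cinv _ wz) IH.
  by split => // u Ku; apply: cc_near (cn _ Ku); apply: nearc_all => v; rewrite exprS.
(* For [w] within [k / 2] of [z], every point of [K] is at least [k / 2] away from [w]; thus [m]
   bounds the kernel at [w] as well as at [z]. *)
pose m := 2 / k.
have bnd w : nm (w - z) < k / 2 -> forall u, K u -> nm ((u - w)^-1) <= m.
  move=> wz u Ku; rewrite nmV -[m]invrK lef_pV2 ?posrE ?invr_gt0 ?divr_gt0//.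
    by apply: le_trans (far _ wz _ Ku); rewrite /m invf_div.
  by apply: nm_gt0; exact: far0 wz _ Ku.
have m0 : 0 < m by rewrite divr_gt0.
split.
- apply: (@param_deriv K a b (fun w u => phi u * (u - w)^-1) _ _ (M * (m * m ^+ 2))) => //.
  + by exists (k / 2) => // w wz; apply: admissibleM => //; exact: cinv.
  + exact: cinvn.
  + exists (k / 2) => // w wz u Ku.
    have u1 := far0 _ wz _ Ku; have u2 := far0 _ zz _ Ku.
    have -> : phi u * (u - w)^-1 - phi u * (u - z)^-1 - phi u * (u - z)^-1 ^+ 2 * (w - z) =
        phi u * ((u - w)^-1 * (u - z)^-1 ^+ 2) * (w - z) ^+ 2.
      by field; rewrite u1 u2.
    rewrite !(nmX, nmM); apply: ler_wpM2r; first exact: sqr_ge0.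
    apply: ler_pM; rewrite ?nm_ge0 ?mulr_ge0 ?sqr_ge0 ?nm_ge0 ?phiM//.
    apply: ler_pM; rewrite ?nm_ge0 ?sqr_ge0 ?bnd//.
    by rewrite lerXn2r ?nnegrE ?nm_ge0 ?(ltW m0)//; exact: bnd zz _ Ku.
- exists (segint (fun u => (2 * phi u) * (u - z)^-1 ^+ 3) a b).
  apply: (@param_deriv K a b (fun w u => phi u * (u - w)^-1 ^+ 2) _ _
    (M * ((m * m ^+ 2) * (3 * m)))) => //.
  + by exists (k / 2) => // w wz; exact: cinvn.
  + have [_ _ cn] := admissibleM (admissible_cst 2 Kc Km) (cinvn _ 3%N zz).
    by split => // u Ku; apply: cc_near (cn _ Ku); apply: nearc_all => v; rewrite mulrA.
  + exists (k / 2) => // w wz u Ku.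
    have u1 := far0 _ wz _ Ku; have u2 := far0 _ zz _ Ku.
    have -> : phi u * (u - w)^-1 ^+ 2 - phi u * (u - z)^-1 ^+ 2
          - 2 * phi u * (u - z)^-1 ^+ 3 * (w - z) =
        phi u * (((u - w)^-1 * (u - z)^-1 ^+ 2) * ((u - w)^-1 + 2 * (u - z)^-1)) * (w - z) ^+ 2.
      by field; rewrite u1 u2.
    rewrite !(nmX, nmM); apply: ler_wpM2r; first exact: sqr_ge0.
    apply: ler_pM; rewrite ?nm_ge0 ?mulr_ge0 ?sqr_ge0 ?nm_ge0 ?phiM//.
    have b1 := bnd _ wz _ Ku; have b2 := bnd _ zz _ Ku.
    apply: ler_pM; rewrite ?nm_ge0 ?mulr_ge0 ?sqr_ge0 ?nm_ge0//.
      apply: ler_pM; rewrite ?nm_ge0 ?sqr_ge0//.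
      by rewrite lerXn2r ?nnegrE ?nm_ge0 ?(ltW m0).
    by apply: (le_trans (nmD _ _)); rewrite nmM (nm_natr 2); lra.
Qed.

End Primitive.

(** * Cauchy's formula and its consequences *)

Section Cauchy.
Context {R : realType}.
Local Notation C := R[i].
Implicit Types (f g : C -> C) (K : set C) (a b c o z w u : C) (r M : R).
Local Notation i := ('i%C : C).

Lemma i2 : i * i = -1.
Proof. by rewrite -expr2 sqr_i. Qed.

Lemma Re_real_mul (x : R) z : complex.Re (x%:C%C * z) = x * complex.Re z.
Proof. by case: z => p q /=; ring. Qed.

Lemma Im_real_mul (x : R) z : complex.Im (x%:C%C * z) = x * complex.Im z.
Proof. by case: z => p q /=; ring. Qed.

Lemma Im_add z w : complex.Im (z + w) = complex.Im z + complex.Im w.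
Proof. by case: z w => ? ? [? ?]. Qed.

Lemma conjc_mul_unit u : nm u = 1 -> (u^*)%C * u = 1.
Proof.
case: u => x y h; have : nm (x +i* y)%C ^+ 2 = 1 by rewrite h expr1n.
rewrite nm_sqr => h'; apply/eqP; rewrite eq_complex; apply/andP; split; apply/eqP.
  exact: h'.
by rewrite /=; ring.
Qed.

(** * The sides of the square around a point *)

Definition vtx o r u : C := o + r%:C%C * u.

(** The conjugate of (1 + i) u, the outward normal of the side from [u] to [i * u]. *)
Definition normal u : C := (u^*)%C * (1 - i).

(** The part of the disc beyond the line of the side: closed, midconvex, and containing both ends of
    the side. Since [normal u] has modulus at most 2, it stays at distance [r / 2] from [o], hence
    [r / 4] from any [z] with [nm (z - o) < r / 4]. *)
Definition side_set o r u : set C :=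
  cball o r `&` [set w | r <= complex.Re (normal u * (w - o))].

Lemma nm_normal u : nm u = 1 -> nm (normal u) <= 2.
Proof.
move=> u1; rewrite nmM nm_conj u1 mul1r; apply: (le_trans (nm_sub _ _)).
by have := nm_i (1 : C); rewrite mulr1 nm1 => ->; lra.
Qed.

Lemma Re_normal_vtx o r u : nm u = 1 ->
  complex.Re (normal u * (vtx o r u - o)) = r /\
  complex.Re (normal u * (vtx o r (i * u) - o)) = r.
Proof.
move=> /conjc_mul_unit uu.
have E1 : normal u * (vtx o r u - o) = r%:C%C * (1 - i) * ((u^*)%C * u).
  by rewrite /normal /vtx; ring.
have E2 : normal u * (vtx o r (i * u) - o) = r%:C%C * (i - i * i) * ((u^*)%C * u).
  by rewrite /normal /vtx; ring.
rewrite E1 E2 uu !mulr1 i2 !Re_real_mul /=; split; ring.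
Qed.

Section Side.
Variables (o : C) (r : R) (u : C).
Hypotheses (r0 : 0 < r) (u1 : nm u = 1).

Lemma side_closed : closedc (side_set o r u).
Proof. by apply: closedcI; [exact: closedc_ball|exact: closedc_halfplane]. Qed.

Lemma side_midconvex : midconvex (side_set o r u).
Proof. by apply: midconvexI; [exact: midconvex_ball|exact: midconvex_halfplane]. Qed.

Lemma side_vtx : side_set o r u (vtx o r u) /\ side_set o r u (vtx o r (i * u)).
Proof.
have [h1 h2] := Re_normal_vtx o r u1; have r0' := ltW r0.
have hb v : nm v = 1 -> cball o r (vtx o r v).
  by move=> v1; rewrite /cball /= /vtx addrC addKr nmM nm_real ger0_norm// v1 mulr1.
by split; split; rewrite /= ?h1 ?h2//; apply: hb; rewrite ?nm_i.
Qed.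

Lemma Re_normal_le z : complex.Re (normal u * z) <= 2 * nm z.
Proof.
have := nm_Re (normal u * z); rewrite nmM ler_norml => /andP[_ h].
by apply: (le_trans h); apply: ler_wpM2r; [exact: nm_ge0|exact: nm_normal].
Qed.

Lemma side_center w : side_set o r u w -> r / 2 <= nm (w - o).
Proof. by move=> [_ /= h]; have := Re_normal_le (w - o); lra. Qed.

Lemma side_far z w : nm (z - o) < r / 4 -> side_set o r u w -> r / 4 <= nm (w - z).
Proof. by move=> hz /side_center h; have := nm_dist z w o; lra. Qed.

Lemma side_separated z : nm (z - o) < r / 4 ->
  separated z (vtx o r u) (vtx o r (i * u)).
Proof.
move=> hz; exists (normal u); exists (r / 2); first by rewrite divr_gt0.
have [h1 h2] := Re_normal_vtx o r u1; have h := Re_normal_le (z - o).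
have E v : normal u * (v - z) + normal u * (z - o) = normal u * (v - o) by ring.
by split; [move: h1; rewrite -E Re_add|move: h2; rewrite -E Re_add]; lra.
Qed.

Lemma side_length : nm (vtx o r (i * u) - vtx o r u) <= 2 * r.
Proof.
have r_gt0 := r0.
have -> : vtx o r (i * u) - vtx o r u = r%:C%C * (i * u) - r%:C%C * u by rewrite /vtx; ring.
by apply: (le_trans (nm_sub _ _)); rewrite !nmM -nmM nm_i u1 nm_real gtr0_norm//; lra.
Qed.

Lemma side_inv_admissible z : nm (z - o) < r / 4 ->
  admissible (side_set o r u) (fun w => (w - z)^-1).
Proof.
have r_gt0 := r0.
move=> hz; split; [exact: side_closed|exact: side_midconvex|] => w Kw.
apply: ccV; first by apply: ccB; [exact: cc_id|exact: cc_cst].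
by apply/eqP => h; have := side_far hz Kw; rewrite h nm0; lra.
Qed.

Let p (t : R) : C := vtx o r (((1 - t) +i* t)%C * u).

(** The quotient is t2 - t1 times (i - 1) / ((1 - s) + i s), whose imaginary part is 1 / ((1 - s)^2
    + s^2), at least 1 on the unit interval: seen from [o], the argument increases along the
    side. *)
Lemma side_pointE t1 t2 (s : R) : 0 <= s <= 1 ->
  t2 - t1 <= complex.Im ((p t2 - p t1) * (p s - o)^-1) \/ t2 < t1.
Proof.
move=> /andP[s0 s1]; have [t12|] := leP t1 t2; last by right.
left; have u0 : u != 0 by apply/eqP => h; move: u1; rewrite h nm0 => /eqP; rewrite eq_sym oner_eq0.
have rC : r%:C%C != 0 :> C by apply/eqP => -[h]; move: r0; rewrite h ltxx.
have S0 : 0 < (1 - s) ^+ 2 + s ^+ 2 by nra.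
have q0 : ((1 - s) +i* s)%C != 0 :> C.
  by apply/eqP => -[h1 h2]; move: S0; rewrite h1 h2 expr0n /= addr0 ltxx.
have -> : (p t2 - p t1) * (p s - o)^-1 = (t2 - t1)%:C%C * ((i - 1) / ((1 - s) +i* s)%C).
  have -> : p s - o = r%:C%C * (((1 - s) +i* s)%C * u) by rewrite /p /vtx addrC addKr.
  have -> : p t2 - p t1 = r%:C%C * ((t2 - t1)%:C%C * (i - 1) * u).
    have -> : (t2 - t1)%:C%C * (i - 1) = ((1 - t2) +i* t2)%C - ((1 - t1) +i* t1)%C.
      by apply/eqP; rewrite eq_complex /=; apply/andP; split; apply/eqP; ring.
    by rewrite /p /vtx; ring.
  by field; rewrite u0 rC q0.
rewrite Im_real_mul -[X in X <= _]mulr1; apply: ler_wpM2l; first by rewrite subr_ge0.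
have -> : complex.Im ((i - 1) / ((1 - s) +i* s)%C) = ((1 - s) ^+ 2 + s ^+ 2)^-1.
  by rewrite /=; field; rewrite gt_eqF.
by rewrite invf_ge1//; nra.
Qed.

(** The lower bound is additive at midpoints, so it holds for each trapezoid sum and survives in the
    limit; every side thus contributes at least 1. *)
Lemma side_trap_Im n t1 t2 : 0 <= t1 -> t1 <= t2 -> t2 <= 1 ->
  t2 - t1 <= complex.Im (trap (fun w => (w - o)^-1) n (p t1) (p t2)).
Proof.
elim: n t1 t2 => [|n IH] t1 t2 h1 h2 h3 /=.
  have -> : (p t2 - p t1) * (((p t1 - o)^-1 + (p t2 - o)^-1) / 2) =
      ((p t2 - p t1) * (p t1 - o)^-1 + (p t2 - p t1) * (p t2 - o)^-1) / 2 by ring.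
  have Im_half z : complex.Im (z / 2) = complex.Im z / 2.
    have {2}-> : z = z / 2 + z / 2 by field.
    by rewrite Im_add; lra.
  rewrite Im_half Im_add.
  have [|k1|] := @side_pointE t1 t2 t1; [by apply/andP; lra| |lra].
  have [|k2|] := @side_pointE t1 t2 t2; [by apply/andP; lra| |lra].
  lra.
have -> : (p t1 + p t2) / 2 = p ((t1 + t2) / 2).
  rewrite /p /vtx.
  have -> : ((1 - (t1 + t2) / 2) +i* ((t1 + t2) / 2))%C =
      (((1 - t1) +i* t1)%C + ((1 - t2) +i* t2)%C) / 2 :> C.
    apply: (mulIf two_neq0); rewrite divfK ?two_neq0//.
    by apply/eqP; rewrite eq_complex /=; apply/andP; split; apply/eqP; field.
  by field.
rewrite Im_add; have k1 := IH t1 ((t1 + t2) / 2); have k2 := IH ((t1 + t2) / 2) t2.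
by have := k1 _ _ _; have := k2 _ _ _; lra.
Qed.

Lemma side_I_Im : 1 <= complex.Im (segint (fun w => (w - o)^-1) (vtx o r u) (vtx o r (i * u))).
Proof.
have r_gt0 := r0.
have zo : nm (o - o) < r / 4 by rewrite subrr nm0; lra.
have [Ka Kb] := side_vtx.
have H := segint_P (side_inv_admissible zo) Ka Kb.
apply/ler_addgt0Pr => e /H[n /(_ _ (leqnn _))].
have -> : vtx o r u = p 0 by rewrite /p subr0 mul1r.
have -> : vtx o r (i * u) = p 1 by rewrite /p subrr.
set L := segint _ _ _; set T := trap _ _ _ _ => TL.
have : 1 - 0 <= complex.Im T by exact: side_trap_Im.
have := nm_Im (T - L); rewrite ler_norml => /andP[_].
have -> : complex.Im (T - L) = complex.Im T - complex.Im L by case: (T) (L) => ? ? [].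
lra.
Qed.

End Side.

Lemma nm_ii : nm i = 1.
Proof. by have := nm_i (1 : C); rewrite mulr1 nm1. Qed.

Definition cint o r f : C :=
  segint f (vtx o r 1) (vtx o r i) + segint f (vtx o r i) (vtx o r (i * i)) +
  segint f (vtx o r (i * i)) (vtx o r (i * (i * i))) +
  segint f (vtx o r (i * (i * i))) (vtx o r 1).

Definition side o r f u : C := segint f (vtx o r u) (vtx o r (i * u)).

Lemma cintE o r f : cint o r f =
  side o r f 1 + side o r f i + side o r f (i * i) + side o r f (i * (i * i)).
Proof.
rewrite /cint /side mulr1.
by have -> : i * (i * (i * i)) = 1 by rewrite mulrA !i2 mulrNN mulr1.
Qed.

(** The slope function [g] of [f] at [z] is holomorphic off [z] and continuous at [z]. On the
    triangle from [z] to a side, [goursat_vertex] turns the integral of [g] along the side into a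
    difference of values of [segint g z] at its ends; these telescope around the square. *)
Lemma cauchy_formula o r f z : 0 < r -> (forall w, cball o r w -> hol f w) ->
    nm (z - o) < r / 4 ->
  cint o r (fun w => f w * (w - z)^-1) = f z * cint o r (fun w => (w - z)^-1).
Proof.
move=> r0 hf hz; have Kz : cball o r z by rewrite /cball /=; lra.
have [d hd] := hf _ Kz; pose g := slope f z d.
have ag : admissible (cball o r) g.
  apply: cball_admissible => w Kw; have [->|wz] := eqVneq w z; first exact: slope_cont.
  by apply: hol_cont; apply: slope_hol => //; exact: hf.
have hg w : cball o r w -> w != z -> hol g w by move=> Kw wz; apply: slope_hol => //; exact: hf.
have S u : nm u = 1 -> side o r (fun w => f w * (w - z)^-1) u =
    f z * side o r (fun w => (w - z)^-1) u + (segint g z (vtx o r (i * u)) - segint g z (vtx o r u)).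
  move=> u1; have [Sa Sb] := side_vtx o r0 u1.
  have [[Ka _] [Kb _]] := (Sa, Sb).
  have ai := side_inv_admissible r0 u1 hz.
  have [sc sm _] := ai.
  have ags : admissible (side_set o r u) g by split => // w [Kw _]; have [_ _] := ag; apply.
  have := goursat_vertex ag hg Kz Ka Kb (side_separated r0 u1 hz).
  rewrite /bd (segint_rev ag Kz Kb) -/(side o r g u) => h.
  have aif : admissible (side_set o r u) (fun w => f z * (w - z)^-1).
    by apply: admissibleM => //; exact: admissible_cst.
  have -> : side o r (fun w => f w * (w - z)^-1) u =
      segint (fun w => f z * (w - z)^-1 + g w) (vtx o r u) (vtx o r (i * u)).
    symmetry; apply: (segint_ext (K := side_set o r u)) => //; first exact: admissibleD.
    move=> w Kw; have wz : w - z != 0.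
      by apply/eqP => e; have := side_far u1 hz Kw; rewrite e nm0; lra.
    by rewrite /g /slope -subr_eq0 (negbTE wz); field.
  rewrite (segint_D aif ags)// (segint_Z _ ai)// -/(side o r g u) -/(side o r _ u).
  have -> : side o r g u = (segint g z (vtx o r u) + side o r g u - segint g z (vtx o r (i * u)))
    + (segint g z (vtx o r (i * u)) - segint g z (vtx o r u)) by ring.
  by rewrite h add0r.
rewrite !cintE !S ?nm_i ?nm_ii ?nm1//.
have -> : i * (i * (i * i)) = 1 by rewrite mulrA !i2 mulrNN mulr1.
by rewrite mulr1; ring.
Qed.

Lemma cint_center_neq0 o r : 0 < r -> cint o r (fun w => (w - o)^-1) != 0.
Proof.
move=> r0; apply/eqP => h.
have : 4 <= complex.Im (cint o r (fun w => (w - o)^-1)).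
  rewrite cintE !Im_add.
  have s u : nm u = 1 -> 1 <= complex.Im (side o r (fun w => (w - o)^-1) u).
    exact: side_I_Im.
  have := s 1 nm1; have := s i nm_ii; have := s (i * i); have := s (i * (i * i)).
  by rewrite !nm_i nm_ii => /(_ erefl) ? /(_ erefl); lra.
by rewrite h /=; lra.
Qed.

Lemma cint_kernel_deriv o r phi M z : 0 < r -> (forall w, cball o r w -> ccont phi w) ->
    (forall w, cball o r w -> nm (phi w) <= M) -> nm (z - o) < r / 4 ->
  cderiv (fun w => cint o r (fun u => phi u * (u - w)^-1)) z
         (cint o r (fun u => phi u * (u - z)^-1 ^+ 2)) /\
  hol (fun w => cint o r (fun u => phi u * (u - w)^-1 ^+ 2)) z.
Proof.
move=> r0 cphi phiM hz.
have S v : nm v = 1 ->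
    cderiv (fun w => side o r (fun u => phi u * (u - w)^-1) v) z
           (side o r (fun u => phi u * (u - z)^-1 ^+ 2) v) /\
    hol (fun w => side o r (fun u => phi u * (u - w)^-1 ^+ 2) v) z.
  move=> v1; have [Sa Sb] := side_vtx o r0 v1.
  apply: (@cauchy_kernel_deriv _ (side_set o r v) _ _ _ _ (r / 4) M) => //.
  - by split; [exact: side_closed|exact: side_midconvex|] => w [Kw _]; exact: cphi.
  - by move=> w [Kw _]; exact: phiM.
  - by lra.
  - by move=> w; exact: side_far.
have [d1 h1] := S 1 nm1; have [d2 h2] := S i nm_ii.
have [|d3 h3] := S (i * i); first by rewrite nm_i nm_ii.
have [|d4 h4] := S (i * (i * i)); first by rewrite !nm_i nm_ii.
split.
  rewrite cintE; apply: (@cd_near _ (fun w => side o r (fun u => phi u * (u - w)^-1) 1 +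
    side o r (fun u => phi u * (u - w)^-1) i + side o r (fun u => phi u * (u - w)^-1) (i * i)
    + side o r (fun u => phi u * (u - w)^-1) (i * (i * i)))).
    by apply: nearc_all => w; rewrite cintE.
  by do 3 apply: cdD => //.
apply: (@hol_near _ (fun w => side o r (fun u => phi u * (u - w)^-1 ^+ 2) 1 +
    side o r (fun u => phi u * (u - w)^-1 ^+ 2) i
    + side o r (fun u => phi u * (u - w)^-1 ^+ 2) (i * i)
    + side o r (fun u => phi u * (u - w)^-1 ^+ 2) (i * (i * i)))).
  by apply: nearc_all => w; rewrite cintE.
by do 3 apply: holD => //.
Qed.

(** * Regularity of derivatives, removable singularities and orders of vanishing *)

Lemma nearc_cball o (P : C -> Prop) : nearc o P ->
  exists2 r : R, 0 < r & forall w, cball o r w -> P w.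
Proof.
move=> [r r0 H]; exists (r / 2); first by lra.
by move=> w; rewrite /cball /= => h; apply: H; lra.
Qed.

Lemma cint_kernel_neq0 o r : 0 < r ->
  nearc o (fun z => cint o r (fun w => (w - z)^-1) != 0).
Proof.
move=> r0; apply: cc_nonzero; last exact: cint_center_neq0.
have [||//|d _] := @cint_kernel_deriv o r (fun=> 1) 1 o r0.
- by move=> w _; exact: cc_cst.
- by move=> w _; rewrite nm1.
- by rewrite subrr nm0; lra.
apply: cc_near (cd_cont d); apply: nearc_all => w.
by congr cint; apply: funext => v; rewrite mul1r.
Qed.

(** By Cauchy's formula [f] is the quotient of two Cauchy integrals [N] and [c], each with a
    holomorphic derivative. The quotient rule then yields a derivative of [f] that is visibly
    holomorphic. *)
Theorem derivative_hol o f : nearc o (hol f) ->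
  exists f', nearc o (fun z => cderiv f z (f' z) /\ hol f' z).
Proof.
move=> hf; have co := hol_cont (nearc_self hf).
have [r r0 Hr] := nearc_cball (nearc_and hf (cc_bounded co)).
pose N z := cint o r (fun w => f w * (w - z)^-1).
pose N2 z := cint o r (fun w => f w * (w - z)^-1 ^+ 2).
pose c z := cint o r (fun w => 1 * (w - z)^-1).
pose c2 z := cint o r (fun w => 1 * (w - z)^-1 ^+ 2).
have cE z : c z = cint o r (fun w => (w - z)^-1).
  by congr cint; apply: funext => v; rewrite mul1r.
have c0 : nearc o (fun z => c z != 0).
  by apply: nearcW (cint_kernel_neq0 o r0) => z; rewrite cE.
have r40 : 0 < r / 4 by lra.
have dN z : nm (z - o) < r / 4 -> cderiv N z (N2 z) /\ hol N2 z.
  apply: cint_kernel_deriv => // w /Hr[h1 h2]; [exact: hol_cont|exact/ltW/h2].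
have dc z : nm (z - o) < r / 4 -> cderiv c z (c2 z) /\ hol c2 z.
  by apply: (@cint_kernel_deriv _ _ _ 1) => // w _; [exact: cc_cst|rewrite nm1].
have fE : nearc o (fun z => N z * (c z)^-1 = f z).
  apply: nearcW (nearc_and c0 (nearc_ball o r40)) => z [cz zr].
  rewrite /N cauchy_formula// -?cE ?mulfK// => w /Hr[].
  by [].
exists (fun z => N2 z * (c z)^-1 + N z * (- c2 z / c z ^+ 2)).
apply: nearcW (nearc_and (nearc_near fE) (nearc_and c0 (nearc_ball o r40))) => z [fEz [cz zr]].
have [dNz hN2] := dN z zr; have [dcz hc2] := dc z zr.
split; first by apply: cd_near fEz _; apply: cdM => //; exact: cdV.
have hN : hol N z by exists (N2 z).
have hc : hol c z by exists (c2 z).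
apply: holD; first by apply: holM => //; exact: holV.
apply: holM => //; apply: holM; first exact: holN.
by apply: holV; [exact: holX|rewrite expf_eq0].
Qed.

(** As in Morera's theorem: [f] has a primitive on the whole disc, and the derivative of a
    holomorphic function is holomorphic. *)
Theorem removable_singularity o f : ccont f o -> nearc o (fun z => z != o -> hol f z) ->
  hol f o.
Proof.
move=> co hf; have [r r0 Hr] := nearc_cball hf.
have cf z : cball o r z -> ccont f z.
  by have [->//|zo] := eqVneq z o => /Hr h; apply/hol_cont/h.
have dP := primitive_punctured r0 cf Hr.
have [|g Hg] := @derivative_hol o (segint f o).
  by exists r => // z /dP h; exists (f z).
have [_ hg] := nearc_self Hg.
apply: hol_near hg.
by apply: nearcW (nearc_and Hg (nearc_ball o r0)) => z [[h _] /dP h']; exact: cd_uniq h h'.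
Qed.

Lemma slope_hol_center o f d : nearc o (hol f) -> cderiv f o d -> hol (slope f o d) o.
Proof.
move=> hf hd; apply: removable_singularity; first exact: slope_cont.
by apply: nearcW hf => z hz zo; exact: slope_hol.
Qed.

(** Cauchy's formula for the quotient [g]: on the sides [nm (w - o)] is at least [r / 2], so [g] is
    at most [M * (2 / r) ^+ m], whereas [(z - o) ^+ m] is at most [(r / 4) ^+ m]. The product decays
    like [2 ^- m]. *)
Lemma infinite_order_vanishing o r f M : 0 < r -> (forall w, cball o r w -> hol f w) ->
    (forall w, cball o r w -> nm (f w) <= M) ->
    (forall m : nat, exists g, forall w, cball o r w ->
      hol g w /\ f w = (w - o) ^+ m * g w) ->
  nearc o (fun w => f w = 0).
Proof.
move=> r0 hf fM H; have r40 : 0 < r / 4 by lra.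
have M0 : 0 <= M by apply: le_trans (fM o (cball_center o (ltW r0))); exact: nm_ge0.
apply: nearcW (nearc_and (cint_kernel_neq0 o r0) (nearc_ball o r40)) => z [cz zr].
have Kz : cball o r z by rewrite /cball /=; lra.
set c := cint _ _ _ in cz.
suff : c * f z = 0 by move/eqP; rewrite mulf_eq0 (negbTE cz) => /eqP.
apply: eq_of_nm_lt => e e0; rewrite subr0.
(* 32 is the product of 4 sides, the length bound [2 * r] and the kernel bound [4 / r]. *)
have [m hm] := half_pow_small (32 * M) e0.
have [g Hg] := H m; apply: le_trans (ltW hm).
have hg w : cball o r w -> hol g w by move=> /Hg[].
have [_ fz] := Hg _ Kz.
have -> : c * f z = (z - o) ^+ m * (g z * c) by rewrite fz; ring.
rewrite -(cauchy_formula r0 hg zr) nmM nmX.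
have B u : nm u = 1 -> nm (side o r (fun w => g w * (w - z)^-1) u) <=
    (M * (2 / r) ^+ m * (4 / r)) * (2 * r).
  move=> u1; have [Sa Sb] := side_vtx o r0 u1; have [sc sm ci] := side_inv_admissible r0 u1 zr.
  have b0 : 0 <= M * (2 / r) ^+ m * (4 / r).
    by apply: mulr_ge0; [apply: mulr_ge0 => //; apply: exprn_ge0|]; rewrite divr_ge0 ?(ltW r0).
  apply: (@le_trans _ _ (M * (2 / r) ^+ m * (4 / r) * nm (vtx o r (i * u) - vtx o r u))); last first.
    by apply: ler_wpM2l => //; exact: side_length.
  apply: (segint_bound (K := side_set o r u)) => //.
    by split => // w Kw; apply: ccM; [apply/hol_cont/hg; case: Kw|exact: ci].
  move=> w Sw; have [Kw _] := Sw; have wo := side_center u1 Sw; have wz := side_far u1 zr Sw.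
  have wo0 : 0 < nm (w - o) by lra.
  have wz0 : 0 < nm (w - z) by lra.
  rewrite nmM nmV; apply: ler_pM; rewrite ?invr_ge0 ?nm_ge0//; last first.
    by rewrite -[X in _ <= X]invrK lef_pV2 ?posrE ?invr_gt0 ?divr_gt0// invf_div.
  have [_ fw] := Hg _ Kw; have := fM _ Kw; rewrite fw nmM nmX mulrC => hfM.
  have : nm (g w) <= M * (nm (w - o))^-1 ^+ m.
    by rewrite exprVn ler_pdivlMr ?exprn_gt0.
  move=> h; apply: (le_trans h); apply: ler_wpM2l => //.
  rewrite lerXn2r ?nnegrE ?invr_ge0 ?nm_ge0 ?divr_ge0 ?(ltW r0)//.
  by rewrite -[X in _ <= X]invrK lef_pV2 ?posrE ?invr_gt0 ?divr_gt0// invf_div.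
have -> : 32 * M / 2 ^+ m = (r / 4) ^+ m * (4 * ((M * (2 / r) ^+ m * (4 / r)) * (2 * r))).
  have -> : (r / 4) ^+ m = (2 / r) ^- m / 2 ^+ m.
    rewrite -exprVn -!exprVn -exprMn; congr (_ ^+ m); field; exact: lt0r_neq0.
  by field; rewrite !expf_neq0 ?lt0r_neq0 ?divr_gt0.
apply: ler_pM; rewrite ?exprn_ge0 ?nm_ge0//.
  by rewrite lerXn2r ?nnegrE ?nm_ge0 ?(ltW r40)// ltW.
move: B; set X := _ * (2 * r) => B.
rewrite cintE (_ : 4 * X = X + X + X + X); last by ring.
do 3 (apply: (le_trans (nmD _ _)); apply: lerD; last by apply: B; rewrite ?nm_i ?nm_ii).
by apply: B; rewrite nm1.
Qed.

(** One exponent serves the whole family: the last [m] such that all members are divisible by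
    [(z - o) ^+ m]. If all quotients vanished at [o], their slope functions at [o] would allow one
    more division. *)
Theorem common_order (T : finType) o (f : T -> C -> C) : (forall k, nearc o (hol (f k))) ->
  (forall k, nearc o (fun w => f k w = 0)) \/
  exists m (g : T -> C -> C), [/\ forall k, nearc o (hol (g k)),
    forall k, nearc o (fun w => f k w = (w - o) ^+ m * g k w) &
    exists k, g k o != 0].
Proof.
move=> hf.
have nearc_fin (P : T -> C -> Prop) : (forall k, nearc o (P k)) ->
    nearc o (fun w => forall k, P k w).
  move=> HP; suff [r r0 H] : exists2 r : R, 0 < r &
      forall k w, k \in enum T -> nm (w - o) < r -> P k w.
    by exists r => // w wr k; apply: H wr; rewrite mem_enum.
  elim: (enum T) => [|k s [r r0 H]]; first by exists 1.
  have [q q0 Hq] := HP k; exists (Num.min r q); first by rewrite lt_min r0.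
  move=> k' w; rewrite inE lt_min => /orP[/eqP->|ks] /andP[? ?]; first exact: Hq.
  exact: H.
have [r r0 Hr] := nearc_cball (nearc_and (nearc_fin _ hf)
  (nearc_fin _ (fun k => cc_bounded (hol_cont (nearc_self (hf k)))))).
(* The disc is fixed before [m], since [infinite_order_vanishing] takes the quotients of all orders
   on the same disc. *)
pose Div m := exists g : T -> C -> C, forall k w, cball o r w ->
  hol (g k) w /\ f k w = (w - o) ^+ m * g k w.
have [allD|nD] := pselect (forall m, Div m).
  left=> k; apply: (@infinite_order_vanishing o r (f k) (nm (f k o) + 1)) => //.
  - by move=> w /Hr[h _]; exact: h.
  - by move=> w /Hr[_ h]; exact/ltW/h.
  - by move=> m; have [g Hg] := allD m; exists (g k) => w; exact: Hg.
right; have [m Dm nDm] : exists2 m, Div m & ~ Div m.+1.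
  apply: contrapT => h; apply: nD; elim=> [|m IH].
    by exists f => k w Kw; rewrite expr0 mul1r; split => //; have [h' _] := Hr _ Kw; exact: h'.
  by apply: contrapT => h'; apply: h; exists m.
have [g Hg] := Dm; exists m, g.
have near_in (P : C -> Prop) : (forall w, cball o r w -> P w) -> nearc o P.
  by move=> h; exists r => // w /ltW; exact: h.
split=> [k|k|]; [by apply: near_in => w /(Hg k)[]|by apply: near_in => w /(Hg k)[]|].
apply: contrapT => h; apply: nDm.
have g0 k : g k o = 0 by apply: contrapT => gk; apply: h; exists k; exact/eqP.
have hgk k : nearc o (hol (g k)) by apply: near_in => w /(Hg k)[].
have /choice[d hd] : forall k, exists d, cderiv (g k) o d by move=> k; exact: nearc_self (hgk k).
exists (fun k => slope (g k) o (d k)) => k w Kw; have [hw fw] := Hg k w Kw.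
have [->|wo] := eqVneq w o.
  split; first exact: slope_hol_center.
  by have [_ ->] := Hg k o (cball_center o (ltW r0)); rewrite g0 subrr exprS mul0r !mul0r mulr0.
split; first exact: slope_hol.
rewrite fw exprSr -mulrA; congr (_ * _); rewrite /slope (negbTE wo) g0 subr0.
by rewrite mulrCA divff ?mulr1// subr_eq0.
Qed.

End Cauchy.

(** * The complex exponential and local logarithms *)

Section Exponential.
Context {R : realType}.
Local Notation C := R[i].
Implicit Types (f g : C -> C) (K : set C) (a b c o z w h : C) (r e : R).

(** The mean value inequality with an arbitrarily small constant: the bound is additive under
    bisection, and Cousin's principle applies to segments. *)
Lemma constant_of_deriv0 o r f : 0 < r -> (forall z, cball o r z -> cderiv f z 0) ->
  forall z, cball o r z -> f z = f o.
Proof.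
move=> r0 hf z Kz; apply: eq_of_nm_lt => e e0.
have Ko := cball_center o (ltW r0).
pose e' := e / r; have e'0 : 0 < e' by rewrite divr_gt0.
suff h : nm (f z - f o) <= e' * nm (z - o).
  apply: (le_trans h); rewrite /e' mulrAC ler_pdivrMr//.
  by apply: ler_wpM2l => //; exact: ltW.
have Kc : closedc (cball o r) by exact: closedc_ball.
have Km : midconvex (cball o r) by exact: midconvex_ball.
pose P a b c := b = c -> nm (f b - f a) <= e' * nm (b - a).
suff : P o z z by exact.
apply: (subdivision_ind (K := cball o r)) => //.
  move=> a b c Ka Kb _ P1 P2 _ _ bc; rewrite {}bc in P1 P2 *.
  have /P1 h1 : (a + c) / 2 = (c + a) / 2 by rewrite addrC.
  have /P2 h2 : c = (c + c) / 2 by field.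
  apply: (le_trans (nm_dist (f ((a + c) / 2)) _ _)).
  by move: h1 h2; rewrite nm_midl nm_midr; lra.
move=> x Kx.
(* In units of [nm (c - a)], the ends [a] and [c] are within 4 and 5 of [x], and 4 + 5 = 9. *)
have e4 : 0 < e' / 9 by lra.
have [s s0 Hs] := cd_bound (hf _ Kx) e4.
exists (s / 4); first by lra.
move=> a b c Ka Kb _ ps ax bc; rewrite {}bc in ps ax Kb *.
have n1 := nm_ge0 (c - a); have n2 := nm_ge0 (a - x).
have pE : perimeter a c c = 2 * nm (c - a).
  by rewrite /perimeter subrr nm0 addr0 (nm_distC a); lra.
rewrite pE in ps ax.
have cx : nm (c - x) <= 5 * nm (c - a) by have := nm_dist a c x; lra.
have h1 := Hs c; have h2 := Hs a.
rewrite !mul0r !subr0 in h1 h2; have {}h1 : nm (f c - f x) <= e' / 9 * nm (c - x) by apply: h1; lra.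
have {}h2 : nm (f a - f x) <= e' / 9 * nm (a - x) by apply: h2; lra.
apply: (le_trans (nm_dist (f x) _ _)); rewrite (nm_distC (f x)).
have k1 : e' / 9 * nm (c - x) <= e' / 9 * (5 * nm (c - a)) by rewrite ler_pM2l.
have k2 : e' / 9 * nm (a - x) <= e' / 9 * (2 * (2 * nm (c - a))) by rewrite ler_pM2l.
lra.
Qed.

(** * The exponential as a power series *)

Definition expsum z n : C := \sum_(0 <= k < n) (k`!%:R)^-1 * z ^+ k.

Definition rexpsum r n : R := \sum_(0 <= k < n) (k`!%:R)^-1 * r ^+ k.

Lemma rexpsumE r : rexpsum r = series (exp_coeff r).
Proof.
by apply: funext => n; rewrite /rexpsum /series /=; apply: eq_bigr => k _; rewrite mulrC.
Qed.

Lemma rexpsum_le r n m : 0 <= r -> (n <= m)%N -> rexpsum r n <= rexpsum r m.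
Proof.
move=> r0 nm'; rewrite /rexpsum (@big_cat_nat _ _ _ n 0 m)//=.
rewrite lerDl; apply: sumr_ge0 => k _.
by rewrite mulr_ge0 ?invr_ge0 ?ler0n ?exprn_ge0.
Qed.

Lemma rexpsum_cvg r : forall e, 0 < e -> exists N, forall n, (N <= n)%N ->
  `|rexpsum r n - expR r| < e.
Proof.
move=> e e0; have H : series (exp_coeff r) @ \oo --> expR r.
  exact: is_cvg_series_exp_coeff.
have /cvgrPdist_lt/(_ _ e0)[N _ HN] := H.
by exists N => n /HN; rewrite distrC rexpsumE.
Qed.

Lemma rexpsum_le_expR r n : 0 <= r -> rexpsum r n <= expR r.
Proof.
move=> r0; apply/ler_addgt0Pr => e e0; have [N HN] := rexpsum_cvg r e0.
have := HN _ (leq_maxl N n); rewrite ltr_distlC => /andP[h _].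
have := rexpsum_le r0 (leq_maxr N n); lra.
Qed.

Lemma expsum_dist z n m : (n <= m)%N ->
  nm (expsum z m - expsum z n) <= rexpsum (nm z) m - rexpsum (nm z) n.
Proof.
elim: m => [|m IH]; first by rewrite leqn0 => /eqP->; rewrite !subrr nm0.
rewrite leq_eqVlt => /orP[/eqP->|/IH h]; first by rewrite !subrr nm0.
rewrite /expsum /rexpsum !big_nat_recr//= -/(expsum z m) -/(rexpsum (nm z) m).
rewrite -/(expsum z n) -/(rexpsum (nm z) n) addrAC [X in _ <= X]addrAC.
apply: (le_trans (nmD _ _)); apply: lerD => //.
by rewrite nmM nmV nm_natr nmX.
Qed.

Lemma expsumS z n : expsum z n.+1 = expsum z n + (n`!%:R)^-1 * z ^+ n.
Proof. by rewrite /expsum big_nat_recr. Qed.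

Lemma rexpsumS r n : rexpsum r n.+1 = rexpsum r n + (n`!%:R)^-1 * r ^+ n.
Proof. by rewrite /rexpsum big_nat_recr. Qed.

Definition isexp z (L : C) := forall e, 0 < e ->
  exists N, forall n, (N <= n)%N -> nm (expsum z n - L) < e.

Lemma isexp_ex z : exists L, isexp z L.
Proof.
apply: cauchy_limit => e e0; have e20 : 0 < e / 2 by lra.
have [N HN] := rexpsum_cvg (nm z) e20.
exists N; suff H n m : (N <= n)%N -> (n <= m)%N -> nm (expsum z m - expsum z n) <= e.
  by move=> n m Nn Nm; have [/H|/ltnW/H] := leqP n m; [rewrite nm_distC; exact|exact].
move=> Nn nm'; apply: (le_trans (expsum_dist _ nm')).
have := HN _ Nn; have := HN _ (leq_trans Nn nm').
by rewrite !ltr_distlC => /andP[? ?] /andP[? ?]; lra.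
Qed.

(** Defined from its partial sums, so that the series of [exp_star] can be evaluated through
    identities between partial sums. *)
Definition expc z : C := xget 0 [set L | isexp z L].

Lemma expcP z : isexp z (expc z).
Proof. by have [L HL] := isexp_ex z; rewrite /expc; case: xgetP => [L' _ //|/(_ L)]. Qed.

Lemma expc_unique z L : isexp z L -> expc z = L.
Proof.
move=> H; apply: eq_of_nm_lt => e e0; have e20 : 0 < e / 2 by lra.
have [N HN] := H _ e20; have [N' HN'] := expcP z e20.
have h1 := HN _ (leq_maxl N N'); have h2 := HN' _ (leq_maxr N N').
have := nm_dist (expsum z (maxn N N')) (expc z) L; rewrite (nm_distC (expc z) (expsum _ _)); lra.
Qed.

Lemma expc_real (r : R) : expc r%:C%C = (expR r)%:C%C.
Proof.
apply: expc_unique => e /(rexpsum_cvg r)[N HN]; exists N => n /HN.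
have -> : expsum r%:C%C n = (rexpsum r n)%:C%C.
  rewrite /expsum /rexpsum rmorph_sum /=; apply: eq_bigr => k _.
  by rewrite rmorphM rmorphXn fmorphV /= rmorph_nat.
by rewrite -rmorphB nm_real.
Qed.

Lemma expc0 : expc 0 = 1.
Proof. by have := expc_real 0; rewrite expR0. Qed.

Lemma pow_second_order z h k :
  nm ((z + h) ^+ k.+2 - z ^+ k.+2 - k.+2%:R * h * z ^+ k.+1) <=
  nm h ^+ 2 * (k.+2%:R * k.+1%:R * (nm z + nm h) ^+ k).
Proof.
have z0 := nm_ge0 z; have h0 := nm_ge0 h; set q := nm z + nm h; have q0 : 0 <= q by rewrite addr_ge0.
elim: k => [|k IH].
  rewrite expr0 mulr1 (_ : _ - _ = h ^+ 2); last by rewrite expr1 !expr2; ring.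
  by rewrite nmX mulr1; have := sqr_ge0 (nm h); lra.
have -> : (z + h) ^+ k.+3 - z ^+ k.+3 - k.+3%:R * h * z ^+ k.+2 =
    (z + h) * ((z + h) ^+ k.+2 - z ^+ k.+2 - k.+2%:R * h * z ^+ k.+1)
    + k.+2%:R * h ^+ 2 * z ^+ k.+1.
  rewrite -[k.+3]addn1 natrD [(z + h) ^+ (_ + _)]exprD [z ^+ (k.+2 + 1)]exprD !expr1.
  rewrite [z ^+ k.+2]exprS expr2.
  have key (p s t : C) : p * (z + h) - z * s * z - (t + 1) * h * (z * s) =
    (z + h) * (p - z * s - t * h * s) + t * (h * h) * s by ring.
  exact: key.
apply: (le_trans (nmD _ _)); rewrite !(nmX, nmM, nm_natr).
have zq : nm z ^+ k.+1 <= q ^+ k.+1 by rewrite lerXn2r ?nnegrE// /q; lra.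
have a1 : nm (z + h) * nm ((z + h) ^+ k.+2 - z ^+ k.+2 - k.+2%:R * h * z ^+ k.+1) <=
    q * (nm h ^+ 2 * (k.+2%:R * k.+1%:R * q ^+ k)).
  by apply: ler_pM => //; rewrite ?nm_ge0// nmD.
have a2 : k.+2%:R * nm h ^+ 2 * nm z ^+ k.+1 <= k.+2%:R * nm h ^+ 2 * q ^+ k.+1.
  by apply: ler_wpM2l => //; rewrite mulr_ge0 ?sqr_ge0.
apply: (le_trans (lerD a1 a2)).
have -> : q * (nm h ^+ 2 * (k.+2%:R * k.+1%:R * q ^+ k)) + k.+2%:R * nm h ^+ 2 * q ^+ k.+1 =
    nm h ^+ 2 * (k.+2%:R * k.+2%:R * q ^+ k.+1).
  by rewrite (exprS q) -(natr1 k.+1); ring.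
rewrite ler_wpM2l ?sqr_ge0// ler_wpM2r ?exprn_ge0//.
by rewrite [X in _ <= X]mulrC ler_wpM2l// ler_nat.
Qed.

(** Dividing [pow_second_order] by (k + 2)! leaves 1 / k!, so the remainders add up to a partial sum
    of the real exponential. The indices drop by one for the derivative and by two for the
    remainder. *)
Lemma expsum_second_order z h n :
  nm (expsum (z + h) n.+2 - expsum z n.+2 - h * expsum z n.+1) <=
  nm h ^+ 2 * rexpsum (nm z + nm h) n.
Proof.
elim: n => [|n IH].
  rewrite /expsum /rexpsum !big_nat_recr//= !big_geq// !expr0 !expr1 fact0 factS fact0.
  rewrite (_ : _ - _ = 0) ?nm0 ?mulr0//.
  by rewrite !invr1; ring.
rewrite [X in _ - h * X]expsumS (expsumS _ n.+2) (expsumS z n.+2) rexpsumS.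
set a := expsum (z + h) _ in IH *; set b := expsum z n.+2 in IH *; set c := expsum z n.+1 in IH *.
have n0 : (n.+2)%:R != 0 :> C by rewrite pnatr_eq0.
have m0 : (n.+1)`!%:R != 0 :> C by rewrite pnatr_eq0 -lt0n fact_gt0.
have -> : a + (n.+2)`!%:R^-1 * (z + h) ^+ n.+2 - (b + (n.+2)`!%:R^-1 * z ^+ n.+2)
    - h * (c + (n.+1)`!%:R^-1 * z ^+ n.+1) =
    (a - b - h * c) + (n.+2)`!%:R^-1 * ((z + h) ^+ n.+2 - z ^+ n.+2 - n.+2%:R * h * z ^+ n.+1).
  rewrite (factS n.+1) natrM.
  have key (N P u v w : C) : N != 0 -> P != 0 ->
      a + (N * P)^-1 * u - (b + (N * P)^-1 * v) - h * (c + P^-1 * w) =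
      (a - b - h * c) + (N * P)^-1 * (u - v - N * h * w).
    by move=> N0 P0; field; rewrite N0 P0.
  exact: key.
apply: (le_trans (nmD _ _)); rewrite [leRHS]mulrDr; apply: lerD => //.
rewrite nmM nmV nm_natr.
have f0 : 0 < (n.+2)`!%:R :> R by rewrite ltr0n fact_gt0.
rewrite mulrC ler_pdivrMr//; apply: (le_trans (pow_second_order _ _ _)).
have k0 : (n`!%:R : R) != 0 by rewrite pnatr_eq0 -lt0n fact_gt0.
rewrite !factS !natrM le_eqVlt; apply/orP; left; apply/eqP.
by field.
Qed.

Lemma nm_second_order_perturb (p q s t u v : C) (d : R) :
    nm (s - p) < d -> nm (t - q) < d -> nm (v - q) < d ->
  nm (p - q - u * q) <= nm (s - t - u * v) + (2 + nm u) * d.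
Proof.
move=> h1 h2 h3.
have -> : p - q - u * q = (s - t - u * v) + (- (s - p) + (t - q) + u * (v - q)) by ring.
apply: (le_trans (nmD _ _)); apply: lerD => //; apply: (le_trans (nmD _ _)).
have h4 := nmD (- (s - p)) (t - q); rewrite nmN in h4.
rewrite nmM mulrDl; have := ler_wpM2l (nm_ge0 u) (ltW h3); lra.
Qed.

Lemma expc_second_order z h :
  nm (expc (z + h) - expc z - h * expc z) <= nm h ^+ 2 * expR (nm z + nm h).
Proof.
apply/ler_addgt0Pr => e e0.
have k0 : 0 < 2 + nm h by have := nm_ge0 h; lra.
have d0 := divr_gt0 e0 k0.
have [N1 H1] := @expcP (z + h) _ d0; have [N2 H2] := @expcP z _ d0.
pose n := maxn N1 N2.
have B := @nm_second_order_perturb (expc (z + h)) (expc z) (expsum (z + h) n.+2)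
  (expsum z n.+2) h (expsum z n.+1) _ (H1 _ _) (H2 _ _) (H2 _ _).
apply: (le_trans (B _ _ _)); rewrite ?leqW ?leq_maxl ?leq_maxr//.
apply: lerD; last by rewrite mulrC divfK// gt_eqF.
apply: (le_trans (expsum_second_order _ _ _)).
by rewrite ler_wpM2l ?sqr_ge0// rexpsum_le_expR// addr_ge0 ?nm_ge0.
Qed.

Lemma expc_deriv z : cderiv expc z (expc z).
Proof.
apply: cd_of_bound => e e0; pose M := expR (nm z + 1).
have M0 : 0 < M by exact: expR_gt0.
exists (Num.min 1 (e / M)); first by rewrite lt_min ltr01 divr_gt0.
move=> w; rewrite lt_min => /andP[h1 h2].
have wE : z + (w - z) = w by rewrite addrC subrK.
have := expc_second_order z (w - z); rewrite wE [(w - z) * _]mulrC => h.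
apply: (le_trans h); rewrite expr2 -mulrA mulrC.
have n0 := nm_ge0 (w - z).
apply: ler_wpM2r => //; move: h2; rewrite ltr_pdivlMr// => /ltW; apply: le_trans.
by rewrite ler_wpM2l// ler_expR; lra.
Qed.

Lemma expc_hol z : hol expc z.
Proof. by exists (expc z); exact: expc_deriv. Qed.

(** The function [f] has derivative zero; its values at [0] and at [a] are compared. *)
Lemma expcD a b : expc (a + b) = expc a * expc b.
Proof.
pose f w := expc w * expc (a + b - w).
have r0 : 0 < nm a + 1 by have := nm_ge0 a; lra.
have hf w : cderiv f w 0.
  have key (p q : C) : p * q + p * (q * (0 - 1)) = 0 by ring.
  rewrite -(key (expc w) (expc (a + b - w))).
  apply: cdM; first exact: expc_deriv.
  apply: (@cd_comp _ (fun w => a + b - w)); last exact: expc_deriv.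
  by apply: cdB; [exact: cd_cst|exact: cd_id].
have := @constant_of_deriv0 0 _ f r0 (fun w _ => hf w) a.
rewrite /cball /= subr0 lerDl ler01 => /(_ isT).
by rewrite /f subr0 expc0 mul1r addrAC subrr add0r.
Qed.

Lemma expc_neq0 z : expc z != 0.
Proof.
apply/eqP => h; have := expcD z (- z).
by rewrite subrr expc0 h mul0r => /eqP; rewrite oner_eq0.
Qed.

Lemma expcN z : expc (- z) = (expc z)^-1.
Proof. by apply: (mulIf (expc_neq0 z)); rewrite -expcD addNr expc0 mulVf// expc_neq0. Qed.

(** [l] is [a] plus a primitive of f'/f, which exists because f' is holomorphic; then f exp(-l) has
    derivative zero. Prescribing [l o] is what later permits a real value at a real point. *)
Theorem local_log o f a : nearc o (hol f) -> expc a = f o ->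
  exists l, l o = a /\ nearc o (fun z => hol l z /\ expc (l z) = f z).
Proof.
move=> hf ea; have [f' Hf'] := derivative_hol hf.
have f0 : f o != 0 by rewrite -ea expc_neq0.
have nf0 := cc_nonzero (hol_cont (nearc_self hf)) f0.
have [r r0 Hr] := nearc_cball (nearc_and Hf' nf0).
pose q w := f' w * (f w)^-1.
have hq z : cball o r z -> hol q z.
  move=> /Hr[[df hf'z] fz]; apply: holM => //; apply: holV => //.
  by exists (f' z).
have dl := hol_primitive r0 hq.
pose l z := a + segint q o z.
have dl' z : nm (z - o) < r -> cderiv l z (q z).
  by move=> /dl h; rewrite -[q z]add0r; apply: cdD => //; exact: cd_cst.
exists l; split; first by rewrite /l segint_same addr0.
have r20 : 0 < r / 2 by lra.
exists (r / 2) => // z zr; have zr' : nm (z - o) < r by lra.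
split; first by exists (q z); exact: dl'.
pose k w := f w * expc (- l w).
have dk w : cball o (r / 2) w -> cderiv k w 0.
  rewrite /cball /= => wr; have wr' : nm (w - o) < r by lra.
  have [|[df _] fw] := Hr w; first exact: ltW.
  have -> : 0 = f' w * expc (- l w) + f w * (expc (- l w) * - q w).
    by rewrite /q; field.
  apply: cdM => //; apply: (@cd_comp _ (fun u => - l u)); last exact: expc_deriv.
  by apply: cdN; exact: dl'.
have := constant_of_deriv0 r20 dk (ltW zr).
rewrite /k expcN [l o]/l segint_same addr0 -ea expcN divff ?expc_neq0// => h.
by rewrite -[expc _]mul1r -h divfK// expc_neq0.
Qed.

(** * Surjectivity of the exponential and local square roots *)

Lemma sqrt_Re_ge0 w : exists2 s : C, s ^+ 2 = w & 0 <= complex.Re s.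
Proof.
have [h|h] := leP 0 (complex.Re (sqrtc w)); first by exists (sqrtc w); rewrite ?sqr_sqrtc.
exists (- sqrtc w); first by rewrite sqrrN sqr_sqrtc.
by case: (sqrtc w) h => x y /=; lra.
Qed.

(* |s - 1| = |s^2 - 1| / |s + 1| and |s + 1|^2 >= 2 for a unit s in the right
   half-plane, so two square roots halve the distance to 1. *)
Lemma fourth_root_near1 w : nm w = 1 ->
  exists t : C, [/\ t ^+ 4 = w, nm t = 1 & nm (t - 1) <= nm (w - 1) / 2].
Proof.
move=> w1.
have unit_sqrt (v s : C) : nm v = 1 -> s ^+ 2 = v -> nm s = 1.
  move=> v1 sv; have := nmX s 2; rewrite sv v1 => h.
  by apply/eqP; rewrite -(@eqrXn2 _ 2)// ?nm_ge0// expr1n -h.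
have step (v s : C) : nm s = 1 -> s ^+ 2 = v -> 0 <= complex.Re s ->
    2 * nm (s - 1) ^+ 2 <= nm (v - 1) ^+ 2.
  move=> s1 <- s0; have -> : s ^+ 2 - 1 = (s - 1) * (s + 1) by ring.
  rewrite nmM exprMn mulrC; apply: ler_wpM2l; first exact: sqr_ge0.
  move: s1 s0; case: s => x y s1 /= s0.
  have : nm (x +i* y)%C ^+ 2 = 1 by rewrite s1 expr1n.
  rewrite !nm_sqr /= => h; nra.
have [s sw s0] := sqrt_Re_ge0 w; have [t ts t0] := sqrt_Re_ge0 s.
have s1 := unit_sqrt _ _ w1 sw; have t1 := unit_sqrt _ _ s1 ts.
exists t; split => //; first by rewrite -sw -ts -exprM.
have h1 := step _ _ s1 sw s0; have h2 := step _ _ t1 ts t0.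
rewrite -(@ler_pXn2r _ 2) ?nnegrE ?divr_ge0 ?nm_ge0// expr_div_n; lra.
Qed.

(** No argument function is used: repeated fourth roots bring a unit number close to 1, where
    [local_log] of the identity inverts the exponential, and the real logarithm supplies the
    modulus. *)
Theorem expc_surj w : w != 0 -> exists a, expc a = w.
Proof.
move=> w0; have nw := nm_gt0 w0.
have [l [_ [r r0 Hr]]] := @local_log 1 id 0 (nearc_all _ (fun z => hol_id z)) expc0.
have unit_case u : nm u = 1 -> exists a, expc a = u.
  move=> u1.
  have small n : forall u, nm u = 1 -> nm (u - 1) / 2 ^+ n < r -> exists a, expc a = u.
    elim: n => [|n IH] v v1; first by rewrite divr1 => /Hr[_ <-]; exists (l v).
    have [t [tv t1 ht]] := fourth_root_near1 v1 => hv.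
    have [|a ea] := IH t t1.
      apply: le_lt_trans hv; rewrite exprS invfM mulrA ler_pM2r// invr_gt0 exprn_gt0//.
    by exists (a + a + (a + a)); rewrite !expcD ea -tv; ring.
  by have [n hn] := half_pow_small (nm (u - 1)) r0; exact: small hn.
have [a ea] : exists a, expc a = w / (nm w)%:C%C.
  by apply: unit_case; rewrite nmM nmV nm_real gtr0_norm// divff// gt_eqF.
exists (a + (ln (nm w))%:C%C); rewrite expcD expc_real lnK ?posrE// ea divfK//.
by apply/eqP => -[h]; move: nw; rewrite h ltxx.
Qed.

Corollary local_log_exists o f : nearc o (hol f) -> f o != 0 ->
  exists l, nearc o (fun z => hol l z /\ expc (l z) = f z).
Proof.
move=> hf /expc_surj[a ea]; have [l [_ Hl]] := local_log hf ea.
by exists l.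
Qed.

Corollary local_sqrt o f : nearc o (hol f) -> f o != 0 ->
  exists s, nearc o (fun z => hol s z /\ s z ^+ 2 = f z).
Proof.
move=> hf f0; have [l Hl] := local_log_exists hf f0.
exists (fun z => expc (l z / 2)); apply: nearcW Hl => z [hl <-]; split.
  apply: (@hol_comp _ (fun w => l w / 2)); last exact: expc_hol.
  by apply: holM => //; exact: hol_cst.
by rewrite expr2 -expcD; congr expc; field.
Qed.

Lemma expc_conj z : expc (z^*)%C = ((expc z)^*)%C.
Proof.
apply: expc_unique => e /(@expcP z)[N HN]; exists N => n /HN.
have -> : expsum (z^*)%C n = ((expsum z n)^*)%C.
  rewrite /expsum rmorph_sum /=; apply: eq_bigr => k _.
  by rewrite rmorphM rmorphXn fmorphV /= rmorph_nat.
by rewrite -conjcB nm_conj.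
Qed.

End Exponential.

(** * The exponential series in the complexified quaternions *)

Section QuaternionExponential.
Context {R : realType}.
Local Notation C := R[i].
Local Notation HC := (quat R[i]).
Local Notation i := ('i%C : C).
Implicit Types (a b c x y z u s t : C) (v w : HC) (e r : R).

Lemma i_neq0 : i != 0.
Proof. by apply/eqP => -[/eqP]; rewrite oner_eq0. Qed.

Lemma q_oneE : (q_re (1 : HC) = 1) * (q_i (1 : HC) = 0) * (q_j (1 : HC) = 0) *
  (q_k (1 : HC) = 0).
Proof. by rewrite -[1]/(Defs.oneq _) !q_mkE. Qed.

Definition seqlim (p : nat -> C) (L : C) := forall e, 0 < e ->
  exists N, forall n, (N <= n)%N -> nm (p n - L) < e.

Lemma seqlimD p q L M : seqlim p L -> seqlim q M -> seqlim (fun n => p n + q n) (L + M).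
Proof.
move=> H H' e e0; have e20 : 0 < e / 2 by lra.
have [N HN] := H _ e20; have [N' HN'] := H' _ e20.
exists (maxn N N') => n; rewrite geq_max => /andP[/HN h1 /HN' h2].
by rewrite opprD addrACA; apply: (le_lt_trans (nmD _ _)); lra.
Qed.

Lemma seqlimZ k p L : seqlim p L -> seqlim (fun n => k * p n) (k * L).
Proof.
move=> H e e0; have k0 : 0 < nm k + 1 by have := nm_ge0 k; lra.
have [N HN] := H _ (divr_gt0 e0 k0); exists N => n /HN h.
rewrite -mulrBr nmM; move: h; rewrite ltr_pdivlMr// mulrC.
by apply: le_lt_trans; apply: ler_wpM2r; rewrite ?nm_ge0//; lra.
Qed.

Lemma seqlim_expsum z : seqlim (expsum z) (expc z).
Proof. exact: expcP. Qed.

Lemma seqlim_eq p q L M : (forall n, p n = q n) -> L = M -> seqlim p L -> seqlim q M.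
Proof. by move=> /funext -> ->. Qed.

Lemma seqlim_shift p L : seqlim (fun n => p n.+1) L -> seqlim p L.
Proof. by move=> H e /H[N HN]; exists N.+1 => -[//|n] /HN. Qed.

Definition qsum w n : HC := \sum_(0 <= k < n) (k`!%:R : C)^-1 *: w ^+ k.

Lemma qsumS w n : qsum w n.+1 = qsum w n + (n`!%:R : C)^-1 *: w ^+ n.
Proof. by rewrite /qsum big_nat_recr. Qed.

Lemma qsum0 w : qsum w 0 = 0.
Proof. by rewrite /qsum big_geq. Qed.

(** A relation, since the exponential is only ever evaluated at elements for which an explicit value
    [v] is at hand. *)
Definition hexp w v :=
  [/\ seqlim (fun n => q_re (qsum w n)) (q_re v), seqlim (fun n => q_i (qsum w n)) (q_i v),
      seqlim (fun n => q_j (qsum w n)) (q_j v) & seqlim (fun n => q_k (qsum w n)) (q_k v)].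

Lemma q_0E : (q_re (0 : HC) = 0) * (q_i (0 : HC) = 0) * (q_j (0 : HC) = 0) *
  (q_k (0 : HC) = 0).
Proof. by rewrite /q_re /q_i /q_j /q_k !mxE. Qed.

Section Split.
Variables (c t W1 W2 W3 : C).
Hypothesis hW : W1 * W1 + W2 * W2 + W3 * W3 = 1.
Let w : HC := qmk c (t * W1) (t * W2) (t * W3).
Let a := c + i * t.
Let b := c - i * t.

(** With W the unit vector, W^2 = -1, so (1 - iota W)/2 and (1 + iota W)/2 are orthogonal
    idempotents with sum 1, and w = c + t W is [a] times the first plus [b] times the second. *)
Lemma split_pow n : w ^+ n = qmk ((a ^+ n + b ^+ n) / 2) ((a ^+ n - b ^+ n) / (2 * i) * W1)
  ((a ^+ n - b ^+ n) / (2 * i) * W2) ((a ^+ n - b ^+ n) / (2 * i) * W3).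
Proof.
have i0 := i_neq0; have ii := @i2 R.
elim: n => [|n IH].
  rewrite !expr0 subrr !mul0r -[1 in LHS]/(Defs.oneq _) /Defs.oneq; congr qmk.
  by field.
rewrite exprS IH -[w * _]/(Defs.mulq _ _) /Defs.mulq /w !q_mkE !exprS.
have iV : i^-1 = - i by apply: (mulIf i0); rewrite mulVf// mulNr ii opprK.
have hre (A B : C) : c * ((A + B) / 2) - (t * W1) * ((A - B) / (2 * i) * W1)
    - (t * W2) * ((A - B) / (2 * i) * W2) - (t * W3) * ((A - B) / (2 * i) * W3) =
    (a * A + b * B) / 2.
  transitivity (c * ((A + B) / 2) - t * ((A - B) / (2 * i)) *
    (W1 * W1 + W2 * W2 + W3 * W3)); first by ring.
  by rewrite hW /a /b invfM iV; ring.
have hW' (A B V : C) : c * ((A - B) / (2 * i) * V) + (t * V) * ((A + B) / 2) =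
    (a * A - b * B) / (2 * i) * V.
  transitivity ((c * ((A - B) / (2 * i)) + (- (i * i)) * t * ((A + B) / 2)) * V).
    by rewrite ii opprK; ring.
  by rewrite /a /b invfM iV; ring.
congr qmk.
- exact: hre.
- by rewrite -hW'; ring.
- by rewrite -hW'; ring.
- by rewrite -hW'; ring.
Qed.

Lemma hexp_split : hexp w (qmk ((expc a + expc b) / 2) ((expc a - expc b) / (2 * i) * W1)
  ((expc a - expc b) / (2 * i) * W2) ((expc a - expc b) / (2 * i) * W3)).
Proof.
have E n : qsum w n = qmk ((expsum a n + expsum b n) / 2)
    ((expsum a n - expsum b n) / (2 * i) * W1) ((expsum a n - expsum b n) / (2 * i) * W2)
    ((expsum a n - expsum b n) / (2 * i) * W3).
  elim: n => [|n IH].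
    rewrite qsum0 /expsum !big_geq// addr0 subrr !mul0r.
    by apply: quat_ext; rewrite q_mkE q_0E.
  rewrite qsumS IH split_pow !expsumS; move: (n`!%:R^-1) => k.
  apply: quat_ext; rewrite q_DE q_ZE !q_mkE; move: (expsum a n) (expsum b n) (a ^+ n) (b ^+ n) => A B A' B'; ring.
have lim1 : seqlim (fun n => (expsum a n + expsum b n) / 2) ((expc a + expc b) / 2).
  apply: (@seqlim_eq (fun n => 2^-1 * (expsum a n + expsum b n)) _ (2^-1 * (expc a + expc b))).
  - by move=> n; rewrite mulrC.
  - by rewrite mulrC.
  - by apply: seqlimZ; apply: seqlimD; exact: seqlim_expsum.
have key (A B k V : C) : k * V * (A + -1 * B) = (A - B) * k * V by ring.
have lim2 V : seqlim (fun n => (expsum a n - expsum b n) / (2 * i) * V)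
    ((expc a - expc b) / (2 * i) * V).
  apply: (@seqlim_eq (fun n => ((2 * i)^-1 * V) * (expsum a n + -1 * expsum b n)) _
    (((2 * i)^-1 * V) * (expc a + -1 * expc b))).
  - by move=> n; exact: key.
  - exact: key.
  - by apply: seqlimZ; apply: seqlimD; [|apply: seqlimZ]; exact: seqlim_expsum.
split; rewrite q_mkE.
- by apply: seqlim_eq lim1 => // n; rewrite E q_mkE.
- by apply: seqlim_eq (lim2 W1) => // n; rewrite E q_mkE.
- by apply: seqlim_eq (lim2 W2) => // n; rewrite E q_mkE.
- by apply: seqlim_eq (lim2 W3) => // n; rewrite E q_mkE.
Qed.

End Split.

Section Nilpotent.
Variables (c x y z : C).
Hypothesis hN : x * x + y * y + z * z = 0.
Let w : HC := qmk c x y z.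

Lemma nilpotent_pow n : w ^+ n.+1 = qmk (c ^+ n.+1) (n.+1%:R * c ^+ n * x)
  (n.+1%:R * c ^+ n * y) (n.+1%:R * c ^+ n * z).
Proof.
elim: n => [|n IH]; first by rewrite !expr1 expr0 !mul1r.
rewrite exprS IH -[w * _]/(Defs.mulq _ _) /Defs.mulq /w !q_mkE -(natr1 n.+1).
rewrite (exprS c n.+1) (exprS c n); move: (n.+1%:R : C) (c ^+ n) => k p.
congr qmk; try ring.
transitivity (c * (c * p) - k * p * (x * x + y * y + z * z)); first by ring.
by rewrite hN mulr0 subr0.
Qed.

Lemma hexp_nilpotent : hexp w (qmk (expc c) (expc c * x) (expc c * y) (expc c * z)).
Proof.
(* The vector part X satisfies X^2 = 0, so (c + X)^k = c^k + k c^(k-1) X: the vector part of the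
   partial sum lags one index behind. *)
have E n : qsum w n.+1 = qmk (expsum c n.+1) (expsum c n * x) (expsum c n * y) (expsum c n * z).
  elim: n => [|n IH].
    have e0 : expsum c 0 = 0 by rewrite /expsum big_geq.
    have e1 : expsum c 1 = 1 by rewrite expsumS e0 add0r expr0 mulr1 fact0 invr1.
    have q1 : qsum w 1 = 1 by rewrite qsumS qsum0 add0r expr0 fact0 invr1 scale1r.
    by rewrite q1 e0 e1 !mul0r; apply: quat_ext; rewrite q_oneE ?q_mkE.
  rewrite qsumS IH nilpotent_pow !expsumS.
  have k0 : (n.+1%:R : C) != 0 by rewrite pnatr_eq0.
  have f0 : (n`!%:R : C) != 0 by rewrite pnatr_eq0 -lt0n fact_gt0.
  have key (k f p s V : C) : k != 0 -> f != 0 ->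
      s * V + (k * f)^-1 * (k * p * V) = (s + f^-1 * p) * V.
    by move=> k1 f1; field; rewrite k1 f1.
  rewrite factS natrM; apply: quat_ext; rewrite q_DE q_ZE !q_mkE //; exact: key.
split; apply: seqlim_shift.
- apply: (@seqlim_eq (fun n => expsum c n.+1) _ (expc c)) => [n||]; rewrite ?E ?q_mkE//.
  move=> e /(@expcP _ c)[N HN]; exists N => n Nn; apply: HN; exact: leqW.
- apply: (@seqlim_eq (fun n => x * expsum c n) _ (x * expc c)) => [n||].
  + by rewrite E q_mkE mulrC.
  + by rewrite q_mkE mulrC.
  + by apply: seqlimZ; exact: seqlim_expsum.
- apply: (@seqlim_eq (fun n => y * expsum c n) _ (y * expc c)) => [n||].
  + by rewrite E q_mkE mulrC.
  + by rewrite q_mkE mulrC.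
  + by apply: seqlimZ; exact: seqlim_expsum.
- apply: (@seqlim_eq (fun n => z * expsum c n) _ (z * expc c)) => [n||].
  + by rewrite E q_mkE mulrC.
  + by rewrite q_mkE mulrC.
  + by apply: seqlimZ; exact: seqlim_expsum.
Qed.

End Nilpotent.

Lemma q_conjE w : (q_re (hc_conj w) = ((q_re w)^*)%C) * (q_i (hc_conj w) = ((q_i w)^*)%C) *
  (q_j (hc_conj w) = ((q_j w)^*)%C) * (q_k (hc_conj w) = ((q_k w)^*)%C).
Proof. by rewrite /q_re /q_i /q_j /q_k !mxE. Qed.

Lemma hc_conjX w n : hc_conj (w ^+ n) = hc_conj w ^+ n.
Proof.
elim: n => [|n IH]; last by rewrite !exprS hc_conjM IH.
by apply: quat_ext; rewrite !expr0 q_conjE q_oneE ?conjc1 ?conjc0.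
Qed.

Lemma seqlim_conj p L : seqlim p L -> seqlim (fun n => ((p n)^*)%C) (L^*)%C.
Proof. by move=> H e /H[N HN]; exists N => n /HN; rewrite -conjcB nm_conj. Qed.

Lemma hexp_conj w v : hexp w v -> hexp (hc_conj w) (hc_conj v).
Proof.
have E n : qsum (hc_conj w) n = hc_conj (qsum w n).
  have cD (p q : HC) : hc_conj (p + q) = hc_conj p + hc_conj q.
    by apply: quat_ext; rewrite !(q_DE, q_conjE) rmorphD.
  elim: n => [|n IH].
    by rewrite !qsum0; apply: quat_ext; rewrite q_conjE q_0E conjc0.
  rewrite !qsumS IH cD -hc_conjX; congr (_ + _).
  by apply: quat_ext; rewrite !(q_ZE, q_conjE) rmorphM fmorphV /= rmorph_nat.
move=> [h1 h2 h3 h4]; split; rewrite q_conjE.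
- by apply: seqlim_eq (seqlim_conj h1) => // n; rewrite E q_conjE.
- by apply: seqlim_eq (seqlim_conj h2) => // n; rewrite E q_conjE.
- by apply: seqlim_eq (seqlim_conj h3) => // n; rewrite E q_conjE.
- by apply: seqlim_eq (seqlim_conj h4) => // n; rewrite E q_conjE.
Qed.

End QuaternionExponential.

(** * Uniqueness and symmetry of logarithms *)

Section LocalLogarithm.
Context {R : realType}.
Local Notation C := R[i].
Local Notation HC := (quat R[i]).
Local Notation i := ('i%C : C).
Implicit Types (a b c o x y z u s t w : C) (e r : R) (f g h l n : C -> C).

Lemma hexp_point (A B g0 n W1 W2 W3 : C) : W1 * W1 + W2 * W2 + W3 * W3 = 1 ->
    expc A = g0 + i * n -> expc B = g0 - i * n ->
  hexp (qmk ((A + B) / 2) ((A - B) / (2 * i) * W1) ((A - B) / (2 * i) * W2)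
    ((A - B) / (2 * i) * W3)) (qmk g0 (n * W1) (n * W2) (n * W3)).
Proof.
move=> hW eA eB; have i0 : i != 0 := i_neq0.
have := @hexp_split R ((A + B) / 2) ((A - B) / (2 * i)) _ _ _ hW.
have -> : (A + B) / 2 + i * ((A - B) / (2 * i)) = A by field.
have -> : (A + B) / 2 - i * ((A - B) / (2 * i)) = B by field.
rewrite eA eB.
have -> : (g0 + i * n + (g0 - i * n)) / 2 = g0 by field.
by have -> : (g0 + i * n - (g0 - i * n)) / (2 * i) = n by field.
Qed.

(** Differentiating the equality of exponentials gives l1' = l2', so the difference is constant. *)
Lemma log_unique o l1 l2 : nearc o (fun z => [/\ hol l1 z, hol l2 z & expc (l1 z) = expc (l2 z)]) ->
  l1 o = l2 o -> nearc o (fun z => l1 z = l2 z).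
Proof.
move=> H e; have [r r0 Hr] := nearc_cball (nearc_near H).
exists r => // z zr; apply/eqP; rewrite -subr_eq0; apply/eqP.
have d0 : l1 o - l2 o = 0 by rewrite e subrr.
rewrite -[RHS]d0; apply: (@constant_of_deriv0 _ o r (fun z => l1 z - l2 z)) => //; last exact: ltW.
move=> w /Hr Hw; have [[d1 h1] [d2 h2] ew] := nearc_self Hw.
have k1 := cd_comp h1 (expc_deriv _); have k2 := cd_comp h2 (expc_deriv _).
have k : expc (l1 w) * d1 = expc (l2 w) * d2.
  apply: cd_uniq k2; apply: cd_near k1.
  by apply: nearcW Hw => x [].
have <- : d1 - d2 = 0.
  rewrite ew in k; apply/eqP; rewrite subr_eq0; apply/eqP.
  exact: mulfI (expc_neq0 _) _ _ k.
exact: cdB.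
Qed.

Definition symm f z := f (z^*)%C = ((f z)^*)%C.

Lemma nearc_conj o (P : C -> Prop) : (o^*)%C = o -> nearc o P -> nearc o (fun z => P (z^*)%C).
Proof.
by move=> oo [r r0 H]; exists r => // z zr; apply: H; rewrite -{1}oo -conjcB nm_conj.
Qed.

Lemma hol_symm o f : (o^*)%C = o -> nearc o (hol f) ->
  nearc o (hol (fun z => ((f (z^*)%C)^*)%C)).
Proof. by move=> oo /(nearc_conj oo); apply: nearcW => z; exact: hol_reflect. Qed.

(** The reflection of [l] is another logarithm of [f], with the same real value at [o]. *)
Lemma log_symm o f l : (o^*)%C = o -> nearc o (symm f) -> ((l o)^*)%C = l o ->
  nearc o (fun z => hol l z /\ expc (l z) = f z) -> nearc o (symm l).
Proof.
move=> oo fs lo Hl.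
have H : nearc o (fun z => ((l (z^*)%C)^*)%C = l z).
  apply: log_unique; last by rewrite oo.
  have Hl' := nearc_conj oo Hl.
  apply: nearcW (nearc_and fs (nearc_and Hl Hl')) => z [fz [[h1 e1] [h2 e2]]].
  by split; [exact: hol_reflect|by []|rewrite expc_conj e2 e1 fz conjcK].
by apply: nearcW H => z e; rewrite /symm -e conjcK.
Qed.

(** S(u) is log(1 + u)/2 and T(u) is arctan(s)/s with s^2 = u. Both are even in s, hence do not
    depend on the root; as the last clause holds for s and for -s, it covers both eigenvalues. *)
Lemma atan_like : exists S T : C -> C, nearc 0 (fun u =>
  [/\ hol S u, hol T u, u = 0 -> S u = 0 /\ T u = 1 &
      forall s, s ^+ 2 = u -> expc (S u + i * (T u * s)) = 1 + i * s]).
Proof.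
have i0 : i != 0 := i_neq0.
have h1i (z : C) : cderiv (fun s => 1 + i * s) z i.
  rewrite -[X in cderiv _ _ X]add0r -[X in cderiv _ _ (0 + X)]mulr1.
  rewrite -[X in cderiv _ _ (0 + X)]add0r -[X in cderiv _ _ (0 + (X + _))](mul0r z).
  by apply: cdD; [exact: cd_cst|apply: cdM; [exact: cd_cst|exact: cd_id]].
have e0 : expc 0 = (fun s => 1 + i * s) 0 by rewrite expc0 mulr0 addr0.
have [l [l0 Hl]] := @local_log _ 0 (fun s => 1 + i * s) 0 (nearc_all 0 (fun z => ex_intro _ i (h1i z))) e0.
have dl : cderiv l 0 i.
  have [[d hd] _] := nearc_self Hl; suff -> : i = d by [].
  have := cd_comp hd (expc_deriv _); rewrite l0 expc0 mul1r => k.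
  apply: cd_uniq (h1i 0) _; apply: cd_near k.
  by apply: nearcW Hl => z [].
have [r r0 Hr] := Hl.
pose q (u : C) : C := sqrtc u.
have qq u : q u ^+ 2 = u by exact: sqr_sqrtc.
have qsmall (e : R) : 0 < e -> nearc 0 (fun u => nm (q u) < e).
  move=> e0'; exists (e ^+ 2); first by rewrite exprn_gt0.
  move=> u; rewrite subr0 -{1}(qq u) nmX.
  by rewrite (@ltr_pXn2r _ 2) ?nnegrE ?nm_ge0 ?ltW.
pose S u := (l (q u) + l (- q u)) / 2.
pose T u := if u == 0 then 1 else (l (q u) - l (- q u)) / (2 * i * q u).
have q0 : q 0 = 0 by exact: sqrtc0.
have qneq u : u != 0 -> q u != 0.
  by move=> u0; apply: contra_neq u0 => h; rewrite -(qq u) h expr0n.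
have two0 := @two_neq0 R.
have STE u s : s ^+ 2 = u ->
    S u = (l s + l (- s)) / 2 /\ (u != 0 -> T u = (l s - l (- s)) / (2 * i * s)).
  move=> su; have /eqP : s ^+ 2 = q u ^+ 2 by rewrite su qq.
  rewrite eqf_sqr => /orP[] /eqP e.
    by rewrite /S /T e; split => // /negbTE ->.
  rewrite /S /T e opprK; split; first by rewrite addrC.
  move=> u0; rewrite (negbTE u0); have := qneq u u0.
  by move: (l (q u)) (l (- q u)) (q u) => A B p p0; field; rewrite i0 p0.
(* [sqrtc] is only a pointwise choice of root. Near a nonzero [u] it is replaced by a holomorphic
   root [p], with the same [S] and [T] by [STE]; at 0 the singularity is removable. *)
have punctured u : u != 0 -> nm (q u) < r -> hol S u /\ hol T u.
  move=> u0 qr; have [p Hp] := local_sqrt (nearc_all u (fun z => hol_id z)) u0.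
  have [hp pu] := nearc_self Hp.
  have nmp : nm (p u) < r.
    rewrite -(@ltr_pXn2r _ 2) ?nnegrE ?nm_ge0 ?(ltW r0)// -nmX pu -{1}(qq u) nmX.
    by rewrite (@ltr_pXn2r _ 2) ?nnegrE ?nm_ge0 ?(ltW r0).
  have pn0 : p u != 0 by apply: contra_neq u0 => h; rewrite -pu h expr0n.
  have [h1 _] : hol l (p u) /\ expc (l (p u)) = 1 + i * p u by apply: Hr; rewrite subr0.
  have [h2 _] : hol l (- p u) /\ expc (l (- p u)) = 1 + i * (- p u).
    by apply: Hr; rewrite subr0 nmN.
  have k1 := hol_comp hp h1.
  have k2 : hol (fun w => l (- p w)) u by apply: (@hol_comp _ (fun w => - p w)) => //; exact: holN.
  split.
    apply: (@hol_near _ (fun w => (l (p w) + l (- p w)) * 2^-1)).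
      by apply: nearcW Hp => w [_ /STE[-> _]].
    by apply: holM; [exact: holD|exact: hol_cst].
  apply: (@hol_near _ (fun w => (l (p w) - l (- p w)) * (2 * i * p w)^-1)).
    by apply: nearcW (nearc_and Hp (nearc_neq u0)) => w [[_ /STE[_ h]] w0]; rewrite h.
  apply: holM; first exact: holB.
  by apply: holV; [apply: holM => //; exact: hol_cst|rewrite !mulf_neq0].
have [phi [cp phi0 Hphi]] := dl.
have nS : nearc 0 (fun u => u != 0 -> hol S u).
  by apply: nearcW (qsmall r r0) => u ur u0; have [] := punctured _ u0 ur.
have nT : nearc 0 (fun u => u != 0 -> hol T u).
  by apply: nearcW (qsmall r r0) => u ur u0; have [] := punctured _ u0 ur.
have S0 : S 0 = 0 by rewrite /S q0 oppr0 l0 addr0 mul0r.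
have T0 : T 0 = 1 by rewrite /T eqxx.
have hS : hol S 0.
  apply: removable_singularity nS => e e'0.
  have cl := cd_cont dl; have [s s0 Hs] := cl _ e'0.
  apply: nearcW (qsmall s s0) => u us; rewrite S0 subr0 nm_half.
  have h1 : nm (l (q u) - l 0) < e by apply: Hs; rewrite subr0.
  have h2 : nm (l (- q u) - l 0) < e by apply: Hs; rewrite subr0 nmN.
  rewrite l0 !subr0 in h1 h2; have := nmD (l (q u)) (l (- q u)); lra.
have hT : hol T 0.
  apply: removable_singularity nT => e e'0.
  have [s s0 Hs] := nearc_and (cp _ e'0) Hphi.
  apply: nearcW (qsmall s s0) => u us; rewrite T0.
  have [->|u0] := eqVneq u 0; first by rewrite T0 subrr nm0.
  have [h1 h2] : nm (phi (q u) - phi 0) < e /\ l (q u) - l 0 = phi (q u) * (q u - 0).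
    by apply: Hs; rewrite subr0.
  have [h3 h4] : nm (phi (- q u) - phi 0) < e /\ l (- q u) - l 0 = phi (- q u) * (- q u - 0).
    by apply: Hs; rewrite subr0 nmN.
  rewrite l0 !subr0 in h2 h4.
  have -> : T u - 1 = ((phi (q u) - phi 0) + (phi (- q u) - phi 0)) / 2 * i^-1.
    rewrite /T (negbTE u0) h2 h4 phi0; have := qneq u u0.
    by move: (phi (q u)) (phi (- q u)) (q u) => A B p p0; field; rewrite i0 p0.
  rewrite nmM nmV nm_ii invr1 mulr1 nm_half.
  by have := nmD (phi (q u) - phi 0) (phi (- q u) - phi 0); lra.
exists S, T; apply: nearcW (qsmall r r0) => u ur.
have pt : forall s, s ^+ 2 = u -> expc (S u + i * (T u * s)) = 1 + i * s.
  move=> s su; have [-> hTs] := STE _ _ su.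
  have sr : nm (s - 0) < r.
    rewrite subr0 -(@ltr_pXn2r _ 2) ?nnegrE ?nm_ge0 ?(ltW r0)// -nmX su -{1}(qq u) nmX.
    by rewrite (@ltr_pXn2r _ 2) ?nnegrE ?nm_ge0 ?(ltW r0).
  have [_ <-] := Hr s sr; congr expc.
  have [u0|u0] := eqVneq u 0.
    have s00 : s = 0 by apply/eqP; rewrite -sqrf_eq0 su u0.
    by rewrite s00 oppr0 l0 !mulr0 !addr0 mul0r.
  have s00 : s != 0 by apply: contra_neq u0 => h; rewrite -su h expr0n.
  rewrite hTs//; move: (l s) (l (- s)) => A B; field.
  by rewrite s00 i0.
have [u0|u0] := eqVneq u 0.
  by rewrite u0 in pt *; split; [exact: hS|exact: hT|move=> _; split|exact: pt].
have [h1 h2] := punctured _ u0 ur.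
split; [exact: h1|exact: h2| |exact: pt].
by move=> u0'; move: u0; rewrite u0' eqxx.
Qed.

End LocalLogarithm.

(** * Logarithms of quaternion-valued holomorphic functions *)

Section StemLogarithm.
Context {R : realType}.
Local Notation C := R[i].
Local Notation HC := (quat R[i]).
Local Notation i := ('i%C : C).
Implicit Types (a b c o x y z u s t w : C) (e r : R) (f g h l n : C -> C) (F G L : C -> HC).

Definition holq F z := [/\ hol (fun w => q_re (F w)) z, hol (fun w => q_i (F w)) z,
  hol (fun w => q_j (F w)) z & hol (fun w => q_k (F w)) z].

Lemma qmk_eta (w : HC) : w = qmk (q_re w) (q_i w) (q_j w) (q_k w).
Proof. by apply: quat_ext; rewrite q_mkE. Qed.

Lemma holq_mk f0 f1 f2 f3 z : hol f0 z -> hol f1 z -> hol f2 z -> hol f3 z ->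
  holq (fun w => qmk (f0 w) (f1 w) (f2 w) (f3 w)) z.
Proof.
move=> h0 h1 h2 h3; split.
- by apply: hol_near h0; apply: nearc_all => w; rewrite q_mkE.
- by apply: hol_near h1; apply: nearc_all => w; rewrite q_mkE.
- by apply: hol_near h2; apply: nearc_all => w; rewrite q_mkE.
- by apply: hol_near h3; apply: nearc_all => w; rewrite q_mkE.
Qed.

Lemma holq_near F G z : nearc z (fun w => F w = G w) -> holq F z -> holq G z.
Proof.
move=> FG [h0 h1 h2 h3]; split.
- by apply: hol_near h0; apply: nearcW FG => w ->.
- by apply: hol_near h1; apply: nearcW FG => w ->.
- by apply: hol_near h2; apply: nearcW FG => w ->.
- by apply: hol_near h3; apply: nearcW FG => w ->.
Qed.

Definition vecnorm (w : HC) : C := q_i w * q_i w + q_j w * q_j w + q_k w * q_k w.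

(** The norm form of H_C, which is the determinant in M_2(C); [qdet_factor] writes it as the product
    of the two eigenvalues. *)
Definition qdet (w : HC) : C := q_re w * q_re w + vecnorm w.

Definition split_log A B W1 W2 W3 z : HC :=
  qmk ((A z + B z) / 2) ((A z - B z) / (2 * i) * W1 z)
    ((A z - B z) / (2 * i) * W2 z) ((A z - B z) / (2 * i) * W3 z).

Lemma split_logP o G n A B W1 W2 W3 :
    nearc o (fun z => [/\ hol A z, hol B z, hol W1 z, hol W2 z & hol W3 z]) ->
    nearc o (fun z => W1 z * W1 z + W2 z * W2 z + W3 z * W3 z = 1) ->
    nearc o (fun z => [/\ q_i (G z) = n z * W1 z, q_j (G z) = n z * W2 z &
      q_k (G z) = n z * W3 z]) ->
    nearc o (fun z => expc (A z) = q_re (G z) + i * n z) ->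
    nearc o (fun z => expc (B z) = q_re (G z) - i * n z) ->
  nearc o (fun z => holq (split_log A B W1 W2 W3) z /\ hexp (split_log A B W1 W2 W3 z) (G z)).
Proof.
move=> hh hW hG hA hB.
apply: nearcW (nearc_and hh (nearc_and hW (nearc_and hG (nearc_and hA hB)))).
move=> z [[kA kB k1 k2 k3] [eW [[e1 e2 e3] [eA eB]]]]; split; last first.
  by rewrite (qmk_eta (G z)) e1 e2 e3; exact: hexp_point.
have hd : hol (fun w => (A w - B w) / (2 * i)) z.
  by apply: holM; [exact: holB|exact: hol_cst].
apply: holq_mk; [|exact: holM|exact: holM|exact: holM].
by apply: holM; [exact: holD|exact: hol_cst].
Qed.

Lemma nearc_hol4 o G : nearc o (holq G) ->
  [/\ nearc o (hol (fun w => q_re (G w))), nearc o (hol (fun w => q_i (G w))),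
      nearc o (hol (fun w => q_j (G w))) & nearc o (hol (fun w => q_k (G w)))].
Proof. by move=> H; split; apply: nearcW H => z []. Qed.

Lemma hol_vecnorm G z : holq G z -> hol (fun w => vecnorm (G w)) z.
Proof. by move=> [_ h1 h2 h3]; apply: holD; [apply: holD|]; exact: holM. Qed.

Lemma qdet_factor (g0 n N : C) : n ^+ 2 = N -> (g0 + i * n) * (g0 - i * n) = g0 * g0 + N.
Proof.
move=> <-; transitivity (g0 * g0 - (i * i) * n ^+ 2); first by ring.
by rewrite i2 mulN1r opprK.
Qed.

Lemma log_semisimple o G : nearc o (holq G) -> qdet (G o) != 0 -> vecnorm (G o) != 0 ->
  exists L, nearc o (fun z => holq L z /\ hexp (L z) (G z)).
Proof.
move=> hG dG nG; have [h0 h1 h2 h3] := nearc_hol4 hG.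
have hN : nearc o (hol (fun w => vecnorm (G w))) by apply: nearcW hG => z; exact: hol_vecnorm.
have [n Hn] := local_sqrt hN nG.
have hn : nearc o (hol n) by apply: nearcW Hn => z [].
have [_ no] := nearc_self Hn.
have n0 : n o != 0 by apply: contra_neq nG => h; rewrite -no h expr0n.
have nn0 := cc_nonzero (hol_cont (nearc_self hn)) n0.
have hin : nearc o (hol (fun z => i * n z)).
  by apply: nearcW hn => z h; apply: holM => //; exact: hol_cst.
have : (q_re (G o) + i * n o) * (q_re (G o) - i * n o) != 0 by rewrite (qdet_factor _ no).
rewrite mulf_eq0 negb_or => /andP[lo mo].
have [A HA] : exists A, nearc o (fun z => hol A z /\ expc (A z) = q_re (G z) + i * n z).
  apply: (@local_log_exists _ o (fun z => q_re (G z) + i * n z)) lo.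
  by apply: nearcW (nearc_and h0 hin) => z [k1 k2]; exact: holD.
have [B HB] : exists B, nearc o (fun z => hol B z /\ expc (B z) = q_re (G z) - i * n z).
  apply: (@local_log_exists _ o (fun z => q_re (G z) - i * n z)) mo.
  by apply: nearcW (nearc_and h0 hin) => z [k1 k2]; exact: holB.
exists (split_log A B (fun z => q_i (G z) / n z) (fun z => q_j (G z) / n z)
  (fun z => q_k (G z) / n z)).
apply: (split_logP (n := n)).
- apply: nearcW (nearc_and HA (nearc_and HB (nearc_and hG (nearc_and hn nn0)))).
  move=> z [[kA _] [[kB _] [[_ k1 k2 k3] [kn kn0]]]].
  by split => //; apply: holM => //; exact: holV.
- apply: nearcW (nearc_and Hn nn0) => z [[_ nz] n0z].
  have -> : q_i (G z) / n z * (q_i (G z) / n z) + q_j (G z) / n z * (q_j (G z) / n z) +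
     q_k (G z) / n z * (q_k (G z) / n z) = vecnorm (G z) / n z ^+ 2.
    by rewrite /vecnorm; field.
  by rewrite nz divff// -nz expf_eq0.
- apply: nearcW nn0 => z n0z.
  by split; rewrite mulrC divfK.
- by apply: nearcW HA => z [].
- by apply: nearcW HB => z [].
Qed.

Lemma log_nilpotent o G : nearc o (holq G) -> qdet (G o) != 0 -> vecnorm (G o) = 0 ->
  exists L, nearc o (fun z => holq L z /\ hexp (L z) (G z)).
Proof.
move=> hG dG nG; have [h0 h1 h2 h3] := nearc_hol4 hG.
have g0 : q_re (G o) != 0.
  by move: dG; rewrite /qdet nG addr0; apply: contra_neq => ->; rewrite mul0r.
have [a Ha] := local_log_exists h0 g0.
have [S [T ST]] := @atan_like R.
pose u z := vecnorm (G z) / q_re (G z) ^+ 2.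
have nng := cc_nonzero (hol_cont (nearc_self h0)) g0.
have hu : nearc o (hol u).
  apply: nearcW (nearc_and hG nng) => z [k k0].
  apply: holM; first exact: hol_vecnorm.
  by have [k1 _ _ _] := k; apply: holV; [exact: holX|rewrite expf_eq0].
have u0 : u o = 0 by rewrite /u nG mul0r.
rewrite -u0 in ST; have ST' := nearc_comp (hol_cont (nearc_self hu)) ST.
pose Y (q : HC -> C) z := T (u z) * (q (G z) / q_re (G z)).
exists (fun z => qmk (a z + S (u z)) (Y (@q_i _) z) (Y (@q_j _) z) (Y (@q_k _) z)).
apply: nearcW (nearc_and ST' (nearc_and hG (nearc_and nng (nearc_and hu Ha)))).
move=> z [[hS hT z0 hs] [[k0 k1 k2 k3] [gz [huz [haz eaz]]]]].
rewrite u0 in z0; split.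
  have hTu : hol (fun w => T (u w)) z by exact: hol_comp huz hT.
  have hV : hol (fun w => (q_re (G w))^-1) z by exact: holV.
  apply: holq_mk.
  - by apply: holD => //; exact: hol_comp huz hS.
  - by apply: holM => //; exact: holM.
  - by apply: holM => //; exact: holM.
  - by apply: holM => //; exact: holM.
set p := q_re (G z) in gz eaz *; set x := q_i (G z); set y := q_j (G z); set t := q_k (G z).
have uE : u z = (x * x + y * y + t * t) / p ^+ 2 by [].
have GE : G z = qmk p x y t by exact: qmk_eta.
rewrite /Y -/p -/x -/y -/t GE.
have [uz|uz] := eqVneq (u z) 0.
  have [S0 T0] := z0 uz; rewrite S0 T0 addr0 !mul1r.
  have hn : x / p * (x / p) + y / p * (y / p) + t / p * (t / p) = 0.
    by rewrite -uz uE; field.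
  have := hexp_nilpotent (a z) hn; rewrite eaz.
  by rewrite ![p * (_ / p)]mulrCA divff// !mulr1.
(* The identity is checked at one point, so any root [s] will do: the logarithm contains only
   [S (u z)] and [T (u z)], and [s] disappears by [key2] and [key3]. *)
pose s := sqrtc (u z); have ss : s ^+ 2 = u z by exact: sqr_sqrtc.
have s0 : s != 0 by apply: contra_neq uz => h; rewrite -ss h expr0n.
have e1 := hs s ss; have e2 : expc (S (u z) + i * (T (u z) * - s)) = 1 + i * - s.
  by apply: hs; rewrite sqrrN.
have hW : x / (p * s) * (x / (p * s)) + y / (p * s) * (y / (p * s)) +
    t / (p * s) * (t / (p * s)) = 1.
  transitivity ((x * x + y * y + t * t) / p ^+ 2 / s ^+ 2); first by field; rewrite s0 gz.
  by rewrite -uE ss divff.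
have eA : expc (a z + (S (u z) + i * (T (u z) * s))) = p + i * (p * s).
  by rewrite expcD eaz e1 mulrDr mulr1 mulrCA.
have eB : expc (a z + (S (u z) + i * (T (u z) * - s))) = p - i * (p * s).
  by rewrite expcD eaz e2 mulrN mulrDr mulr1 mulrN mulrCA.
have := hexp_point hW eA eB.
have key (v : C) : p * s * (v / (p * s)) = v by field; rewrite s0 gz.
rewrite !key.
have i0 : i != 0 := i_neq0.
have key2 (A B D : C) : (A + (B + i * (D * s)) + (A + (B + i * (D * - s)))) / 2 = A + B by field.
have key3 (A B D V : C) : (A + (B + i * (D * s)) - (A + (B + i * (D * - s)))) / (2 * i) *
    (V / (p * s)) = D * (V / p) by field; rewrite s0 i0 gz.
by rewrite key2 !key3.
Qed.

Lemma log_generic o G : nearc o (holq G) -> qdet (G o) != 0 ->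
  exists L, nearc o (fun z => holq L z /\ hexp (L z) (G z)).
Proof.
move=> hG dG; have [n0|n0] := eqVneq (vecnorm (G o)) 0.
  exact: log_nilpotent.
exact: log_semisimple.
Qed.

Lemma nearc_symm o G : nearc o (fun z => G (z^*)%C = hc_conj (G z)) ->
  [/\ nearc o (symm (fun w => q_re (G w))), nearc o (symm (fun w => q_i (G w))),
      nearc o (symm (fun w => q_j (G w))) & nearc o (symm (fun w => q_k (G w)))].
Proof. by move=> H; split; apply: nearcW H => z e; rewrite /symm e q_conjE. Qed.

Lemma real_of_symm o f : (o^*)%C = o -> symm f o -> exists x : R, f o = x%:C%C.
Proof.
rewrite /symm => -> ; case: (f o) => x y [/eqP]; rewrite -subr_eq0 opprK -mulr2n mulrn_eq0 /=.
by move=> /eqP ->; exists x.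
Qed.

(* Near a real point the vector part of G is n W with n and the unit vector W
   holomorphic: G's vector part vanishes to some order m, and the quotient by
   (z - o)^m is a nonzero real vector at o, so its norm has a holomorphic square
   root. *)
Lemma real_polar o G : (o^*)%C = o -> nearc o (holq G) ->
    nearc o (fun z => G (z^*)%C = hc_conj (G z)) ->
  exists n W1 W2 W3, [/\ nearc o (fun z => [/\ hol n z, hol W1 z, hol W2 z & hol W3 z]),
    nearc o (fun z => W1 z * W1 z + W2 z * W2 z + W3 z * W3 z = 1),
    nearc o (fun z => [/\ q_i (G z) = n z * W1 z, q_j (G z) = n z * W2 z &
      q_k (G z) = n z * W3 z]) &
    nearc o (fun z => [/\ symm n z, symm W1 z, symm W2 z & symm W3 z])].
Proof.
move=> oo hG sG; have [_ h1 h2 h3] := nearc_hol4 hG; have [_ s1 s2 s3] := nearc_symm sG.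
(* [option bool] serves as a three-element index type for the vector coordinates. *)
pose f (k : option bool) := match k with
  | None => fun w => q_i (G w) | Some true => fun w => q_j (G w)
  | Some false => fun w => q_k (G w) end.
have hf k : nearc o (hol (f k)) by case: k => [[]|].
have sf k : nearc o (symm (f k)) by case: k => [[]|].
have [f0|[m [g [hg fg [k0 gk0]]]]] := common_order hf.
  (* If the vector part vanishes identically, [n] is 0 and any constant real unit vector can be
     [W]. *)
  exists (fun=> 0), (fun=> 1), (fun=> 0), (fun=> 0); split.
  - by apply: nearc_all => z; split; exact: hol_cst.
  - by apply: nearc_all => z; rewrite !mulr0 !addr0 mulr1.
  - apply: nearcW (nearc_and (f0 None) (nearc_and (f0 (Some true)) (f0 (Some false)))).
    by move=> z [/= -> [-> ->]]; rewrite !mul0r.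
  - by apply: nearc_all => z; rewrite /symm conjc0 conjc1.
(* Since [o] is real, the symmetric factor [(z - o) ^+ m] cancels off [o]; at [o] itself the
   symmetry follows by continuity. *)
have sg k : nearc o (symm (g k)).
  have cg := hol_cont (nearc_self (hg k)).
  have cg' := hol_cont (nearc_self (hol_symm oo (hg k))).
  have H : nearc o (fun z => z != o -> g k z = ((g k (z^*)%C)^*)%C).
    apply: nearcW (nearc_and (sf k) (nearc_and (fg k) (nearc_conj oo (fg k)))).
    move=> z [e1 [e2 e3]] zo; rewrite /symm e2 e3 conjcM in e1.
    have zo' : (z - o) ^+ m != 0 by rewrite expf_neq0// subr_eq0.
    have zc : (((z - o) ^+ m)^*)%C = ((z^*)%C - o) ^+ m.
      by rewrite rmorphXn /= conjcB oo.
    rewrite zc in e1; have zo2 : ((z^*)%C - o) ^+ m != 0 by rewrite -zc conjc_eq0.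
    by rewrite (mulfI zo2 e1) conjcK.
  have go : g k o = ((g k (o^*)%C)^*)%C by exact: cc_uniq H cg cg'.
  apply: nearcW H => z h; rewrite /symm.
  have [zo|/h ->] := eqVneq z o; last by rewrite conjcK.
  by rewrite zo go conjcK.
have [x ex] := real_of_symm oo (nearc_self (sg None)).
have [y ey] := real_of_symm oo (nearc_self (sg (Some true))).
have [t et] := real_of_symm oo (nearc_self (sg (Some false))).
pose NV z := g None z * g None z + g (Some true) z * g (Some true) z
  + g (Some false) z * g (Some false) z.
have NVo : NV o = (x * x + y * y + t * t)%:C%C.
  by rewrite /NV ex ey et !rmorphD !rmorphM.
have pos : 0 < x * x + y * y + t * t.
  have nz : x != 0 \/ y != 0 \/ t != 0.
    move: gk0; case: k0 => [[]|].
    - by rewrite ey => h; right; left; apply: contra_neq h => ->.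
    - by rewrite et => h; right; right; apply: contra_neq h => ->.
    - by rewrite ex => h; left; apply: contra_neq h => ->.
  have sq (v : R) : v != 0 -> 0 < v * v by rewrite -expr2 exprn_even_gt0.
  have := sqr_ge0 x; have := sqr_ge0 y; have := sqr_ge0 t; rewrite !expr2.
  by case: nz => [/sq|[/sq|/sq]]; lra.
have hNV : nearc o (hol NV).
  apply: nearcW (nearc_and (hg None) (nearc_and (hg (Some true)) (hg (Some false)))).
  by move=> z [k1 [k2 k3]]; apply: holD; [apply: holD|]; exact: holM.
have sNV : nearc o (symm NV).
  apply: nearcW (nearc_and (sg None) (nearc_and (sg (Some true)) (sg (Some false)))).
  move=> z [e1 [e2 e3]]; rewrite /symm /NV e1 e2 e3 -!conjcM.
  by rewrite -!rmorphD.
(* [NV o] is a positive real number; the choice of its real logarithm makes [l], and so the root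
   [nu], symmetric. *)
have eNV : expc (ln (x * x + y * y + t * t))%:C%C = NV o.
  by rewrite expc_real NVo lnK.
have [l [lo Hl]] := local_log hNV eNV.
have sl : nearc o (symm l).
  by apply: (log_symm oo sNV) Hl; rewrite lo conjc_real.
pose nu z := expc (l z / 2).
have nu2 : nearc o (fun z => nu z * nu z = NV z).
  by apply: nearcW Hl => z [_ <-]; rewrite /nu -expcD; congr expc; field.
have nu0 z : nu z != 0 by exact: expc_neq0.
have hnu : nearc o (hol nu).
  apply: nearcW Hl => z [hl _]; apply: (@hol_comp _ (fun w => l w / 2)); last exact: expc_hol.
  by apply: holM => //; exact: hol_cst.
have snu : nearc o (symm nu).
  apply: nearcW sl => z e; rewrite /symm /nu e -expc_conj; congr expc.
  by rewrite conjcM conjc_inv conjc_nat.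
have hW k : nearc o (hol (fun z => g k z / nu z)).
  by apply: nearcW (nearc_and (hg k) hnu) => z [? ?]; apply: holM => //; exact: holV.
have sW k : nearc o (symm (fun z => g k z / nu z)).
  by apply: nearcW (nearc_and (sg k) snu) => z [e1 e2]; rewrite /symm e1 e2 conjcM conjc_inv.
have nW k z : f k z = (z - o) ^+ m * g k z -> f k z = (z - o) ^+ m * nu z * (g k z / nu z).
  by move=> ->; rewrite -mulrA; congr (_ * _); rewrite mulrCA divff// mulr1.
exists (fun z => (z - o) ^+ m * nu z), (fun z => g None z / nu z),
  (fun z => g (Some true) z / nu z), (fun z => g (Some false) z / nu z); split.
- apply: nearcW (nearc_and hnu (nearc_and (hW None)
    (nearc_and (hW (Some true)) (hW (Some false))))) => z [k0' [k1 [k2 k3]]].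
  split => //; apply: holM => //; apply: holX; apply: holB; [exact: hol_id|exact: hol_cst].
- apply: nearcW nu2 => z e.
  transitivity (NV z / (nu z * nu z)); last by rewrite e divff// -e mulf_neq0.
  by rewrite /NV; move: (nu0 z) => nz; field.
- apply: nearcW (nearc_and (fg None) (nearc_and (fg (Some true)) (fg (Some false)))).
  by move=> z [e1 [e2 e3]]; split; [exact: (nW None)|exact: (nW (Some true))|exact: (nW (Some false))].
- apply: nearcW (nearc_and snu (nearc_and (sW None)
    (nearc_and (sW (Some true)) (sW (Some false))))) => z [k0' [k1 [k2 k3]]].
  split => //; rewrite /symm k0' conjcM; congr (_ * _).
  by rewrite rmorphXn /= conjcB oo.
Qed.

(** As [n] is symmetric, conjugation exchanges the two eigenvalues; with [B] the reflection of [A]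
    it exchanges the two logarithms as well. Hence (A + B)/2 and (A - B)/(2 iota) are symmetric, the
    sign from exchanging [A] and [B] being offset by that of conjugating iota. *)
Lemma log_real o G : (o^*)%C = o -> nearc o (holq G) ->
    nearc o (fun z => G (z^*)%C = hc_conj (G z)) -> qdet (G o) != 0 ->
  exists L, nearc o (fun z => holq L z /\ hexp (L z) (G z)) /\
    nearc o (fun z => L (z^*)%C = hc_conj (L z)).
Proof.
move=> oo hG sG dG; have [h0 _ _ _] := nearc_hol4 hG; have [s0 _ _ _] := nearc_symm sG.
have [n [W1 [W2 [W3 [hh hW eG ss]]]]] := real_polar oo hG sG.
have n2 : n o ^+ 2 = vecnorm (G o).
  rewrite /vecnorm; have [-> -> ->] : [/\ q_i (G o) = n o * W1 o, q_j (G o) = n o * W2 o & q_k (G o) = n o * W3 o].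
    exact: nearc_self eG.
  have e := nearc_self hW.
  transitivity (n o ^+ 2 * (W1 o * W1 o + W2 o * W2 o + W3 o * W3 o)); first by rewrite e mulr1.
  by ring.
have : (q_re (G o) + i * n o) * (q_re (G o) - i * n o) != 0 by rewrite (qdet_factor _ n2).
rewrite mulf_eq0 negb_or => /andP[lo _].
have [A HA] : exists A, nearc o (fun z => hol A z /\ expc (A z) = q_re (G z) + i * n z).
  apply: (@local_log_exists _ o (fun z => q_re (G z) + i * n z)) lo.
  apply: nearcW (nearc_and h0 hh) => z [k1 [k2 _ _ _]]; apply: holD => //.
  by apply: holM => //; exact: hol_cst.
pose B z := ((A (z^*)%C)^*)%C.
have HB : nearc o (fun z => hol B z /\ expc (B z) = q_re (G z) - i * n z).
  apply: nearcW (nearc_and (nearc_conj oo HA) (nearc_and s0 ss)).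
  move=> z [[kA eA] [e0 [en _ _ _]]]; split; first exact: hol_reflect.
  rewrite /B expc_conj eA e0 en rmorphD /= conjcK; congr (_ + _).
  rewrite conjcM conjcK -mulNr; congr (_ * _).
  by apply/eqP; rewrite eq_complex /= oppr0 !eqxx.
have i0 : i != 0 := i_neq0.
exists (split_log A B W1 W2 W3); split.
  apply: (split_logP (n := n)) => //.
  - by apply: nearcW (nearc_and HA (nearc_and HB hh)) => z [[? _] [[? _] [_ ? ? ?]]].
  - by apply: nearcW HA => z [].
  - by apply: nearcW HB => z [].
apply: nearcW ss => z [_ e1 e2 e3].
have AB : A (z^*)%C = ((B z)^*)%C by rewrite /B conjcK.
have BA : B (z^*)%C = ((A z)^*)%C by rewrite /B conjcK.
have ic : ((2 * i)^-1^*)%C = - (2 * i)^-1.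
  rewrite conjc_inv conjcM conjc_nat -invrN -mulrN; congr (_ * _)^-1.
  by apply/eqP; rewrite eq_complex /= oppr0 !eqxx.
have key : (A (z^*)%C - B (z^*)%C) / (2 * i) = (((A z - B z) / (2 * i))^*)%C.
  by rewrite AB BA conjcM ic conjcB; move: ((A z)^*)%C ((B z)^*)%C => p q; ring.
apply: quat_ext; rewrite /split_log q_conjE !q_mkE ?key ?e1 ?e2 ?e3 ?conjcM//.
by rewrite AB BA conjc_inv conjc_nat rmorphD /= addrC.
Qed.

End StemLogarithm.

(** * Complex derivatives in MathComp-Analysis *)

Section Bridge.
Context {R : realType}.
Local Notation C := R[i].
Local Notation HC := (quat R[i]).

Lemma nbhs_nearc (z : C) (P : C -> Prop) : nbhs (z : C^o) P <-> nearc z P.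
Proof.
split.
  move=> /nbhs_ballP[e /= e0 H].
  (* In the order of [R[i]], a positive element is real. *)
  have [er eE] : exists x : R, e = x%:C%C.
    by move: e0; rewrite ltcE => /andP[/eqP h _]; exists (complex.Re e); case: e h {H} => x y /= ->.
  exists er; first by rewrite -ltcR -eE.
  by move=> w wz; apply: H; rewrite -ball_normE /= distrC nmE eE ltcR.
move=> [r r0 H]; apply/nbhs_ballP; exists r%:C%C => /=; first by rewrite ltcR.
by move=> w; rewrite -ball_normE /= distrC nmE ltcR => /H.
Qed.

Lemma derivable_hol (f : C -> C) (z : C) : derivable (f : C^o -> C^o) z 1 <-> hol f z.
Proof.
split.
  move=> /cvg_ex[/= d /cvgrPdist_lt Hd]; exists d; apply: cd_of_bound => e e0.
  have := Hd e%:C%C; rewrite ltcR => /(_ e0).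
  move=> /nbhs_nearc[r r0 Hr]; exists r => // w wz.
  have [->|wz0] := eqVneq w z; first by rewrite !subrr mulr0 subrr nm0 mulr0.
  have wz0' : w - z != 0 by rewrite subr_eq0.
  have := Hr (w - z); rewrite subr0 => /(_ wz wz0').
  rewrite /= scaler1 subrK nmE ltcR => h.
  have -> : f w - f z - d * (w - z) = - ((d - (w - z)^-1 *: (f w - f z)) * (w - z)).
    by rewrite /GRing.scale /=; field.
  by rewrite nmN nmM ler_wpM2r ?nm_ge0// ltW.
move=> [d hd]; apply/cvg_ex; exists d => /=; apply/cvgrPdist_lt => e e0.
have [er eE] : exists x : R, e = x%:C%C.
  by move: e0; rewrite ltcE => /andP[/eqP h _]; exists (complex.Re e); case: e h => x y /= ->.
have er0 : 0 < er by rewrite -ltcR -eE.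
have er20 : 0 < er / 2 by lra.
have [r r0 Hr] := cd_bound hd er20.
apply/nbhs_nearc; exists r => // h; rewrite subr0 => hr h0.
have := Hr (h + z); rewrite addrK => /(_ hr) B.
rewrite scaler1 nmE eE ltcR.
have -> : d - h^-1 *: (f (h + z) - f z) = - ((f (h + z) - f z - d * h) * h^-1).
  by rewrite /GRing.scale /=; field.
rewrite nmN nmM nmV ltr_pdivrMr ?nm_gt0//; apply: (le_lt_trans B).
by rewrite ltr_pM2r ?nm_gt0//; lra.
Qed.


Lemma cvg_coord (K : numFieldType) (n : nat) (T : Type) (FF : set_system T) (hF : Filter FF)
    (u : T -> 'rV[K]_n) (L : 'rV[K]_n) :
  (forall j, (fun t => u t 0 j : K^o) @ FF --> (L 0 j : K^o)) -> u @ FF --> L.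
Proof.
move=> H; apply/cvg_ballP => e e0.
have : \forall t \near FF, forall j, ball (L 0 j : K^o) e (u t 0 j).
  by apply: filter_forall => j; have /cvg_ballP/(_ _ e0) := H j.
by apply: filterS => t Ht; split => // k j; rewrite ord1; exact: Ht.
Qed.

Lemma coord_cases (P : 'I_4 -> Prop) :
  P 0 -> P 1 -> P 2 -> P 3 -> forall j, P j.
Proof.
move=> p0 p1 p2 p3 [[|[|[|[|//]]]] h].
- by move: p0; congr P; exact/val_inj.
- by move: p1; congr P; exact/val_inj.
- by move: p2; congr P; exact/val_inj.
- by move: p3; congr P; exact/val_inj.
Qed.

Lemma derivable_holq (F : C -> HC) (z : C) : derivable (F : C^o -> HC) z 1 <-> holq F z.
Proof.
have coord j : derivable (F : C^o -> HC) z 1 -> hol (fun w => (F w : 'rV[C]_4) 0 j) z.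
  move=> /cvg_ex[/= d Hd]; apply/derivable_hol/cvg_ex; exists (d 0 j).
  apply/cvg_ballP => e e0; have /cvg_ballP/(_ _ e0) := Hd.
  by apply: filterS => h [_ /(_ 0 j)]; rewrite /= !mxE.
split=> [H|[h0 h1 h2 h3]].
  by split; [exact: (coord 0 H)|exact: (coord 1 H)|exact: (coord 2 H)|exact: (coord 3 H)].
have hj j : hol (fun w => (F w : 'rV[C]_4) 0 j) z.
  by move: j; apply: coord_cases.
have Hj j : exists d, (fun h : C^o => h^-1 *: (((fun w => (F w : 'rV[C]_4) 0 j) \o shift z)
    (h *: 1) - (F z : 'rV[C]_4) 0 j)) @ 0^' --> (d : C^o).
  by have /derivable_hol/cvg_ex := hj j.
have /choice[d Hd] := Hj.
apply/cvg_ex; exists (\row_j d j); apply: cvg_coord => j; rewrite mxE.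
apply: cvg_trans (Hd j); apply: near_eq_cvg; near=> h.
by rewrite /= !mxE.
Unshelve. all: by end_near. Qed.

End Bridge.

(** * Slice geometry *)

Section SliceGeometry.
Context {R : realType}.
Local Notation H := (quat R).
Local Notation C := R[i].
Local Notation HC := (quat R[i]).
Implicit Types (q J p : H) (z o : C) (x y r : R) (w : HC) (Omega : set H).

Definition vecnorm2 q : R := q_i q ^+ 2 + q_j q ^+ 2 + q_k q ^+ 2.

(** The fibres of [sig] are the spheres x + S y, each represented by its point of the closed upper
    half-plane; sets defined through [sig] are axially symmetric. *)
Definition sig q : C := (q_re q +i* Num.sqrt (vecnorm2 q))%C.

Lemma imag_unitsI J : q_re J = 0 -> vecnorm2 J = 1 -> imag_units J.
Proof.
rewrite /vecnorm2 /imag_units /= expr2 => J0 J1; rewrite -[LHS]/(Defs.mulq J J).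
rewrite -[1]/(Defs.oneq R) -scaleN1r.
apply: quat_ext; rewrite q_ZE /Defs.mulq /Defs.oneq !q_mkE J0.
- by rewrite mulN1r -J1; ring.
- by ring.
- by ring.
- by ring.
Qed.

Lemma slice_coords x y J : imag_units J ->
  q_re (x%:A + y *: J) = x /\ vecnorm2 (x%:A + y *: J) = y ^+ 2.
Proof.
move=> /imag_unitsE[J0 J1]; split.
  by rewrite q_DE !q_ZE J0 mulr0 addr0 -[1]/(Defs.oneq R) q_mkE mulr1.
by rewrite /vecnorm2 !q_DE !q_ZE -[1]/(Defs.oneq R) !q_mkE -[RHS]mulr1 -J1; ring.
Qed.

Lemma sig_slice x y J : imag_units J -> sig (x%:A + y *: J) = (x +i* `|y|)%C.
Proof. by move=> /(slice_coords x y)[e1 e2]; rewrite /sig e1 e2 sqrtr_sqr. Qed.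

Lemma slice_decomposition q : exists2 J, imag_units J &
  q = (q_re q)%:A + Num.sqrt (vecnorm2 q) *: J.
Proof.
have v0 : 0 <= vecnorm2 q by rewrite !addr_ge0 ?sqr_ge0.
have [s0|s0] := eqVneq (Num.sqrt (vecnorm2 q)) 0.
  have [J uJ] := @imag_units_neq0 R; exists J => //.
  rewrite s0 scale0r addr0; have e : vecnorm2 q = 0 by rewrite -(sqr_sqrtr v0) s0 expr0n.
  have [h1 h2 h3] : [/\ q_i q = 0, q_j q = 0 & q_k q = 0].
    move: e; rewrite /vecnorm2 => e.
    have := sqr_ge0 (q_i q); have := sqr_ge0 (q_j q); have := sqr_ge0 (q_k q).
    by split; apply/eqP; rewrite -sqrf_eq0; apply/eqP; lra.
  by apply: quat_ext; rewrite q_ZE -[1]/(Defs.oneq R) !q_mkE ?mulr1 ?mulr0.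
set s := Num.sqrt _ in s0 *; pose J := s^-1 *: (q - (q_re q)%:A).
have EJ : [/\ q_re J = 0, q_i J = s^-1 * q_i q, q_j J = s^-1 * q_j q & q_k J = s^-1 * q_k q].
  have one : (q_re (1 : H) = 1) * (q_i (1 : H) = 0) * (q_j (1 : H) = 0) * (q_k (1 : H) = 0).
    by rewrite -[1]/(Defs.oneq R) !q_mkE.
  by rewrite /J -scaleNr !(q_ZE, q_DE) !one; split; ring.
have [J0 J1 J2 J3] := EJ.
exists J; last by rewrite /J scalerA divff// scale1r addrC subrK.
apply: imag_unitsI => //; rewrite /vecnorm2 J1 J2 J3.
transitivity (s^-1 ^+ 2 * vecnorm2 q); first by rewrite /vecnorm2; ring.
by rewrite exprVn sqr_sqrtr// mulVf// -(sqr_sqrtr v0) expf_eq0.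
Qed.

(** For w = P + iota Q, [qdet w] is |P|^2 - |Q|^2 + 2 iota <P, Q>. Its vanishing is exactly what
    makes P + J Q = 0 solvable by an imaginary unit J, so a zero of the norm form is a zero of the
    slice function on that sphere. *)
Lemma qdet_neq0 w : (forall J, imag_units J -> hc1 w + J * hc2 w <> 0) -> qdet w != 0.
Proof.
move=> Hw; apply/eqP => dw.
have Q1 : (q_re (hc1 w) = complex.Re (q_re w)) * (q_i (hc1 w) = complex.Re (q_i w)) *
  (q_j (hc1 w) = complex.Re (q_j w)) * (q_k (hc1 w) = complex.Re (q_k w)).
  by rewrite /q_re /q_i /q_j /q_k !mxE.
have Q2 : (q_re (hc2 w) = complex.Im (q_re w)) * (q_i (hc2 w) = complex.Im (q_i w)) *
  (q_j (hc2 w) = complex.Im (q_j w)) * (q_k (hc2 w) = complex.Im (q_k w)).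
  by rewrite /q_re /q_i /q_j /q_k !mxE.
have [e1 e2] : complex.Re (qdet w) = 0 /\ complex.Im (qdet w) = 0 by rewrite dw.
move: e1 e2 Q1 Q2 Hw; rewrite /qdet /vecnorm; move: (hc1 w) (hc2 w).
case: (q_re w) (q_i w) (q_j w) (q_k w) => p0 s0 [p1 s1] [p2 s2] [p3 s3] P Q /= e1 e2 Q1 Q2 Hw.
pose N := s0 * s0 + s1 * s1 + s2 * s2 + s3 * s3.
have PN : p0 * p0 + p1 * p1 + p2 * p2 + p3 * p3 = N by rewrite /N; lra.
have PQ : p0 * s0 + p1 * s1 + p2 * s2 + p3 * s3 = 0 by lra.
have [N0|N0] := eqVneq N 0.
  have z4 (a b c d : R) : a * a + b * b + c * c + d * d = 0 -> [/\ a = 0, b = 0, c = 0 & d = 0].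
    move=> e; have := sqr_ge0 a; have := sqr_ge0 b; have := sqr_ge0 c; have := sqr_ge0 d.
    rewrite !expr2 => ? ? ? ?.
    by split; apply/eqP; rewrite -sqrf_eq0 expr2; apply/eqP; lra.
  have [a0 a1 a2 a3] := z4 _ _ _ _ N0.
  have [b0 b1 b2 b3] : [/\ p0 = 0, p1 = 0, p2 = 0 & p3 = 0] by apply: z4; rewrite PN.
  have [J uJ] := @imag_units_neq0 R; apply: (Hw J uJ).
  have -> : Q = 0 by apply: quat_ext; rewrite Q2 ?a0 ?a1 ?a2 ?a3 /q_re /q_i /q_j /q_k mxE.
  by rewrite mulr0 addr0; apply: quat_ext; rewrite Q1 ?b0 ?b1 ?b2 ?b3 /q_re /q_i /q_j /q_k mxE.
(* J = - P Q^-1 solves P + J Q = 0, and is a unit because |P| = |Q| and <P, Q> = 0. *)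
pose J : H := qmk 0
  ((p0 * s1 - p1 * s0 + p2 * s3 - p3 * s2) / N)
  ((p0 * s2 - p1 * s3 - p2 * s0 + p3 * s1) / N)
  ((p0 * s3 + p1 * s2 - p2 * s1 - p3 * s0) / N).
apply: (Hw J).
  apply: imag_unitsI; rewrite ?q_mkE// /vecnorm2 !q_mkE.
  transitivity (((p0 * p0 + p1 * p1 + p2 * p2 + p3 * p3) * N
    - (p0 * s0 + p1 * s1 + p2 * s2 + p3 * s3) ^+ 2) / N ^+ 2).
    by rewrite /N; field.
  by rewrite PN PQ expr0n /= subr0 -expr2 divff// expf_eq0.
have zero : (q_re (0 : H) = 0) * (q_i (0 : H) = 0) * (q_j (0 : H) = 0) * (q_k (0 : H) = 0).
  by rewrite /q_re /q_i /q_j /q_k !mxE.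
have NE : N != 0 := N0.
apply: quat_ext; rewrite q_DE Q1 zero -[J * Q]/(Defs.mulq J Q) /Defs.mulq !q_mkE !Q2.
- transitivity (s0 * (p0 * s0 + p1 * s1 + p2 * s2 + p3 * s3) / N); last by rewrite PQ mulr0 mul0r.
  by rewrite /N in NE *; field.
- transitivity (s1 * (p0 * s0 + p1 * s1 + p2 * s2 + p3 * s3) / N); last by rewrite PQ mulr0 mul0r.
  by rewrite /N in NE *; field.
- transitivity (s2 * (p0 * s0 + p1 * s1 + p2 * s2 + p3 * s3) / N); last by rewrite PQ mulr0 mul0r.
  by rewrite /N in NE *; field.
- transitivity (s3 * (p0 * s0 + p1 * s1 + p2 * s2 + p3 * s3) / N); last by rewrite PQ mulr0 mul0r.
  by rewrite /N in NE *; field.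
Qed.

(** The value of [sig] at any x + y J with z = x + iota y; a disc condition on [upz z] describes a
    set invariant under conjugation. *)
Definition upz z : C := (complex.Re z +i* `|complex.Im z|)%C.

Lemma upz_ge0 z : 0 <= complex.Im z -> upz z = z.
Proof. by case: z => x y /= h; rewrite /upz /= ger0_norm. Qed.

Lemma upz_le0 z : complex.Im z <= 0 -> upz z = (z^*)%C.
Proof. by case: z => x y /= h; rewrite /upz /= ler0_norm. Qed.

Lemma hc_conjK : involutive (@hc_conj R).
Proof. by move=> w; apply: quat_ext; rewrite !q_conjE conjcK. Qed.

Lemma holq_reflect (F : C -> HC) z : holq F (z^*)%C -> holq (fun v => hc_conj (F (v^*)%C)) z.
Proof.
move=> [h0 h1 h2 h3]; split.
- by apply: hol_near (hol_reflect h0); apply: nearc_all => v; rewrite q_conjE.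
- by apply: hol_near (hol_reflect h1); apply: nearc_all => v; rewrite q_conjE.
- by apply: hol_near (hol_reflect h2); apply: nearc_all => v; rewrite q_conjE.
- by apply: hol_near (hol_reflect h3); apply: nearc_all => v; rewrite q_conjE.
Qed.

Lemma nearc_Im_gt0 z : 0 < complex.Im z -> nearc z (fun v => 0 < complex.Im v).
Proof.
move=> z0; exists (complex.Im z) => // v vz.
have := nm_Im (v - z); rewrite ler_norml => /andP[h _]; move: h vz.
by case: v z {z0} => a b [c d] /=; lra.
Qed.

Lemma nearc_Im_lt0 z : complex.Im z < 0 -> nearc z (fun v => complex.Im v < 0).
Proof.
move=> z0; exists (- complex.Im z); first by rewrite oppr_gt0.
move=> v vz; have := nm_Im (v - z); rewrite ler_norml => /andP[_ h]; move: h vz.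
by case: v z {z0} => a b [c d] /=; lra.
Qed.

(** For real [o] the symmetric logarithm is used on one disc. Otherwise the disc is taken inside the
    upper half-plane, hence disjoint from its mirror image, and reflection defines the logarithm on
    the latter. *)
Lemma local_stem_log (G : C -> HC) o : 0 <= complex.Im o -> nearc o (holq G) ->
    nearc o (fun z => G (z^*)%C = hc_conj (G z)) -> qdet (G o) != 0 ->
  exists2 r, 0 < r & exists F : C -> HC, forall z, nm (upz z - o) < r ->
    [/\ holq F z, F (z^*)%C = hc_conj (F z) & hexp (F z) (G z)].
Proof.
move=> o0 hG sG dG; move: o0; rewrite le_eqVlt => /orP[/eqP o0|o0].
  have oo : (o^*)%C = o by case: o o0 {hG sG dG} => x y /= <-; rewrite oppr0.
  have [L [HL sL]] := log_real oo hG sG dG.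
  have [r r0 Hr] := nearc_and HL sL; exists r => //; exists L => z zr.
  have zo : nm (z - o) < r.
    have [h|/ltW h] := leP 0 (complex.Im z); first by rewrite -(upz_ge0 h).
    by rewrite -nm_conj conjcB oo -(upz_le0 h).
  by have [[h1 h2] h3] := Hr z zo.
have [L HL] := log_generic hG dG.
have [r1 r10 Hr] := nearc_and (nearc_Im_gt0 o0) (nearc_and HL sG); exists r1 => //.
exists (fun z => if 0 < complex.Im z then L z else hc_conj (L (z^*)%C)) => z zr.
have ImJ v : complex.Im (v^*)%C = - complex.Im v by case: v.
have [h|h|h] := ltgtP 0 (complex.Im z).
- have [_ [[k1 k2] _]] : 0 < complex.Im z /\ (holq L z /\ hexp (L z) (G z)) /\
      G (z^*)%C = hc_conj (G z) by apply: Hr; rewrite -(upz_ge0 (ltW h)).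
  split => //.
    by apply: holq_near k1; apply: nearcW (nearc_Im_gt0 h) => v ->.
  by rewrite ImJ oppr_gt0 ltNge (ltW h) /= conjcK.
- have [_ [[k1 k2] k3]] : 0 < complex.Im (z^*)%C /\ (holq L (z^*)%C /\
      hexp (L (z^*)%C) (G (z^*)%C)) /\ G ((z^*)^*)%C = hc_conj (G (z^*)%C).
    by apply: Hr; rewrite -(upz_le0 (ltW h)).
  split.
  + apply: holq_near (holq_reflect k1); apply: nearcW (nearc_Im_lt0 h) => v v0.
    by rewrite ltNge (ltW v0).
  + by rewrite ImJ oppr_gt0 h hc_conjK.
  + by rewrite -(conjcK z) k3 conjcK; exact: hexp_conj.
(* Real points do not occur: the disc lies in the open upper half-plane. *)
- have [] := Hr (upz z) zr; by rewrite /upz /= -h normr0 ltxx.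
Qed.

Lemma Re_sub (z v : C) : complex.Re (z - v) = complex.Re z - complex.Re v.
Proof. by case: z v => ? ? []. Qed.

Lemma Im_sub (z v : C) : complex.Im (z - v) = complex.Im z - complex.Im v.
Proof. by case: z v => ? ? []. Qed.

Lemma open_Omega_iota Omega z : open Omega -> Omega_iota Omega z -> nearc z (Omega_iota Omega).
Proof.
move=> oO [J uJ OJ]; have := open_nbhs_nbhs (conj oO OJ).
move=> /nbhs_ballP[e /= e0 He].
pose k : R := `|1 : H| + `|J| + 1; have k0 : 0 < k.
  by rewrite /k; have := normr_ge0 (1 : H); have := normr_ge0 J; lra.
exists (e / k); first by rewrite divr_gt0.
move=> v vz; exists J => //; apply: He; rewrite -ball_normE /=.
set dx := complex.Re z - complex.Re v; set dy := complex.Im z - complex.Im v.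
have -> : (complex.Re z)%:A + complex.Im z *: J - ((complex.Re v)%:A + complex.Im v *: J) =
    dx%:A + dy *: J by rewrite /dx /dy !scalerBl opprD addrACA.
apply: (le_lt_trans (ler_normD _ _)); rewrite !normrZ.
have hx : `|dx| <= nm (v - z).
  by rewrite nm_distC /dx -Re_sub nm_Re.
have hy : `|dy| <= nm (v - z).
  by rewrite nm_distC /dy -Im_sub nm_Im.
rewrite ltr_pdivlMr// in vz; apply: le_lt_trans vz.
have b1 : `|dx| * `|1 : H| <= nm (v - z) * `|1 : H| by rewrite ler_wpM2r.
have b2 : `|dy| * `|J| <= nm (v - z) * `|J| by rewrite ler_wpM2r.
by rewrite /k; have := nm_ge0 (v - z); lra.
Qed.

Lemma continuous_sig_dist o : continuous (fun q : H => nm (sig q - o) : R).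
Proof.
have cc j : continuous (fun q : H => (q : 'rV[R]_4) 0 j) by exact: coord_continuous.
case: o => a b q.
have sqc (f : H -> R) : {for q, continuous f} -> {for q, continuous (fun p => f p ^+ 2)}.
  by move=> cf; apply: (@continuous_comp _ _ _ f (fun x : R => x ^+ 2)) => //; exact: exprn_continuous.
have sqrtc (f : H -> R) : {for q, continuous f} -> {for q, continuous (fun p => Num.sqrt (f p))}.
  by move=> cf; apply: (@continuous_comp _ _ _ f (@Num.sqrt R)) => //; exact: sqrt_continuous.
have addc (f g : H -> R) : {for q, continuous f} -> {for q, continuous g} ->
    {for q, continuous (fun p => f p + g p)} by move=> cf cg; exact: (cvgD cf cg).
have subc (f : H -> R) (k : R) : {for q, continuous f} ->
    {for q, continuous (fun p => f p - k)} by move=> cf; exact: (addc _ _ cf (@cst_continuous _ _ (- k) q)).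
have k1 := sqc _ (cc 1 q); have k2 := sqc _ (cc 2 q); have k3 := sqc _ (cc 3 q).
have kv := sqc _ (subc _ b (sqrtc _ (addc _ _ (addc _ _ k1 k2) k3))).
exact: sqrtc _ (addc _ _ (sqc _ (subc _ a (cc 0 q))) kv).
Qed.

Definition sig_ball o r : set H := [set q | nm (sig q - o) < r].

Lemma open_sig_ball o r : open (sig_ball o r).
Proof.
apply: (@open_comp _ _ (fun q : H => nm (sig q - o)) [set x | x < r]); last exact: open_lt.
by move=> q _; exact: continuous_sig_dist.
Qed.

Lemma axially_symmetric_sig_ball o r : axially_symmetric (sig_ball o r).
Proof. by move=> x y I J uI uJ; rewrite /sig_ball /= !sig_slice. Qed.

Lemma seqlim_Re (p : nat -> C) L : seqlim p L ->
  (fun n => complex.Re (p n)) @ \oo --> complex.Re L.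
Proof.
move=> Hp; apply/cvgrPdist_lt => e /Hp[N HN]; exists N => // n /HN.
by rewrite nm_distC -Re_sub; apply: le_lt_trans; exact: nm_Re.
Qed.

Lemma seqlim_Im (p : nat -> C) L : seqlim p L ->
  (fun n => complex.Im (p n)) @ \oo --> complex.Im L.
Proof.
move=> Hp; apply/cvgrPdist_lt => e /Hp[N HN]; exists N => // n /HN.
by rewrite nm_distC -Im_sub; apply: le_lt_trans; exact: nm_Im.
Qed.

(** For fixed [J], each coordinate is a real linear combination of the real and imaginary parts of
    the four coordinates, so coordinatewise limits suffice. *)
Lemma hexp_slice_cvg w v J : hexp w v ->
  (fun n => hc1 (qsum w n) + J * hc2 (qsum w n)) @ \oo --> hc1 v + J * hc2 v.
Proof.
move=> [l0 l1 l2 l3].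
have [r0 r1 r2 r3] := And4 (seqlim_Re l0) (seqlim_Re l1) (seqlim_Re l2) (seqlim_Re l3).
have [i0 i1 i2 i3] := And4 (seqlim_Im l0) (seqlim_Im l1) (seqlim_Im l2) (seqlim_Im l3).
have Q1 u : (q_re (hc1 u) = complex.Re (q_re u)) * (q_i (hc1 u) = complex.Re (q_i u)) *
  (q_j (hc1 u) = complex.Re (q_j u)) * (q_k (hc1 u) = complex.Re (q_k u)).
  by rewrite /q_re /q_i /q_j /q_k !mxE.
have Q2 u : (q_re (hc2 u) = complex.Im (q_re u)) * (q_i (hc2 u) = complex.Im (q_i u)) *
  (q_j (hc2 u) = complex.Im (q_j u)) * (q_k (hc2 u) = complex.Im (q_k u)).
  by rewrite /q_re /q_i /q_j /q_k !mxE.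
have M u : J * hc2 u = Defs.mulq J (hc2 u) by [].
have lin (c0 c1 c2 c3 : R) (p0 p1 p2 p3 p4 : nat -> R) (L0 L1 L2 L3 L4 : R) :
    p4 @ \oo --> L4 -> p0 @ \oo --> L0 -> p1 @ \oo --> L1 -> p2 @ \oo --> L2 ->
    p3 @ \oo --> L3 ->
    (fun n => p4 n + (c0 * p0 n + c1 * p1 n + c2 * p2 n + c3 * p3 n)) @ \oo -->
    L4 + (c0 * L0 + c1 * L1 + c2 * L2 + c3 * L3).
  move=> h4 h0 h1 h2 h3; apply: cvgD => //.
  have Z (c : R) (p : nat -> R) l : p @ \oo --> l -> (fun n => c * p n) @ \oo --> c * l.
    by move=> hp; apply: cvgM => //; exact: cvg_cst.
  exact: (cvgD (cvgD (cvgD (Z c0 _ _ h0) (Z c1 _ _ h1)) (Z c2 _ _ h2)) (Z c3 _ _ h3)).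
have E0 u : q_re (hc1 u + J * hc2 u) = complex.Re (q_re u) +
    ((q_re J) * complex.Im (q_re u) + (- q_i J) * complex.Im (q_i u) +
     (- q_j J) * complex.Im (q_j u) + (- q_k J) * complex.Im (q_k u)).
  by rewrite q_DE Q1 M /Defs.mulq q_mkE !Q2; ring.
have E1 u : q_i (hc1 u + J * hc2 u) = complex.Re (q_i u) +
    ((q_i J) * complex.Im (q_re u) + (q_re J) * complex.Im (q_i u) +
     (- q_k J) * complex.Im (q_j u) + (q_j J) * complex.Im (q_k u)).
  by rewrite q_DE Q1 M /Defs.mulq q_mkE !Q2; ring.
have E2 u : q_j (hc1 u + J * hc2 u) = complex.Re (q_j u) +
    ((q_j J) * complex.Im (q_re u) + (q_k J) * complex.Im (q_i u) +
     (q_re J) * complex.Im (q_j u) + (- q_i J) * complex.Im (q_k u)).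
  by rewrite q_DE Q1 M /Defs.mulq q_mkE !Q2; ring.
have E3 u : q_k (hc1 u + J * hc2 u) = complex.Re (q_k u) +
    ((q_k J) * complex.Im (q_re u) + (- q_j J) * complex.Im (q_i u) +
     (q_i J) * complex.Im (q_j u) + (q_re J) * complex.Im (q_k u)).
  by rewrite q_DE Q1 M /Defs.mulq q_mkE !Q2; ring.
pose S n := hc1 (qsum w n) + J * hc2 (qsum w n); pose L := hc1 v + J * hc2 v.
suff [k0 k1 k2 k3] : [/\ (fun n => q_re (S n)) @ \oo --> q_re L,
    (fun n => q_i (S n)) @ \oo --> q_i L, (fun n => q_j (S n)) @ \oo --> q_j L &
    (fun n => q_k (S n)) @ \oo --> q_k L].
  by apply: (@cvg_coord R 4 nat \oo _ S L); apply: coord_cases.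
have Lc (c : H -> R) (d : HC -> R) : (forall u, c (hc1 u + J * hc2 u) = d u) ->
    (fun n => d (qsum w n)) @ \oo --> d v -> (fun n => c (S n)) @ \oo --> c L.
  move=> h; have -> : (fun n => c (S n)) = (fun n => d (qsum w n)).
    by apply: funext => n; exact: h.
  by rewrite /L h.
split.
- by apply: (Lc _ _ E0); exact: (lin _ _ _ _ _ _ _ _ _ _ _ _ _ _ r0 i0 i1 i2 i3).
- by apply: (Lc _ _ E1); exact: (lin _ _ _ _ _ _ _ _ _ _ _ _ _ _ r1 i0 i1 i2 i3).
- by apply: (Lc _ _ E2); exact: (lin _ _ _ _ _ _ _ _ _ _ _ _ _ _ r2 i0 i1 i2 i3).
- by apply: (Lc _ _ E3); exact: (lin _ _ _ _ _ _ _ _ _ _ _ _ _ _ r3 i0 i1 i2 i3).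
Qed.

End SliceGeometry.

(** * The star exponential *)

Section StarExponential.
Context {R : realType}.
Local Notation H := (quat R).
Local Notation C := R[i].
Local Notation HC := (quat R[i]).
Implicit Types (q J : H) (z o : C) (x y r : R) (w : HC) (Omega U : set H).

Lemma hc1D (v w : HC) : hc1 (v + w) = hc1 v + hc1 w.
Proof. by apply/rowP => k; rewrite !mxE Re_add. Qed.

Lemma hc2D (v w : HC) : hc2 (v + w) = hc2 v + hc2 w.
Proof. by apply/rowP => k; rewrite !mxE Im_add. Qed.

Lemma hc1Z (a : R) w : hc1 (a%:C%C *: w) = a *: hc1 w.
Proof. by apply/rowP => k; rewrite !mxE Re_real_mul. Qed.

Lemma hc2Z (a : R) w : hc2 (a%:C%C *: w) = a *: hc2 w.
Proof. by apply/rowP => k; rewrite !mxE Im_real_mul. Qed.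

(** The star powers of [f] are induced by the pointwise powers of [F], and the coefficients 1/n! are
    real, hence commute with [hc1] and [hc2]: the partial sums of [exp_star] are the slice values of
    [qsum]. *)
Lemma exp_star_slice U (F : C -> HC) (f : H -> H) x y J v : axially_symmetric U ->
    stem_function U F -> induces U F f -> imag_units J -> U (x%:A + y *: J) ->
    hexp (F (x +i* y)%C) v ->
  exp_star U f (x%:A + y *: J) = hc1 v + J * hc2 v.
Proof.
move=> aU sF iF uJ UJ hv; rewrite /exp_star; apply: cvg_lim; first exact: norm_hausdorff.
set w := F (x +i* y)%C in hv.
rewrite [X in X @ _ --> _](_ : _ = (fun n => hc1 (qsum w n) + J * hc2 (qsum w n))).
  exact: hexp_slice_cvg.
apply: funext; elim=> [|n IH].
  rewrite /series /= big_geq// qsum0.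
  have -> : hc1 0 = 0 :> H by apply/rowP => k; rewrite !mxE.
  have -> : hc2 0 = 0 :> H by apply/rowP => k; rewrite !mxE.
  by rewrite mulr0 addr0.
rewrite /series /= big_nat_recr//= -/(series _ n) in IH *.
rewrite IH qsumS; have [_ iS] := induces_star_pow n aU sF iF.
rewrite (iS _ _ _ uJ UJ) -/w.
have -> : (n`!%:R : C)^-1 = ((n`!%:R : R)^-1)%:C%C by rewrite fmorphV /= rmorph_nat.
rewrite hc1D hc2D hc1Z hc2Z scalerDr mulrDr -scalerAr.
by rewrite addrACA.
Qed.

End StarExponential.

Unset Implicit Arguments.

Theorem mainTheorem3 (R : realType) (Omega : set (quat R)) (g : quat R -> quat R)
    (hOmega : basic_domain Omega) (hg : slice_regular Omega g)
    (hg0 : forall q, Omega q -> g q <> 0) :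
  forall z, Omega z ->
    exists U : set (quat R),
      [/\ open U, axially_symmetric U, U z, U `<=` Omega &
          exists2 f : quat R -> quat R, slice_regular U f &
            forall q, U q -> exp_star U f q = g q].
Proof.
have [[oO _] aO _] := hOmega; have [G [sG hG iG]] := hg; move=> q Oq.
(* By axial symmetry, membership in [Omega] depends only on [sig p]. *)
have in_Oi p : Omega p -> Omega_iota Omega (sig p).
  by move=> Op; have [J uJ pE] := slice_decomposition p; exists J => //=; rewrite -pE.
have from_Oi p : Omega_iota Omega (sig p) -> Omega p.
  move=> [I uI OI]; have [J uJ ->] := slice_decomposition p; exact: aO uI uJ OI.
have Oo := in_Oi _ Oq; set o := sig q in Oo.
have nO := open_Omega_iota oO Oo.
have o0 : 0 <= complex.Im o by exact: sqrtr_ge0.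
have hqG : nearc o (holq G) by apply: nearcW nO => z /hG/derivable_holq.
have syG : nearc o (fun z => G (z^*)%C = hc_conj (G z)) by apply: nearcW nO => z /sG.
(* As [J] varies, G_1(o) + J G_2(o) runs over the values of [g] on the whole sphere of [q], which
   lies in [Omega]. *)
have dG : qdet (G o) != 0.
  apply: qdet_neq0 => J uJ; have [I uI OI] := Oo.
  have OJ := aO _ _ _ _ uI uJ OI.
  have := iG _ _ _ uJ OJ; move=> <-; exact: hg0.
have [r1 r10 [F HF]] := local_stem_log o0 hqG syG dG.
(* [r1] secures the stem logarithm on the disc and its mirror image, [r2] the inclusion of the
   neighbourhood in [Omega]. *)
have [r2 r20 Hr2] := nO; pose r := Num.min r1 r2.
have r0 : 0 < r by rewrite lt_min r10.
have inU z : Omega_iota (sig_ball o r) z -> nm (upz z - o) < r.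
  by move=> [I uI]; rewrite /sig_ball /= sig_slice.
have F_at z : Omega_iota (sig_ball o r) z ->
    [/\ holq F z, F (z^*)%C = hc_conj (F z) & hexp (F z) (G z)].
  by move=> /inU; rewrite lt_min => /andP[/HF].
have sF : stem_function (sig_ball o r) F by move=> z /F_at[].
have aU : axially_symmetric (sig_ball o r) by exact: axially_symmetric_sig_ball.
have sub : sig_ball o r `<=` Omega.
  move=> p; rewrite /sig_ball /= lt_min => /andP[_ /Hr2]; exact: from_Oi.
exists (sig_ball o r); split => //.
- exact: open_sig_ball.
- by rewrite /sig_ball /= subrr nm0.
exists (slice_fun F).
  exists F; split => //; last exact: slice_funP.
  by move=> z /F_at[hF _ _]; apply/derivable_holq.
move=> p Up; have [J uJ pE] := slice_decomposition p.
have UJ : sig_ball o r ((q_re p)%:A + Num.sqrt (vecnorm2 p) *: J) by rewrite -pE.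
have Uz : Omega_iota (sig_ball o r) (q_re p +i* Num.sqrt (vecnorm2 p))%C by exists J.
have [_ _ eF] := F_at _ Uz.
rewrite pE (exp_star_slice aU sF (slice_funP sF) uJ UJ eF).
by rewrite (iG _ _ _ uJ (sub _ UJ)).
Qed.
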